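(* Let $s>\frac32$ and let $\varpi_0\in H^s(\mathbb{T})$ be real-valued with $\int_{\mathbb{T}}\varpi_0=0$. Consider the Cauchy problem $$\varpi_t-\tfrac12(\varpi H\varpi)_\sigma=0,\qquad \varpi(\sigma,0)=\varpi_0(\sigma).$$ If there exists a point $\sigma_0\in\mathbb{T}$ such that $\varpi_0(\sigma_0)>0$ and $\varpi_0$ is not $C^\infty$ at $\sigma_0$ (i.e. $\varpi_0$ is not $C^\infty$ on any neighbourhood of $\sigma_0$), then for no $T>0$ does there exist a solution of this problem in the class $C([0,T);H^s(\mathbb{T}))$. In addition, $\varpi_0\in C^\infty$ is not sufficient to obtain existence: there exist mean-zero initial data $\varpi_0\in C^\infty(\mathbb{T})$ for which there is no solution of this problem in $C([0,T);H^s(\mathbb{T}))$ for any $s>\frac32$ and $T>0$.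
   Context: $\mathbb{T}$ is the circle of length $2\pi$, $H^s(\mathbb{T})$ is the usual Sobolev space of periodic functions, and $H$ (as an operator) is the periodic Hilbert transform $$H\varpi(\sigma)=\frac1\pi PV\int_{-\pi}^{\pi}\frac{\varpi(\tau)}{2\tan((\sigma-\tau)/2)}\,d\tau .$$ Subscripts $t$ and $\sigma$ denote partial derivatives. Solutions are real-valued. *)

(* Defs.v *)
From Stdlib Require Import Reals.
From Coquelicot Require Import Coquelicot.
Open Scope R_scope.

(* Functions on the circle of length 2 PI are 2 PI-periodic functions R -> R. *)
Definition periodic (f : R -> R) : Prop := forall x, f (x + 2 * PI) = f x.

(* (1 / 2 PI) * int_{-PI}^{PI} f(x) exp(- i n x) dx, as a pair (real part,
   imaginary part) *)
Definition fourier (f : R -> R) (n : Z) : C :=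
  ( / (2 * PI) * RInt (fun x => f x * cos (IZR n * x)) (- PI) PI,
    - (/ (2 * PI) * RInt (fun x => f x * sin (IZR n * x)) (- PI) PI)).

Definition sobolev_weight (s : R) (f : R -> R) (n : Z) : R :=
  Rpower (1 + IZR n ^ 2) s * Cmod (fourier f n) ^ 2.

(* The sum over Z of the (nonnegative) weights is taken over the pairs
   {k, - (k + 1)}, k >= 0, which partition Z. *)
Definition sobolev_pair (s : R) (f : R -> R) (k : nat) : R :=
  sobolev_weight s f (Z.of_nat k) + sobolev_weight s f (- Z.of_nat (S k)).

(* Membership in H^s(T), meant for s > 1/2: by the Sobolev embedding every
   element of H^s(T) then has exactly one continuous representative, and an
   element is identified with it, so that pointwise values make sense and
   Riemann integrals suffice. *)
Definition in_Hs (s : R) (f : R -> R) : Prop :=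
  periodic f /\ (forall x, continuous f x) /\ ex_series (sobolev_pair s f).

Definition Hs_norm (s : R) (f : R -> R) : R :=
  sqrt (Series (sobolev_pair s f)).

(* The arc |x - y| < e of the circle is removed; by periodicity the rest is
   integrated over the period [x - PI, x + PI] instead of [- PI, PI]. *)
Definition hilbert_trunc (f : R -> R) (x e : R) : R :=
  RInt (fun y => f y / (2 * tan ((x - y) / 2))) (x - PI) (x - e) +
  RInt (fun y => f y / (2 * tan ((x - y) / 2))) (x + e) (x + PI).

(* [iota P] is the unique real satisfying P, if there is one; here it is the
   principal value, which exists for f in H^s(T), s > 3/2. *)
Definition Hilbert (f : R -> R) (x : R) : R :=
  / PI * iota (fun l : R =>
           filterlim (hilbert_trunc f x) (at_right 0) (locally l)).

(* t |-> u t belongs to C([0, T); H^s(T)) *)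
Definition in_C_Hs (s T : R) (u : R -> R -> R) : Prop :=
  (forall t, 0 <= t < T -> in_Hs s (u t)) /\
  (forall t, 0 <= t < T ->
     filterlim (fun r => Hs_norm s (fun x => u r x - u t x))
       (within (fun r => 0 <= r < T) (locally t)) (locally 0)).

(* First argument of u: time; second: space. For s > 3/2 the partial
   derivatives in the equation are classical ones. *)
Definition is_solution (s T : R) (w0 : R -> R) (u : R -> R -> R) : Prop :=
  in_C_Hs s T u /\
  (forall x, u 0 x = w0 x) /\
  (forall t x, 0 < t < T ->
     ex_derive (fun r => u r x) t /\
     ex_derive (fun y => u t y * Hilbert (u t) y) x /\
     Derive (fun r => u r x) t
       - 1 / 2 * Derive (fun y => u t y * Hilbert (u t) y) x = 0).

Definition smooth_at (f : R -> R) (x0 : R) : Prop :=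
  locally x0 (fun x => forall n : nat, ex_derive_n f n x).

Definition smooth_periodic (f : R -> R) : Prop :=
  periodic f /\ forall (n : nat) (x : R), ex_derive_n f n x.

(* Main.v *)
Require Import Defs.
From Stdlib Require Import Reals ZArith Lra Lia Psatz FunctionalExtensionality.
From Coquelicot Require Import Coquelicot.
Open Scope R_scope.

(** Write u for a solution and f = u + i H u = sum_(n >= 0) a_n e^(i n x), the
    boundary value of an analytic function on the disc. Since u H u is half the
    imaginary part of f^2, the equation says that f solves the complex Burgers
    equation f_t = - (i/2) f f_x, that is, the triangular system

      a_n' = (1/2) sum_(j + k = n) a_j k a_k,

    in which f extends to F(t, z) = sum_n a_n(t) e^(i n z), analytic for Im z > 0
    ([solution_coef_flow]). For s > 3/2 the norm sum_n (1 + n) |a_n| is controlled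
    by the H^s norm ([sobolev_controls_wnorm]); in this norm all series involved
    converge absolutely, a continuous function is the sum of its Fourier series
    ([Fourier_series]), and the principal value H u is the conjugate series
    ([Hilbert_Re_mode_sum]).

    First part. Put f0 = f(0, .). The characteristic z(t) = x + (i t/2) f0(x) of
    the Burgers equation has imaginary part t u(0, x) / 2, so from a point with
    u(0, x) > 0 it enters the half plane where F is analytic. Along it F - f0(x)
    solves a linear equation with bounded coefficient and tends to 0 as t tends
    to 0, hence vanishes ([characteristic]). For a fixed t > 0 this reads
    f0(x) = F(t, x + (i t/2) f0(x)): near x, the initial value solves an
    implicit equation with analytic data, and it is smooth
    ([coef_flow_initial_smooth]).

    Second part. Take a_n(0) = exp(- sqrt n) for n >= 1 and a_0(0) = 0. These
    coefficients decay faster than any power, so the initial value is smooth, but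
    more slowly than any exponential. All a_n(t) stay real and nonnegative and
    the system is positive, so keeping the single term a_1 a_(n-1) gives

      a_(n+k)(t) >= a_n(0) C(n + k - 1, k) (a_1(0) t / 2)^k

    ([flow_cascade]). For n = M k with M large, depending on t, the binomial
    coefficient beats the other factors, and the right-hand side is at least 1
    for infinitely many k, whereas a_m(t) tends to 0 as m grows
    ([bad_coef_no_flow]). *)

(** * Dominated series of real functions *)

Lemma ex_series_dominated (c B : nat -> R) :
  ex_series B -> (forall n, Rabs (c n) <= B n) -> ex_series c.
Proof.
  intros HB Hc. apply (ex_series_le (K := R_AbsRing) (V := R_CompleteNormedModule) c B).
  - exact Hc.
  - exact HB.
Qed.

Lemma ex_series_Rscal (k : R) (c : nat -> R) :
  ex_series c -> ex_series (fun n => k * c n).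
Proof. exact (ex_series_scal_l k c). Qed.

Lemma Series_abs_le (c B : nat -> R) :
  ex_series B -> (forall n, Rabs (c n) <= B n) -> Rabs (Series c) <= Series B.
Proof.
  intros HB Hc.
  eapply Rle_trans; [apply Series_Rabs|].
  - apply ex_series_dominated with B; auto. intros n. rewrite Rabs_Rabsolu. apply Hc.
  - apply Series_le; auto. intros n; split; [apply Rabs_pos|apply Hc].
Qed.

Lemma Series_zero (c : nat -> R) : (forall n, c n = 0) -> Series c = 0.
Proof.
  intros H. rewrite (Series_ext _ (fun n => 0 * c n)), Series_scal_l; [apply Rmult_0_l|].
  intros n. rewrite H. ring.
Qed.

Lemma Series_nonneg (B : nat -> R) :
  ex_series B -> (forall n, 0 <= B n) -> 0 <= Series B.
Proof.
  intros HB Hp. rewrite <- (Rmult_0_l (Series B)), <- Series_scal_l.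
  apply Series_le; auto. intros n. rewrite Rmult_0_l. split; [lra|apply Hp].
Qed.

Lemma term_le_sum (B : nat -> R) (k N : nat) :
  (k <= N)%nat -> (forall j, 0 <= B j) -> B k <= sum_f_R0 B N.
Proof.
  intros Hk HB. induction N as [|N IH].
  - replace k with 0%nat by lia. simpl; lra.
  - rewrite tech5. destruct (Nat.eq_dec k (S N)) as [->|Hne].
    + assert (0 <= sum_f_R0 B N) by (apply cond_pos_sum; auto). lra.
    + assert (H := IH ltac:(lia)). assert (H1 := HB (S N)). lra.
Qed.

Lemma term_le_Series (B : nat -> R) (n : nat) :
  ex_series B -> (forall k, 0 <= B k) -> B n <= Series B.
Proof.
  intros HB Hp.
  rewrite (Series_incr_n B (S n)); [|lia|auto]. simpl pred.
  assert (0 <= Series (fun k => B (S n + k)%nat)).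
  { apply Series_nonneg; [|intros; apply Hp]. apply (ex_series_incr_n B (S n)). exact HB. }
  assert (Hl := term_le_sum B n n (le_n n) Hp). lra.
Qed.

Lemma Series_remainder (c B : nat -> R) (N : nat) :
  ex_series B -> (forall n, Rabs (c n) <= B n) ->
  Rabs (Series c - sum_f_R0 c N) <= Series B - sum_f_R0 B N.
Proof.
  intros HB Hc.
  assert (Ec : ex_series c) by (apply ex_series_dominated with B; auto).
  rewrite (Series_incr_n B (S N)); [|lia|auto].
  rewrite (Series_incr_n c (S N)); [|lia|auto]. simpl pred.
  replace (sum_f_R0 c N + Series (fun k => c (S N + k)%nat) - sum_f_R0 c N)
    with (Series (fun k => c (S N + k)%nat)) by ring.
  replace (sum_f_R0 B N + Series (fun k => B (S N + k)%nat) - sum_f_R0 B N)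
    with (Series (fun k => B (S N + k)%nat)) by ring.
  apply Series_abs_le; [|intros; apply Hc].
  apply (ex_series_incr_n B (S N)). exact HB.
Qed.

Lemma Series_tail_small (B : nat -> R) (eps : R) :
  ex_series B -> 0 < eps ->
  exists N0, forall N, (N0 <= N)%nat -> Rabs (Series B - sum_f_R0 B N) < eps.
Proof.
  intros HB He.
  assert (H := Series_correct _ HB).
  assert (H' : is_lim_seq (sum_n B) (Series B)) by exact H.
  apply is_lim_seq_spec in H'.
  destruct (H' (mkposreal eps He)) as [N0 HN].
  exists N0. intros N HNN. specialize (HN N HNN). simpl in HN.
  rewrite <- sum_n_Reals, Rabs_minus_sym. exact HN.
Qed.

Lemma filterlim_sum_f_R0 {T : Type} (F : (T -> Prop) -> Prop) {FF : Filter F}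
  (c : T -> nat -> R) (l : nat -> R) (N : nat) :
  (forall n, filterlim (fun h => c h n) F (locally (l n))) ->
  filterlim (fun h => sum_f_R0 (c h) N) F (locally (sum_f_R0 l N)).
Proof.
  intros Hl. induction N as [|N IH]; simpl; [apply Hl|].
  eapply filterlim_comp_2; [apply IH|apply Hl|].
  apply (filterlim_plus (K := R_AbsRing) (V := R_NormedModule)).
Qed.

(** Tannery's theorem, the dominated convergence theorem for series. *)
Lemma Series_dominated_convergence {T : Type} (F : (T -> Prop) -> Prop)
  {FF : Filter F} (c : T -> nat -> R) (l B : nat -> R) :
  ex_series B ->
  F (fun h => forall n, Rabs (c h n) <= B n) ->
  (forall n, Rabs (l n) <= B n) ->
  (forall n, filterlim (fun h => c h n) F (locally (l n))) ->
  filterlim (fun h => Series (c h)) F (locally (Series l)).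
Proof.
  intros HB Hc Hl Hlim.
  apply filterlim_locally. intros eps.
  destruct (Series_tail_small B (eps / 3) HB) as [N0 HN].
  { destruct eps; simpl; lra. }
  specialize (HN N0 (le_n _)).
  assert (Hs := filterlim_sum_f_R0 F c l N0 Hlim).
  rewrite filterlim_locally in Hs.
  assert (He3 : 0 < eps / 3) by (destruct eps; simpl; lra).
  specialize (Hs (mkposreal _ He3)).
  generalize (filter_and _ _ Hc Hs). apply filter_imp.
  intros h [H1 H2].
  assert (R1 := Series_remainder (c h) B N0 HB H1).
  assert (R2 := Series_remainder l B N0 HB Hl).
  change (Rabs (sum_f_R0 (c h) N0 - sum_f_R0 l N0) < eps / 3) in H2.
  change (Rabs (Series (c h) - Series l) < eps).
  apply Rabs_def2 in H2. apply Rabs_def2 in HN.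
  apply Rabs_le_between in R1. apply Rabs_le_between in R2.
  apply Rabs_def1; lra.
Qed.

(** By the mean value inequality the bound on the derivatives dominates the
    difference quotients. *)
Lemma is_derive_Series (f df : nat -> R -> R) (B : nat -> R) (x0 d : R) :
  0 < d -> ex_series B ->
  (forall n x, Rabs (x - x0) < d -> is_derive (f n) x (df n x)) ->
  (forall n x, Rabs (x - x0) < d -> Rabs (df n x) <= B n) ->
  (forall x, Rabs (x - x0) < d -> ex_series (fun n => f n x)) ->
  is_derive (fun x => Series (fun n => f n x)) x0 (Series (fun n => df n x0)).
Proof.
  intros Hd HB Hder Hbd Hex.
  assert (H0 : Rabs (x0 - x0) < d).
  { replace (x0 - x0) with 0 by ring. rewrite Rabs_R0; exact Hd. }
  apply is_derive_Reals. intros eps He.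
  pose (F := within (fun h => h <> 0) (locally 0)).
  assert (FF : Filter F) by (apply within_filter; apply locally_filter).
  assert (L : filterlim (fun h => Series (fun n => (f n (x0 + h) - f n x0) / h))
                F (locally (Series (fun n => df n x0)))).
  { apply Series_dominated_convergence with (B := B); auto.
    - unfold F, within. exists (mkposreal d Hd). intros h Hh Hh0 n.
      change (Rabs (h - 0) < d) in Hh. rewrite Rminus_0_r in Hh.
      unfold Rdiv. rewrite Rabs_mult, Rabs_inv.
      apply Rmult_le_reg_r with (Rabs h); [apply Rabs_pos_lt; auto|].
      rewrite Rmult_assoc, Rinv_l, Rmult_1_r by (apply Rabs_no_R0; auto).
      assert (Ex : x0 + h - x0 = h) by (change (x0 + h - x0 = h :> R); ring).
      rewrite <- Ex at 2.
      apply bounded_variation with (dh := df n).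
      intros t Ht.
      rewrite Ex in Ht.
      split; [apply Hder|apply Hbd]; lra.
    - intros n. assert (Hn := Hder n x0 H0).
      apply is_derive_Reals in Hn.
      apply filterlim_locally. intros e.
      destruct (Hn e (cond_pos e)) as [del Hdel].
      exists del. intros h Hh Hh0.
      apply Hdel; auto. change (Rabs (h - 0) < del) in Hh.
      rewrite Rminus_0_r in Hh. exact Hh. }
  rewrite filterlim_locally in L.
  destruct (L (mkposreal eps He)) as [del Hdel].
  assert (Hm : 0 < Rmin del d) by (apply Rmin_pos; [apply cond_pos|auto]).
  exists (mkposreal _ Hm). intros h Hh0 Hh. simpl in Hh.
  assert (Hh1 := Rlt_le_trans _ _ _ Hh (Rmin_l _ _)).
  assert (Hh2 := Rlt_le_trans _ _ _ Hh (Rmin_r _ _)).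
  assert (Hq := Hdel h). cbv beta in Hq.
  assert (Hb : ball 0 del h).
  { change (Rabs (h - 0) < del). rewrite Rminus_0_r. exact Hh1. }
  specialize (Hq Hb Hh0).
  change (Rabs (Series (fun n => (f n (x0 + h) - f n x0) / h)
                - Series (fun n => df n x0)) < eps) in Hq.
  replace ((Series (fun n => f n (x0 + h)) - Series (fun n => f n x0)) / h)
    with (Series (fun n => (f n (x0 + h) - f n x0) / h)); auto.
  unfold Rdiv. rewrite Series_scal_r, Series_minus; auto.
  apply Hex. replace (x0 + h - x0) with h by ring. exact Hh2.
Qed.

Lemma ex_RInt_cont (f : R -> R) (a b : R) :
  (forall x, continuous f x) -> ex_RInt f a b.
Proof.
  intros Hf. apply (ex_RInt_continuous (V := R_CompleteNormedModule)). auto.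
Qed.

(** Equations between integrals are typed in the carrier of a normed module;
    [ring] and [field] expect the type [R] itself. *)
Ltac eq_R := match goal with |- @eq _ ?a ?b => change (@eq R a b) end.

Lemma RInt_Rext (f g : R -> R) (a b : R) :
  (forall x : R, Rmin a b < x < Rmax a b -> f x = g x) -> RInt f a b = RInt g a b.
Proof. exact (RInt_ext (V := R_CompleteNormedModule) f g a b). Qed.

Lemma RInt_Rconst (a b k : R) : RInt (fun _ => k) a b = (b - a) * k.
Proof. exact (RInt_const (V := R_CompleteNormedModule) a b k). Qed.

Lemma RInt_Rplus (f g : R -> R) (a b : R) :
  ex_RInt f a b -> ex_RInt g a b ->
  RInt (fun x => f x + g x) a b = RInt f a b + RInt g a b.
Proof. exact (RInt_plus (V := R_CompleteNormedModule) f g a b). Qed.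

Lemma RInt_Rminus (f g : R -> R) (a b : R) :
  ex_RInt f a b -> ex_RInt g a b ->
  RInt (fun x => f x - g x) a b = RInt f a b - RInt g a b.
Proof. exact (RInt_minus (V := R_CompleteNormedModule) f g a b). Qed.

Lemma RInt_Rscal (f : R -> R) (k a b : R) :
  ex_RInt f a b -> RInt (fun x => k * f x) a b = k * RInt f a b.
Proof. exact (RInt_scal (V := R_CompleteNormedModule) f a b k). Qed.

Lemma ex_RInt_Rscal (f : R -> R) (k a b : R) :
  ex_RInt f a b -> ex_RInt (fun x => k * f x) a b.
Proof. exact (ex_RInt_scal (V := R_NormedModule) f a b k). Qed.

Lemma ex_RInt_Rminus (f g : R -> R) (a b : R) :
  ex_RInt f a b -> ex_RInt g a b -> ex_RInt (fun x => f x - g x) a b.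
Proof. exact (ex_RInt_minus (V := R_NormedModule) f g a b). Qed.

(** The remainders are uniformly small on [[a, b]], so the integrals of the
    partial sums converge. *)
Lemma RInt_Series (f : nat -> R -> R) (B : nat -> R) (a b : R) :
  a <= b -> ex_series B ->
  (forall n x, continuous (f n) x) ->
  (forall n x, a <= x <= b -> Rabs (f n x) <= B n) ->
  ex_RInt (fun x => Series (fun n => f n x)) a b ->
  RInt (fun x => Series (fun n => f n x)) a b = Series (fun n => RInt (f n) a b).
Proof.
  intros Hab HB Hc Hbd HI.
  assert (Hcs : forall N x, continuous (fun x => sum_f_R0 (fun n => f n x) N) x).
  { intros N x. induction N; simpl; [apply Hc|].
    apply (continuous_plus (fun x => sum_f_R0 (fun n => f n x) N) (f (S N))); auto. }
  assert (Hs : forall N, RInt (fun x => sum_f_R0 (fun n => f n x) N) a b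
                 = sum_f_R0 (fun n => RInt (f n) a b) N).
  { induction N as [|N IH]; simpl; [reflexivity|]. rewrite <- IH.
    apply RInt_Rplus; apply ex_RInt_cont; intros; auto. }
  symmetry. apply is_series_unique.
  apply (is_lim_seq_spec _ (Finite _)). intros eps.
  assert (He : 0 < eps / (b - a + 1)).
  { apply Rdiv_lt_0_compat; [apply cond_pos|lra]. }
  destruct (Series_tail_small B _ HB He) as [N0 HN].
  exists N0. intros N HNN. specialize (HN N HNN).
  rewrite sum_n_Reals, <- Hs.
  rewrite Rabs_minus_sym.
  rewrite <- RInt_Rminus; [|exact HI|].
  2: { apply ex_RInt_cont; intros; auto. }
  eapply Rle_lt_trans; [apply (abs_RInt_le_const _ a b (eps / (b - a + 1)))|]; auto.
  - apply ex_RInt_Rminus; auto.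
    apply ex_RInt_cont; intros; auto.
  - intros x Hx. apply Rlt_le.
    eapply Rle_lt_trans; [|apply HN].
    eapply Rle_trans; [apply (Series_remainder (fun n => f n x) B N HB); intros; auto|].
    apply Rle_abs.
  - destruct eps as [e pe]; simpl in *.
    apply Rmult_lt_reg_r with (b - a + 1); [lra|].
    unfold Rdiv. rewrite Rmult_assoc, Rmult_assoc, Rinv_l, Rmult_1_r by lra.
    apply Rmult_lt_compat_r with (r := e) in He; nra.
Qed.

(** * Absolutely convergent complex series *)

Definition summable (c : nat -> C) : Prop := ex_series (fun n => Cmod (c n)).

Definition Csum (c : nat -> C) : C :=
  (Series (fun n => Re (c n)), Series (fun n => Im (c n))).

Definition Csum_upto (c : nat -> C) (N : nat) : C :=
  (sum_f_R0 (fun n => Re (c n)) N, sum_f_R0 (fun n => Im (c n)) N).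

Definition conv (a b : nat -> C) (n : nat) : C :=
  Csum_upto (fun k => Cmult (a k) (b (n - k)%nat)) n.

Lemma Rabs_Re_le (z : C) : Rabs (Re z) <= Cmod z.
Proof. eapply Rle_trans; [apply Rmax_l|apply Rmax_Cmod]. Qed.

Lemma Rabs_Im_le (z : C) : Rabs (Im z) <= Cmod z.
Proof. eapply Rle_trans; [apply Rmax_r|apply Rmax_Cmod]. Qed.

Lemma Cmod_le_Re_Im (z : C) : Cmod z <= Rabs (Re z) + Rabs (Im z).
Proof.
  unfold Cmod. apply Rsqr_incr_0_var.
  - rewrite Rsqr_sqrt by nra. unfold Rsqr, Re, Im.
    assert (H1 := Rabs_pos (fst z)). assert (H2 := Rabs_pos (snd z)).
    rewrite <- (pow2_abs (fst z)), <- (pow2_abs (snd z)). nra.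
  - assert (H1 := Rabs_pos (Re z)). assert (H2 := Rabs_pos (Im z)). lra.
Qed.

Lemma Cmod_sqr (z : C) : Cmod z ^ 2 = Re z ^ 2 + Im z ^ 2.
Proof. unfold Cmod. rewrite pow2_sqrt by nra. reflexivity. Qed.

Lemma C_ext (z w : C) : Re z = Re w -> Im z = Im w -> z = w.
Proof. destruct z, w; simpl; congruence. Qed.

Lemma summable_dominated (c : nat -> C) (B : nat -> R) :
  ex_series B -> (forall n, Cmod (c n) <= B n) -> summable c.
Proof.
  intros HB Hc. apply ex_series_dominated with B; auto.
  intros n. rewrite Rabs_pos_eq; auto using Cmod_ge_0.
Qed.

Lemma summable_Re (c : nat -> C) : summable c -> ex_series (fun n => Re (c n)).
Proof. intros H. apply ex_series_dominated with (1 := H). intros; apply Rabs_Re_le. Qed.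

Lemma summable_Im (c : nat -> C) : summable c -> ex_series (fun n => Im (c n)).
Proof. intros H. apply ex_series_dominated with (1 := H). intros; apply Rabs_Im_le. Qed.

Lemma Csum_ext (c d : nat -> C) : (forall n, c n = d n) -> Csum c = Csum d.
Proof.
  intros H. unfold Csum. f_equal; apply Series_ext; intros n; rewrite H; reflexivity.
Qed.

Lemma Csum_plus (c d : nat -> C) : summable c -> summable d ->
  Csum (fun n => Cplus (c n) (d n)) = Cplus (Csum c) (Csum d).
Proof.
  intros Hc Hd. apply C_ext; simpl.
  - rewrite <- Series_plus; auto using summable_Re.
  - rewrite <- Series_plus; auto using summable_Im.
Qed.

Lemma Csum_minus (c d : nat -> C) : summable c -> summable d ->
  Csum (fun n => Cminus (c n) (d n)) = Cminus (Csum c) (Csum d).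
Proof.
  intros Hc Hd. apply C_ext; simpl.
  - change (Series (fun n => Re (c n) - Re (d n))
            = Series (fun n => Re (c n)) - Series (fun n => Re (d n))).
    rewrite <- Series_minus; auto using summable_Re.
  - change (Series (fun n => Im (c n) - Im (d n))
            = Series (fun n => Im (c n)) - Series (fun n => Im (d n))).
    rewrite <- Series_minus; auto using summable_Im.
Qed.

Lemma summable_scal (k : C) (c : nat -> C) : summable c -> summable (fun n => Cmult k (c n)).
Proof.
  intros H. apply summable_dominated with (fun n => Cmod k * Cmod (c n)).
  - apply ex_series_Rscal. exact H.
  - intros n. rewrite Cmod_mult. lra.
Qed.

Lemma summable_plus (c d : nat -> C) : summable c -> summable d ->
  summable (fun n => Cplus (c n) (d n)).
Proof.
  intros Hc Hd. apply summable_dominated with (fun n => Cmod (c n) + Cmod (d n)).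
  - apply (ex_series_plus (fun n => Cmod (c n)) (fun n => Cmod (d n))); assumption.
  - intros; apply Cmod_triangle.
Qed.

Lemma Csum_scal (k : C) (c : nat -> C) : summable c ->
  Csum (fun n => Cmult k (c n)) = Cmult k (Csum c).
Proof.
  intros Hc. apply C_ext; simpl.
  - rewrite <- !Series_scal_l, <- Series_minus;
      auto using ex_series_Rscal, summable_Re, summable_Im.
  - rewrite <- !Series_scal_l, <- Series_plus;
      auto using ex_series_Rscal, summable_Re, summable_Im.
Qed.

Lemma Cmod_Csum_le (c : nat -> C) (B : nat -> R) :
  ex_series B -> (forall n, Cmod (c n) <= B n) -> Cmod (Csum c) <= Series B.
Proof.
  intros HB Hc.
  assert (Hs : summable c) by eauto using summable_dominated.
  (* testing the sum against its own conjugate yields |S|^2 <= |S| * Series B *)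
  set (S := Csum c).
  assert (Hk : Rabs (Re (Csum (fun n => Cmult (Cconj S) (c n)))) <= Cmod S * Series B).
  { unfold Csum; simpl. rewrite <- Series_scal_l.
    apply (Series_abs_le (fun n => Re (Cmult (Cconj S) (c n)))).
    - apply ex_series_Rscal; exact HB.
    - intros n. eapply Rle_trans; [apply Rabs_Re_le|].
      rewrite Cmod_mult, Cmod_conj.
      apply Rmult_le_compat_l; auto using Cmod_ge_0. }
  rewrite Csum_scal in Hk by auto. fold S in Hk.
  replace (Re (Cmult (Cconj S) S)) with (Cmod S ^ 2) in Hk
    by (rewrite Cmod_sqr; unfold Re, Im; simpl; ring).
  rewrite Rabs_pos_eq in Hk by apply pow2_ge_0.
  assert (H0 := Cmod_ge_0 S).
  destruct (Rle_lt_or_eq_dec _ _ H0) as [Hp|He].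
  - apply Rmult_le_reg_l with (Cmod S); auto. simpl in Hk; lra.
  - rewrite <- He. apply Series_nonneg; auto.
    intros n; eapply Rle_trans; [apply Cmod_ge_0|apply Hc].
Qed.

Lemma Csum_upto_S (c : nat -> C) (N : nat) :
  Csum_upto c (S N) = Cplus (Csum_upto c N) (c (S N)).
Proof. reflexivity. Qed.

Lemma Csum_upto_ext (c d : nat -> C) (N : nat) :
  (forall n, (n <= N)%nat -> c n = d n) -> Csum_upto c N = Csum_upto d N.
Proof.
  intros H. unfold Csum_upto. f_equal; apply sum_eq; intros n Hn; rewrite H; auto.
Qed.

Lemma Csum_upto_scal_r (k : C) (c : nat -> C) (N : nat) :
  Csum_upto (fun n => Cmult (c n) k) N = Cmult (Csum_upto c N) k.
Proof.
  induction N as [|N IH].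
  - unfold Csum_upto; simpl. apply C_ext; reflexivity.
  - rewrite !Csum_upto_S, IH. ring.
Qed.

Lemma Cmod_Csum_upto (c : nat -> C) (B : nat -> R) (N : nat) :
  (forall n, (n <= N)%nat -> Cmod (c n) <= B n) -> Cmod (Csum_upto c N) <= sum_f_R0 B N.
Proof.
  induction N as [|N IH]; intros H.
  - replace (Csum_upto c 0) with (c 0%nat) by (apply C_ext; reflexivity).
    simpl; auto.
  - rewrite Csum_upto_S. simpl. eapply Rle_trans; [apply Cmod_triangle|].
    apply Rplus_le_compat; auto.
Qed.

Lemma is_series_Cauchy_product (a b : nat -> R) :
  ex_series a -> ex_series b -> (forall n, 0 <= a n) -> (forall n, 0 <= b n) ->
  is_series (fun n => sum_f_R0 (fun k => a k * b (n - k)%nat) n) (Series a * Series b).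
Proof.
  intros Ha Hb Pa Pb. apply is_series_mult; try (apply Series_correct; assumption).
  - apply ex_series_ext with (2 := Ha). intros n. symmetry; apply Rabs_pos_eq; auto.
  - apply ex_series_ext with (2 := Hb). intros n. symmetry; apply Rabs_pos_eq; auto.
Qed.

Lemma Cmod_conv (a b : nat -> C) (n : nat) :
  Cmod (conv a b n) <= sum_f_R0 (fun k => Cmod (a k) * Cmod (b (n - k)%nat)) n.
Proof. apply Cmod_Csum_upto. intros k _. rewrite Cmod_mult. lra. Qed.

Lemma summable_conv (a b : nat -> C) : summable a -> summable b -> summable (conv a b).
Proof.
  intros Ha Hb.
  apply summable_dominated with (fun n => sum_f_R0 (fun k => Cmod (a k) * Cmod (b (n - k)%nat))
    n).
  - eexists. apply (is_series_Cauchy_product (fun n => Cmod (a n)) (fun n => Cmod (b n)));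
      auto using Cmod_ge_0.
  - apply Cmod_conv.
Qed.

Lemma Cmod_conv_le (a b : nat -> C) (n : nat) : summable a -> summable b ->
  Cmod (conv a b n) <= Series (fun k => Cmod (a k)) * Series (fun k => Cmod (b k)).
Proof.
  intros Ha Hb.
  assert (H := is_series_Cauchy_product _ _ Ha Hb
                 (fun n => Cmod_ge_0 (a n)) (fun n => Cmod_ge_0 (b n))).
  rewrite <- (is_series_unique _ _ H).
  eapply Rle_trans; [apply Cmod_conv|].
  apply (term_le_Series (fun n => sum_f_R0 (fun k => Cmod (a k) * Cmod (b (n - k)%nat)) n)).
  - eexists; exact H.
  - intros m. apply cond_pos_sum. intros k.
    apply Rmult_le_pos; apply Cmod_ge_0.
Qed.

Lemma Csum_conv (a b : nat -> C) : summable a -> summable b ->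
  Csum (conv a b) = Cmult (Csum a) (Csum b).
Proof.
  intros Ha Hb.
  assert (Hp : forall p q : C -> R, (p = Re \/ p = Im) -> (q = Re \/ q = Im) ->
    is_series (fun n => sum_f_R0 (fun k => p (a k) * q (b (n - k)%nat)) n)
      (Series (fun n => p (a n)) * Series (fun n => q (b n)))).
  { intros p q Hp Hq.
    assert (Bp : forall z, Rabs (p z) <= Cmod z)
      by (destruct Hp; subst; auto using Rabs_Re_le, Rabs_Im_le).
    assert (Bq : forall z, Rabs (q z) <= Cmod z)
      by (destruct Hq; subst; auto using Rabs_Re_le, Rabs_Im_le).
    assert (Ap : forall c, summable c -> ex_series (fun n => Rabs (p (c n)))).
    { intros c Hc. apply ex_series_dominated with (1 := Hc).
      intros n. rewrite Rabs_Rabsolu. apply Bp. }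
    assert (Aq : forall c, summable c -> ex_series (fun n => Rabs (q (c n)))).
    { intros c Hc. apply ex_series_dominated with (1 := Hc).
      intros n. rewrite Rabs_Rabsolu. apply Bq. }
    apply (is_series_mult (fun n => p (a n)) (fun n => q (b n))); auto;
      apply Series_correct.
    - apply ex_series_dominated with (1 := Ha); auto.
    - apply ex_series_dominated with (1 := Hb); auto. }
  apply C_ext; simpl.
  - rewrite <- (is_series_unique _ _ (Hp Re Re (or_introl eq_refl) (or_introl eq_refl))).
    rewrite <- (is_series_unique _ _ (Hp Im Im (or_intror eq_refl) (or_intror eq_refl))).
    rewrite <- Series_minus; [|eexists; apply Hp; auto|eexists; apply Hp; auto].
    apply Series_ext. intros n. rewrite <- minus_sum. reflexivity.
  - rewrite <- (is_series_unique _ _ (Hp Re Im (or_introl eq_refl) (or_intror eq_refl))).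
    rewrite <- (is_series_unique _ _ (Hp Im Re (or_intror eq_refl) (or_introl eq_refl))).
    rewrite <- Series_plus; [|eexists; apply Hp; auto|eexists; apply Hp; auto].
    apply Series_ext. intros n. rewrite <- plus_sum. reflexivity.
Qed.

(** * Complex-valued functions of a real variable *)

Definition Cder (f : R -> C) (x : R) (l : C) : Prop :=
  is_derive (fun s => Re (f s)) x (Re l) /\ is_derive (fun s => Im (f s)) x (Im l).

Lemma is_derive_Rmult (f g : R -> R) (x l m : R) :
  is_derive f x l -> is_derive g x m ->
  is_derive (fun s => f s * g s) x (l * g x + f x * m).
Proof. intros Hf Hg. apply (is_derive_mult f g x l m); auto. intros; apply Rmult_comm. Qed.

Lemma is_derive_Rplus (f g : R -> R) (x l m : R) :
  is_derive f x l -> is_derive g x m -> is_derive (fun s => f s + g s) x (l + m).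
Proof. intros Hf Hg. apply (is_derive_plus f g x l m); auto. Qed.

Lemma is_derive_Rminus (f g : R -> R) (x l m : R) :
  is_derive f x l -> is_derive g x m -> is_derive (fun s => f s - g s) x (l - m).
Proof. intros Hf Hg. apply (is_derive_minus f g x l m); auto. Qed.

Lemma is_derive_eq (f : R -> R) (x l m : R) : is_derive f x l -> l = m -> is_derive f x m.
Proof. intros H <-; exact H. Qed.

Lemma Cder_const (k : C) (x : R) : Cder (fun _ => k) x 0.
Proof. split; apply (is_derive_const (V := R_NormedModule)). Qed.

Lemma Cder_plus (f g : R -> C) (x : R) (l m : C) :
  Cder f x l -> Cder g x m -> Cder (fun s => Cplus (f s) (g s)) x (Cplus l m).
Proof.
  intros [Hf1 Hf2] [Hg1 Hg2]. split; simpl.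
  - apply (is_derive_Rplus _ _ _ _ _ Hf1 Hg1).
  - apply (is_derive_Rplus _ _ _ _ _ Hf2 Hg2).
Qed.

Lemma Cder_mult (f g : R -> C) (x : R) (l m : C) :
  Cder f x l -> Cder g x m ->
  Cder (fun s => Cmult (f s) (g s)) x (Cplus (Cmult l (g x)) (Cmult (f x) m)).
Proof.
  intros [Hf1 Hf2] [Hg1 Hg2]. split; simpl.
  - assert (H := is_derive_Rminus _ _ _ _ _ (is_derive_Rmult _ _ _ _ _ Hf1 Hg1)
                   (is_derive_Rmult _ _ _ _ _ Hf2 Hg2)).
    unfold Re, Im in H. apply (is_derive_eq _ _ _ _ H). unfold Re, Im. ring.
  - assert (H := is_derive_Rplus _ _ _ _ _ (is_derive_Rmult _ _ _ _ _ Hf1 Hg2)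
                   (is_derive_Rmult _ _ _ _ _ Hf2 Hg1)).
    unfold Re, Im in H. apply (is_derive_eq _ _ _ _ H). unfold Re, Im. ring.
Qed.

Lemma Cder_eq (f : R -> C) (x : R) (l m : C) : Cder f x l -> l = m -> Cder f x m.
Proof. intros H <-; exact H. Qed.

Lemma Cder_ext_loc (f g : R -> C) (x : R) (l : C) :
  locally x (fun s => f s = g s) -> Cder f x l -> Cder g x l.
Proof.
  intros He [H1 H2].
  split; [eapply is_derive_ext_loc; [|exact H1]|eapply is_derive_ext_loc; [|exact H2]];
    (revert He; apply filter_imp; intros s ->; reflexivity).
Qed.

Lemma Cder_scal (k : C) (f : R -> C) (x : R) (l : C) :
  Cder f x l -> Cder (fun s => Cmult k (f s)) x (Cmult k l).
Proof.
  intros H. apply (Cder_eq _ _ _ _ (Cder_mult _ _ _ _ _ (Cder_const k x) H)). ring.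
Qed.

Lemma Cder_real (f : R -> R) (x l : R) :
  is_derive f x l -> Cder (fun s => RtoC (f s)) x (RtoC l).
Proof. intros H. split; [exact H|exact (is_derive_const (V := R_NormedModule) 0 x)]. Qed.

Lemma Cder_inv (f : R -> C) (x : R) (l : C) :
  Cder f x l -> f x <> 0 ->
  Cder (fun s => Cinv (f s)) x (Copp (Cmult l (Cmult (Cinv (f x)) (Cinv (f x))))).
Proof.
  intros [H1 H2] Hn.
  assert (Hq : Re (f x) * Re (f x) + Im (f x) * Im (f x) <> 0).
  { intros Hz. apply Hn. apply C_ext; simpl; nra. }
  assert (Hd := is_derive_Rplus _ _ _ _ _ (is_derive_Rmult _ _ _ _ _ H1 H1)
                                (is_derive_Rmult _ _ _ _ _ H2 H2)).
  assert (Hr := is_derive_div _ _ _ _ _ H1 Hd Hq).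
  assert (Hi := is_derive_div _ _ _ _ _
    (is_derive_Rminus _ _ _ _ _ (is_derive_const (V := R_NormedModule) 0 x) H2) Hd Hq).
  unfold Re, Im in *. split; unfold Re, Im; simpl.
  - refine (is_derive_eq _ _ _ _ (is_derive_ext _ _ _ _ _ Hr) _).
    + intros t; simpl. unfold Rdiv. rewrite !Rmult_1_r. reflexivity.
    + simpl. rewrite !Rmult_1_r. field. exact Hq.
  - refine (is_derive_eq _ _ _ _ (is_derive_ext _ _ _ _ _ Hi) _).
    + intros t; simpl. unfold Rdiv. rewrite !Rmult_1_r, Rminus_0_l. reflexivity.
    + change (zero : R_NormedModule) with 0. simpl. rewrite !Rmult_1_r. field. exact Hq.
Qed.

Lemma Cder_Csum (f df : nat -> R -> C) (A B : nat -> R) (x0 d : R) :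
  0 < d -> ex_series A -> ex_series B ->
  (forall n x, Rabs (x - x0) < d -> Cder (f n) x (df n x)) ->
  (forall n x, Rabs (x - x0) < d -> Cmod (df n x) <= B n) ->
  (forall n x, Rabs (x - x0) < d -> Cmod (f n x) <= A n) ->
  Cder (fun x => Csum (fun n => f n x)) x0 (Csum (fun n => df n x0)).
Proof.
  intros Hd HA HB Hder Hdb Hb. split; simpl.
  - apply is_derive_Series with (B := B) (d := d) (f := fun n x => Re (f n x))
      (df := fun n x => Re (df n x)); auto.
    + intros n x Hx. apply (Hder n x Hx).
    + intros n x Hx. eapply Rle_trans; [apply Rabs_Re_le|auto].
    + intros x Hx. apply summable_Re. apply summable_dominated with A; auto.
  - apply is_derive_Series with (B := B) (d := d) (f := fun n x => Im (f n x))
      (df := fun n x => Im (df n x)); auto.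
    + intros n x Hx. apply (Hder n x Hx).
    + intros n x Hx. eapply Rle_trans; [apply Rabs_Im_le|auto].
    + intros x Hx. apply summable_Im. apply summable_dominated with A; auto.
Qed.

(** * Fourier series as power series in the upper half plane *)

(** [mode n z] is exp(i n z). *)
Definition mode (n : nat) (z : C) : C :=
  (exp (- (INR n * Im z)) * cos (INR n * Re z),
   exp (- (INR n * Im z)) * sin (INR n * Re z)).

Definition mode_sum (a : nat -> C) (z : C) : C := Csum (fun n => Cmult (a n) (mode n z)).

(** The coefficients of - i d/dz, so that no factor i appears in the system. *)
Definition dcoef (a : nat -> C) (n : nat) : C := Cmult (INR n) (a n).

Definition weighted (a : nat -> C) (n : nat) : R := (1 + INR n) * Cmod (a n).

Definition wsummable (a : nat -> C) : Prop := ex_series (weighted a).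

(** A Wiener algebra norm: it dominates the uniform norms of the series and of
    its first derivative, up to the real axis. *)
Definition wnorm (a : nat -> C) : R := Series (weighted a).

Lemma mode_plus (j k : nat) (z : C) : mode (j + k) z = Cmult (mode j z) (mode k z).
Proof.
  unfold mode. apply C_ext; simpl; rewrite plus_INR, !Rmult_plus_distr_r, Ropp_plus_distr,
    exp_plus.
  - rewrite cos_plus; ring.
  - rewrite sin_plus; ring.
Qed.

Lemma Cmod_mode (n : nat) (z : C) : Cmod (mode n z) = exp (- (INR n * Im z)).
Proof.
  set (e := exp (- (INR n * Im z))). set (t := INR n * Re z).
  assert (He : 0 < e) by apply exp_pos.
  change (sqrt ((e * cos t) ^ 2 + (e * sin t) ^ 2) = e).
  replace ((e * cos t) ^ 2 + (e * sin t) ^ 2) with (e * e).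
  - apply sqrt_square; lra.
  - assert (H := sin2_cos2 t). unfold Rsqr in H. nra.
Qed.

Lemma Cmod_mode_le (n : nat) (z : C) (y : R) : y <= Im z -> Cmod (mode n z) <= exp (- (INR n *
  y)).
Proof.
  intros H. rewrite Cmod_mode. assert (H0 := pos_INR n).
  destruct (Rle_lt_or_eq_dec _ _ (Rmult_le_compat_l _ _ _ H0 H)) as [Hl|He].
  - apply Rlt_le, exp_increasing; lra.
  - rewrite He; lra.
Qed.

Lemma Cmod_mode_le_1 (n : nat) (z : C) : 0 <= Im z -> Cmod (mode n z) <= 1.
Proof.
  intros H. eapply Rle_trans; [apply (Cmod_mode_le n z 0 H)|].
  rewrite Rmult_0_r, Ropp_0, exp_0; lra.
Qed.

Lemma is_derive_exp_trig (n : R) (X Y : R -> R) (x dX dY : R) :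
  is_derive X x dX -> is_derive Y x dY ->
  is_derive (fun s => exp (- (n * Y s)) * cos (n * X s)) x
    (exp (- (n * Y x)) * (- (n * dY) * cos (n * X x) - n * dX * sin (n * X x))) /\
  is_derive (fun s => exp (- (n * Y s)) * sin (n * X s)) x
    (exp (- (n * Y x)) * (- (n * dY) * sin (n * X x) + n * dX * cos (n * X x))).
Proof.
  intros H1 H2.
  assert (E1 : ex_derive X x) by (eexists; exact H1).
  assert (E2 : ex_derive Y x) by (eexists; exact H2).
  split; auto_derive; auto;
    change (fun s => X s) with X; change (fun s => Y s) with Y;
    rewrite (is_derive_unique _ _ _ H1), (is_derive_unique _ _ _ H2); ring.
Qed.

Lemma Cder_mode (n : nat) (zeta : R -> C) (x : R) (l : C) :
  Cder zeta x l ->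
  Cder (fun s => mode n (zeta s)) x (Cmult (Cmult Ci (Cmult l (INR n))) (mode n (zeta x))).
Proof.
  intros [H1 H2]. destruct (is_derive_exp_trig (INR n) _ _ _ _ _ H1 H2) as [G1 G2].
  split.
  - apply (is_derive_eq _ _ _ _ G1). unfold mode, Re, Im; simpl. ring.
  - apply (is_derive_eq _ _ _ _ G2). unfold mode, Re, Im; simpl. ring.
Qed.

Lemma Cmod_mul_mode_le (c : C) (n : nat) (z : C) :
  0 <= Im z -> Cmod (Cmult c (mode n z)) <= Cmod c.
Proof.
  intros Hz. rewrite Cmod_mult.
  assert (H := Cmod_mode_le_1 n z Hz). assert (H0 := Cmod_ge_0 c). nra.
Qed.

Lemma summable_mul_mode (a : nat -> C) (z : C) :
  summable a -> 0 <= Im z -> summable (fun n => Cmult (a n) (mode n z)).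
Proof.
  intros Ha Hz. apply summable_dominated with (1 := Ha).
  intros n. apply Cmod_mul_mode_le; auto.
Qed.

Lemma Cmod_mode_sum_le (a : nat -> C) (z : C) :
  summable a -> 0 <= Im z -> Cmod (mode_sum a z) <= Series (fun n => Cmod (a n)).
Proof.
  intros Ha Hz. apply Cmod_Csum_le; auto.
  intros n. apply Cmod_mul_mode_le; auto.
Qed.

Lemma mode_sum_conv (a b : nat -> C) (z : C) : summable a -> summable b -> 0 <= Im z ->
  mode_sum (conv a b) z = Cmult (mode_sum a z) (mode_sum b z).
Proof.
  intros Ha Hb Hz. unfold mode_sum. rewrite <- Csum_conv; auto using summable_mul_mode.
  apply Csum_ext. intros n. unfold conv. rewrite <- Csum_upto_scal_r.
  apply Csum_upto_ext. intros k Hk.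
  replace n with (k + (n - k))%nat at 2 by lia. rewrite mode_plus. ring.
Qed.

Lemma Cmod_le_weighted (a : nat -> C) (n : nat) : Cmod (a n) <= weighted a n.
Proof.
  unfold weighted. assert (H := Cmod_ge_0 (a n)). assert (H0 := pos_INR n). nra.
Qed.

Lemma Cmod_dcoef_le_weighted (a : nat -> C) (n : nat) : Cmod (dcoef a n) <= weighted a n.
Proof.
  unfold weighted, dcoef. rewrite Cmod_mult, Cmod_R, Rabs_pos_eq by apply pos_INR.
  assert (H := Cmod_ge_0 (a n)). nra.
Qed.

Lemma weighted_nonneg (a : nat -> C) (n : nat) : 0 <= weighted a n.
Proof. eapply Rle_trans; [apply Cmod_ge_0|apply Cmod_le_weighted]. Qed.

Lemma wsummable_summable (a : nat -> C) : wsummable a -> summable a.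
Proof. intros H. apply summable_dominated with (1 := H), Cmod_le_weighted. Qed.

Lemma wsummable_dcoef (a : nat -> C) : wsummable a -> summable (dcoef a).
Proof. intros H. apply summable_dominated with (1 := H), Cmod_dcoef_le_weighted. Qed.

Lemma wnorm_nonneg (a : nat -> C) : wsummable a -> 0 <= wnorm a.
Proof. intros H. apply Series_nonneg; auto using weighted_nonneg. Qed.

Lemma Series_Cmod_le_wnorm (a : nat -> C) : wsummable a ->
  Series (fun n => Cmod (a n)) <= wnorm a.
Proof.
  intros H. apply Series_le; auto.
  intros n; split; [apply Cmod_ge_0|apply Cmod_le_weighted].
Qed.

Lemma Series_Cmod_dcoef_le_wnorm (a : nat -> C) : wsummable a ->
  Series (fun n => Cmod (dcoef a n)) <= wnorm a.
Proof.
  intros H. apply Series_le; auto.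
  intros n; split; [apply Cmod_ge_0|apply Cmod_dcoef_le_weighted].
Qed.

Lemma Cmod_mode_sum_le_wnorm (a : nat -> C) (z : C) :
  wsummable a -> 0 <= Im z -> Cmod (mode_sum a z) <= wnorm a.
Proof.
  intros Ha Hz. eapply Rle_trans; [apply Cmod_mode_sum_le; auto using wsummable_summable|].
  apply Series_Cmod_le_wnorm; auto.
Qed.

Lemma Cmod_mode_sum_deriv_le_wnorm (a : nat -> C) (z : C) :
  wsummable a -> 0 <= Im z -> Cmod (mode_sum (dcoef a) z) <= wnorm a.
Proof.
  intros Ha Hz. eapply Rle_trans; [apply Cmod_mode_sum_le; auto using wsummable_dcoef|].
  apply Series_Cmod_dcoef_le_wnorm; auto.
Qed.

Lemma weighted_minus_le (a b : nat -> C) (n : nat) :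
  weighted (fun n => Cminus (a n) (b n)) n <= weighted a n + weighted b n.
Proof.
  unfold weighted. assert (H := Cmod_triangle (a n) (Copp (b n))).
  rewrite Cmod_opp in H. assert (H0 := pos_INR n).
  change (Cmod (Cminus (a n) (b n)) <= Cmod (a n) + Cmod (b n)) in H. nra.
Qed.

Lemma wsummable_minus (a b : nat -> C) : wsummable a -> wsummable b ->
  wsummable (fun n => Cminus (a n) (b n)).
Proof.
  intros Ha Hb. apply ex_series_dominated with (fun n => weighted a n + weighted b n).
  - apply (ex_series_plus (weighted a) (weighted b)); assumption.
  - intros n. rewrite Rabs_pos_eq by apply weighted_nonneg. apply weighted_minus_le.
Qed.

Lemma wnorm_triangle (a b : nat -> C) : wsummable a -> wsummable b ->
  wnorm a <= wnorm (fun n => Cminus (a n) (b n)) + wnorm b.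
Proof.
  intros Ha Hb. unfold wnorm.
  assert (Hm := wsummable_minus a b Ha Hb).
  rewrite <- Series_plus; auto. apply Series_le.
  - intros n. split; [apply weighted_nonneg|].
    unfold weighted. assert (H := Cmod_triangle (Cminus (a n) (b n)) (b n)).
    replace (Cplus (Cminus (a n) (b n)) (b n)) with (a n) in H by ring.
    assert (H0 := pos_INR n). nra.
  - apply (ex_series_plus (weighted (fun n => Cminus (a n) (b n))) (weighted b)); auto.
Qed.

Lemma mode_sum_minus (a b : nat -> C) (z : C) : summable a -> summable b -> 0 <= Im z ->
  mode_sum (fun n => Cminus (a n) (b n)) z = Cminus (mode_sum a z) (mode_sum b z).
Proof.
  intros Ha Hb Hz. unfold mode_sum. rewrite <- Csum_minus; auto using summable_mul_mode.
  apply Csum_ext. intros n. ring.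
Qed.

Lemma mode_sum_ext (a b : nat -> C) (z : C) : (forall n, a n = b n) -> mode_sum a z = mode_sum
  b z.
Proof. intros H. apply Csum_ext. intros n. rewrite H. reflexivity. Qed.

(** At height at least [y0] each term and its derivative are dominated by a
    multiple of (1 + n) A_n exp(- n y0), which allows termwise differentiation.
    Moving coefficients and a moving point are treated together, because along
    characteristics both depend on time. *)
Lemma Cder_mode_sum_curve (p dp : R -> nat -> C) (zeta dzeta : R -> C) (A : nat -> R)
  (y0 L x0 d : R) :
  0 < d -> 0 <= L ->
  ex_series (fun n => (1 + INR n) * A n * exp (- (INR n * y0))) ->
  (forall x, Rabs (x - x0) < d -> Cder zeta x (dzeta x)) ->
  (forall x, Rabs (x - x0) < d -> Cmod (dzeta x) <= L) ->
  (forall x, Rabs (x - x0) < d -> y0 <= Im (zeta x)) ->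
  (forall n x, Rabs (x - x0) < d -> Cder (fun s => p s n) x (dp x n)) ->
  (forall n x, Rabs (x - x0) < d -> Cmod (p x n) <= A n) ->
  (forall n x, Rabs (x - x0) < d -> Cmod (dp x n) <= A n) ->
  Cder (fun s => mode_sum (p s) (zeta s)) x0
    (Cplus (mode_sum (dp x0) (zeta x0)) (Cmult (Cmult Ci (dzeta x0)) (mode_sum (dcoef (p x0))
      (zeta x0)))).
Proof.
  intros Hd HL HA Hz HzL Hy Hp Hpb Hdpb.
  set (B := fun n => (1 + L) * ((1 + INR n) * A n * exp (- (INR n * y0)))).
  assert (HB : ex_series B) by (apply ex_series_Rscal; exact HA).
  assert (H0 : Rabs (x0 - x0) < d).
  { replace (x0 - x0) with 0 by ring. rewrite Rabs_R0; exact Hd. }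
  assert (PA : forall n, 0 <= A n).
  { intros n. eapply Rle_trans; [apply Cmod_ge_0|apply (Hpb n x0 H0)]. }
  assert (B1 : forall n (c z : C), Cmod c <= A n -> y0 <= Im z -> Cmod (Cmult c (mode n z)) <=
    B n).
  { intros n c z Hc Hyz. rewrite Cmod_mult. unfold B.
    assert (Hn := pos_INR n). assert (He := Cmod_mode_le n z y0 Hyz).
    assert (Hm := Rmult_le_compat _ _ _ _ (Cmod_ge_0 _) (Cmod_ge_0 _) Hc He).
    assert (Hae : 0 <= A n * exp (- (INR n * y0)))
      by (apply Rmult_le_pos; auto; left; apply exp_pos).
    assert (0 <= L * INR n) by nra. nra. }
  assert (B2 : forall n (c z w : C), Cmod c <= A n -> y0 <= Im z -> Cmod w <= L ->
             Cmod (Cmult (Cmult Ci w) (Cmult (Cmult (INR n) c) (mode n z))) <= B n).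
  { intros n c z w Hc Hyz Hw. rewrite !Cmod_mult, Cmod_R, (Rabs_pos_eq _ (pos_INR n)).
    assert (HCi : Cmod Ci = 1).
    { unfold Cmod, Ci; simpl. replace (_ + _) with 1 by ring. apply sqrt_1. }
    rewrite HCi, Rmult_1_l. unfold B.
    assert (Hn := pos_INR n). assert (He := Cmod_mode_le n z y0 Hyz).
    assert (Hm := Rmult_le_compat _ _ _ _ (Cmod_ge_0 _) (Cmod_ge_0 _) Hc He).
    assert (Hae : 0 <= A n * exp (- (INR n * y0)))
      by (apply Rmult_le_pos; auto; left; apply exp_pos).
    rewrite Rmult_assoc.
    assert (Hq : Cmod w * (INR n * (Cmod c * Cmod (mode n z)))
                 <= L * (INR n * (A n * exp (- (INR n * y0))))).
    { apply Rmult_le_compat; auto using Cmod_ge_0.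
      - apply Rmult_le_pos; auto. apply Rmult_le_pos; apply Cmod_ge_0.
      - apply Rmult_le_compat_l; auto. }
    eapply Rle_trans; [exact Hq|].
    assert (0 <= L * (A n * exp (- (INR n * y0)))) by (apply Rmult_le_pos; auto).
    assert (0 <= INR n * (A n * exp (- (INR n * y0)))) by (apply Rmult_le_pos; auto).
    nra. }
  assert (S1 : summable (fun n => Cmult (dp x0 n) (mode n (zeta x0))))
    by (apply summable_dominated with B; auto).
  assert (S2 : summable (fun n => Cmult (dcoef (p x0) n) (mode n (zeta x0)))).
  { apply summable_dominated with (fun n => (1 + INR n) * A n * exp (- (INR n * y0))); auto.
    intros n. unfold dcoef. rewrite !Cmod_mult, Cmod_R, (Rabs_pos_eq _ (pos_INR n)).
    apply Rmult_le_compat; auto using Cmod_ge_0, Cmod_mode_le.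
    - apply Rmult_le_pos; auto using pos_INR, Cmod_ge_0.
    - apply Rmult_le_compat; auto using pos_INR, Cmod_ge_0. lra. }
  unfold mode_sum. rewrite <- Csum_scal, <- Csum_plus; auto using summable_scal.
  apply (Cder_Csum (fun n s => Cmult (p s n) (mode n (zeta s)))
    (fun n s => Cplus (Cmult (dp s n) (mode n (zeta s)))
       (Cmult (Cmult Ci (dzeta s)) (Cmult (dcoef (p s) n) (mode n (zeta s)))))
    B (fun n => B n + B n) x0 d); auto.
  - apply (ex_series_plus B B); auto.
  - intros n x Hx.
    apply (Cder_eq _ _ _ _ (Cder_mult _ _ _ _ _ (Hp n x Hx) (Cder_mode n _ _ _ (Hz x Hx)))).
    unfold dcoef. ring.
  - intros n x Hx. eapply Rle_trans; [apply Cmod_triangle|].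
    apply Rplus_le_compat; [apply B1|apply B2]; auto.
Qed.

(** * Derivatives of power series along curves *)

Lemma mode_sum_scal (k : C) (a : nat -> C) (z : C) : summable a -> 0 <= Im z ->
  mode_sum (fun n => Cmult k (a n)) z = Cmult k (mode_sum a z).
Proof.
  intros Ha Hz. unfold mode_sum. rewrite <- Csum_scal; auto using summable_mul_mode.
  apply Csum_ext. intros n. ring.
Qed.

Lemma Cder_unique (f : R -> C) (x : R) (l m : C) : Cder f x l -> Cder f x m -> l = m.
Proof.
  intros [H1 H2] [G1 G2]. apply C_ext.
  - rewrite <- (is_derive_unique _ _ _ H1), <- (is_derive_unique _ _ _ G1). reflexivity.
  - rewrite <- (is_derive_unique _ _ _ H2), <- (is_derive_unique _ _ _ G2). reflexivity.
Qed.

Lemma Cder_continuous (f : R -> C) (x : R) (l : C) (eps : R) : Cder f x l -> 0 < eps ->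
  exists d, 0 < d /\ forall s, Rabs (s - x) < d -> Cmod (Cminus (f s) (f x)) < eps.
Proof.
  intros [H1 H2] He.
  assert (C1 := ex_derive_continuous _ _ (ex_intro _ _ H1)).
  assert (C2 := ex_derive_continuous _ _ (ex_intro _ _ H2)).
  assert (He2 : 0 < eps / 2) by lra.
  destruct (proj1 (filterlim_locally _ _) C1 (mkposreal _ He2)) as [d1 Hd1].
  destruct (proj1 (filterlim_locally _ _) C2 (mkposreal _ He2)) as [d2 Hd2].
  exists (Rmin d1 d2). split; [apply Rmin_pos; apply cond_pos|].
  intros s Hs.
  assert (Q1 := Hd1 s (Rlt_le_trans _ _ _ Hs (Rmin_l _ _))).
  assert (Q2 := Hd2 s (Rlt_le_trans _ _ _ Hs (Rmin_r _ _))).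
  change (Rabs (Re (f s) - Re (f x)) < eps / 2) in Q1.
  change (Rabs (Im (f s) - Im (f x)) < eps / 2) in Q2.
  eapply Rle_lt_trans; [apply Cmod_le_Re_Im|].
  change (Rabs (Re (f s) - Re (f x)) + Rabs (Im (f s) - Im (f x)) < eps). lra.
Qed.

Lemma exp_pow_le (k : nat) (x : R) : 0 < x -> x ^ k * exp (- x) <= INR (Factorial.fact k).
Proof.
  intros Hx.
  assert (H := exp_ge_taylor x k (Rlt_le _ _ Hx)).
  assert (Hf := INR_fact_lt_0 k).
  assert (Ht : x ^ k / INR (Factorial.fact k) <= exp x).
  { eapply Rle_trans; [|exact H].
    apply (term_le_sum (fun j => x ^ j / INR (Factorial.fact j)) k k (le_n k)).
    intros j. apply Rdiv_le_0_compat; [apply pow_le; lra|apply INR_fact_lt_0]. }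
  rewrite exp_Ropp. assert (He := exp_pos x).
  apply Rmult_le_reg_r with (exp x); auto.
  rewrite Rmult_assoc, Rinv_l, Rmult_1_r by lra.
  apply Rmult_le_reg_r with (/ INR (Factorial.fact k)); [apply Rinv_0_lt_compat; auto|].
  rewrite (Rmult_comm (INR (Factorial.fact k))), Rmult_assoc, Rinv_r, Rmult_1_r by lra.
  exact Ht.
Qed.

Lemma ex_series_pow_exp (k : nat) (y : R) : 0 < y ->
  ex_series (fun n => INR n ^ k * exp (- (INR n * y))).
Proof.
  intros Hy.
  apply ex_series_dominated with
    (fun n => (INR (Factorial.fact k) * (/ (y / 2)) ^ k) * exp (- (y / 2)) ^ n).
  - apply ex_series_Rscal, ex_series_geom.
    rewrite Rabs_pos_eq by (left; apply exp_pos).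
    rewrite <- exp_0. apply exp_increasing. lra.
  - intros n.
    assert (He : exp (- (y / 2)) ^ n = exp (- (INR n * (y / 2)))).
    { induction n as [|n IH].
      - simpl. rewrite Rmult_0_l, Ropp_0, exp_0. reflexivity.
      - rewrite S_INR. simpl pow. rewrite IH, <- exp_plus. f_equal. ring. }
    rewrite He.
    replace (exp (- (INR n * y))) with (exp (- (INR n * (y / 2))) * exp (- (INR n * (y / 2))))
      by (rewrite <- exp_plus; f_equal; field).
    rewrite Rabs_pos_eq.
    2: { apply Rmult_le_pos; [apply pow_le, pos_INR|].
         apply Rmult_le_pos; left; apply exp_pos. }
    rewrite <- Rmult_assoc. apply Rmult_le_compat_r; [left; apply exp_pos|].
    assert (Hk : 0 < (/ (y / 2)) ^ k) by (apply pow_lt, Rinv_0_lt_compat; lra).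
    replace (INR n) with (INR n * (y / 2) * / (y / 2)) at 1 by (field; lra).
    rewrite Rpow_mult_distr, Rmult_assoc, (Rmult_comm ((/ (y / 2)) ^ k)), <- Rmult_assoc.
    apply Rmult_le_compat_r; [lra|].
    destruct n as [|n].
    + simpl INR. rewrite Rmult_0_l, Ropp_0, exp_0, Rmult_1_r.
      assert (Hf : 1 <= INR (Factorial.fact k)) by (apply (le_INR 1), Factorial.lt_O_fact).
      destruct k; [simpl; lra|]. rewrite pow_ne_zero; [lra|lia].
    + apply exp_pow_le. rewrite S_INR. assert (H0 := pos_INR n). nra.
Qed.

Definition dcoef_iter (k : nat) (a : nat -> C) (n : nat) : C := Cmult (INR n ^ k)%R (a n).

Lemma dcoef_dcoef_iter (k : nat) (a : nat -> C) (n : nat) : dcoef (dcoef_iter k a) n =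
  dcoef_iter (S k) a n.
Proof. unfold dcoef, dcoef_iter. simpl pow. rewrite RtoC_mult. ring. Qed.

Lemma Cmod_dcoef_iter (k : nat) (a : nat -> C) (n : nat) :
  Cmod (dcoef_iter k a n) = INR n ^ k * Cmod (a n).
Proof.
  unfold dcoef_iter. rewrite Cmod_mult, Cmod_R, Rabs_pos_eq; auto.
  apply pow_le, pos_INR.
Qed.

Lemma mode_sum_zero (z : C) : mode_sum (fun _ => RtoC 0) z = 0.
Proof.
  unfold mode_sum, Csum. apply C_ext; simpl; apply Series_zero; intros n; ring.
Qed.

(** On the real axis each derivative costs a factor [n], and the weight pays for
    exactly one. *)
Lemma Cder_mode_sum_real (a : nat -> C) (x : R) : wsummable a ->
  Cder (fun s => mode_sum a (RtoC s)) x (Cmult Ci (mode_sum (dcoef a) (RtoC x))).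
Proof.
  intros Ha.
  apply (Cder_eq _ _ (Cplus (mode_sum (fun _ => RtoC 0) (RtoC x))
                       (Cmult (Cmult Ci (RtoC 1)) (mode_sum (dcoef a) (RtoC x))))).
  - apply (Cder_mode_sum_curve (fun _ => a) (fun _ _ => RtoC 0) RtoC (fun _ => RtoC 1)
             (fun n => Cmod (a n)) 0 1 x 1); intros; try lra.
    + apply ex_series_ext with (2 := Ha). intros n.
      rewrite Rmult_0_r, Ropp_0, exp_0. rewrite Rmult_1_r. reflexivity.
    + apply Cder_real. apply (is_derive_id (K := R_AbsRing)).
    + rewrite Cmod_1; lra.
    + simpl; lra.
    + apply Cder_const.
    + rewrite Cmod_0. apply Cmod_ge_0.
  - rewrite mode_sum_zero. ring.
Qed.

(** Above the real axis the factors exp(- n y) pay for any number of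
    derivatives, so bounded coefficients suffice. *)
Lemma Cder_mode_sum_dcoef_iter (a : nat -> C) (M : R) (k : nat) (zeta dzeta : R -> C)
  (L x d : R) :
  0 < d -> 0 <= L -> (forall n, Cmod (a n) <= M) -> 0 < Im (zeta x) ->
  (forall s, Rabs (s - x) < d -> Cder zeta s (dzeta s)) ->
  (forall s, Rabs (s - x) < d -> Cmod (dzeta s) <= L) ->
  Cder (fun s => mode_sum (dcoef_iter k a) (zeta s)) x
    (Cmult (Cmult Ci (dzeta x)) (mode_sum (dcoef_iter (S k) a) (zeta x))).
Proof.
  intros Hd HL HM Hy Hz HzL.
  assert (H0 : Rabs (x - x) < d).
  { replace (x - x) with 0 by ring. rewrite Rabs_R0; exact Hd. }
  assert (Hy2 : 0 < Im (zeta x) / 2) by lra.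
  destruct (Cder_continuous _ _ _ _ (Hz x H0) Hy2) as [d1 [Hd1 Hc]].
  assert (HM0 : 0 <= M) by (eapply Rle_trans; [apply Cmod_ge_0|apply (HM 0%nat)]).
  apply (Cder_eq _ _ (Cplus (mode_sum (fun _ => RtoC 0) (zeta x))
                       (Cmult (Cmult Ci (dzeta x)) (mode_sum (dcoef (dcoef_iter k a)) (zeta
                         x))))).
  - apply (Cder_mode_sum_curve (fun _ => dcoef_iter k a) (fun _ _ => RtoC 0) zeta dzeta
             (fun n => INR n ^ k * M) (Im (zeta x) / 2) L x (Rmin d d1)).
    + apply Rmin_pos; auto.
    + exact HL.
    + apply ex_series_ext with (fun n =>
        M * (INR n ^ k * exp (- (INR n * (Im (zeta x) / 2)))) +
        M * (INR n ^ (S k) * exp (- (INR n * (Im (zeta x) / 2))))).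
      * intros n. simpl. ring.
      * apply (ex_series_plus
          (fun n => M * (INR n ^ k * exp (- (INR n * (Im (zeta x) / 2)))))
          (fun n => M * (INR n ^ (S k) * exp (- (INR n * (Im (zeta x) / 2))))));
          apply ex_series_Rscal, ex_series_pow_exp; auto.
    + intros s Hs. apply Hz. eapply Rlt_le_trans; [exact Hs|apply Rmin_l].
    + intros s Hs. apply HzL. eapply Rlt_le_trans; [exact Hs|apply Rmin_l].
    + intros s Hs. assert (Q := Hc s (Rlt_le_trans _ _ _ Hs (Rmin_r _ _))).
      assert (Q2 := Rabs_Im_le (Cminus (zeta s) (zeta x))).
      change (Im (Cminus (zeta s) (zeta x))) with (Im (zeta s) - Im (zeta x)) in Q2.
      apply Rabs_le_between in Q2. lra.
    + intros. apply Cder_const.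
    + intros. rewrite Cmod_dcoef_iter. apply Rmult_le_compat_l; auto. apply pow_le, pos_INR.
    + intros. rewrite Cmod_0. apply Rmult_le_pos; auto. apply pow_le, pos_INR.
  - rewrite mode_sum_zero, (mode_sum_ext _ _ _ (dcoef_dcoef_iter k a)). ring.
Qed.

(** Induction on the order of the derivative. It yields smoothness without a
    formula for the derivatives of higher order. *)
Lemma smooth_of_closed_class (U : R -> Prop) (P : (R -> C) -> Prop) :
  open U ->
  (forall phi, P phi -> exists psi, P psi /\ forall x, U x -> Cder phi x (psi x)) ->
  forall phi, P phi -> forall n x, U x -> ex_derive_n (fun s => Re (phi s)) n x.
Proof.
  intros HU HP phi Hphi.
  assert (H : forall n, exists psi, P psi /\
            forall x, U x -> Derive_n (fun s => Re (phi s)) n x = Re (psi x)).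
  { induction n as [|n [psi [Hpsi IH]]].
    - exists phi. split; auto.
    - destruct (HP psi Hpsi) as [chi [Hchi Hd]]. exists chi. split; auto.
      intros x Hx. simpl.
      rewrite (Derive_ext_loc _ (fun s => Re (psi s))).
      + apply is_derive_unique, (Hd x Hx).
      + apply (filter_imp U); auto. }
  intros [|n] x Hx; simpl; auto.
  destruct (H n) as [psi [Hpsi Heq]]. destruct (HP psi Hpsi) as [chi [_ Hd]].
  exists (Re (chi x)).
  apply (is_derive_ext_loc (fun s => Re (psi s))); [|apply (Hd x Hx)].
  apply (filter_imp U); [|apply HU; exact Hx]. intros s Hs; symmetry; auto.
Qed.

(** * Complex Burgers flow and its characteristics *)

(** The complex Burgers equation f_t = - (i/2) f f_x in terms of the
    coefficients of f. *)
Definition coef_flow (a : R -> nat -> C) (T : R) : Prop :=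
  (forall t, 0 <= t < T -> wsummable (a t)) /\
  (forall t, 0 <= t < T -> forall eps, 0 < eps ->
     exists d, 0 < d /\ forall r, 0 <= r < T -> Rabs (r - t) < d ->
       wnorm (fun n => Cminus (a r n) (a t n)) < eps) /\
  (forall t n, 0 < t < T ->
     Cder (fun r => a r n) t (Cmult (RtoC (1 / 2)) (conv (a t) (dcoef (a t)) n))).

Lemma coef_flow_bounded (a : R -> nat -> C) (T : R) : 0 < T -> coef_flow a T ->
  exists t1 M, 0 < t1 <= T /\ 0 <= M /\ forall t, 0 <= t < t1 -> wnorm (a t) <= M.
Proof.
  intros HT [Hs [Hc _]].
  destruct (Hc 0 (conj (Rle_refl 0) HT) 1 Rlt_0_1) as [d [Hd Hw]].
  assert (H0 : wsummable (a 0)) by (apply Hs; lra).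
  exists (Rmin d T), (1 + wnorm (a 0)). split; [|split].
  - split; [apply Rmin_pos; auto|apply Rmin_r].
  - assert (H := wnorm_nonneg _ H0). lra.
  - intros t Ht. assert (B1 := Rmin_l d T). assert (B2 := Rmin_r d T).
    eapply Rle_trans; [apply (wnorm_triangle (a t) (a 0)); auto; apply Hs; lra|].
    apply Rplus_le_compat_r. left. apply Hw; [lra|].
    rewrite Rminus_0_r, Rabs_pos_eq; lra.
Qed.

Lemma mode_sum_continuous_curve (a : nat -> C) (zeta : R -> C) (l : C) (eps : R) :
  summable a -> Cder zeta 0 l -> (forall s, 0 <= s -> 0 <= Im (zeta s)) -> 0 < eps ->
  exists d, 0 < d /\ forall s, 0 <= s < d ->
    Cmod (Cminus (mode_sum a (zeta s)) (mode_sum a (zeta 0))) < eps.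
Proof.
  intros Ha Hz Hpos He.
  pose (FF := within (fun s => 0 <= s) (locally 0)).
  assert (Hf : Filter FF) by (apply within_filter, locally_filter).
  assert (L : filterlim
    (fun s => Series (fun n => Cmod (Cmult (a n) (Cminus (mode n (zeta s)) (mode n (zeta 0))))))
    FF (locally (Series (fun _ => 0)))).
  { apply Series_dominated_convergence with (B := fun n => 2 * Cmod (a n)); auto.
    - apply ex_series_Rscal; exact Ha.
    - unfold FF, within. exists (mkposreal 1 Rlt_0_1). intros s _ Hs n.
      rewrite Rabs_pos_eq by apply Cmod_ge_0. rewrite Cmod_mult.
      assert (H1 := Cmod_mode_le_1 n (zeta s) (Hpos s Hs)).
      assert (H2 := Cmod_mode_le_1 n (zeta 0) (Hpos 0 (Rle_refl 0))).
      assert (H3 := Cmod_triangle (mode n (zeta s)) (Copp (mode n (zeta 0)))).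
      rewrite Cmod_opp in H3.
      change (Cmod (Cminus (mode n (zeta s)) (mode n (zeta 0)))
              <= Cmod (mode n (zeta s)) + Cmod (mode n (zeta 0))) in H3.
      assert (H4 := Cmod_ge_0 (a n)). nra.
    - intros n. rewrite Rabs_R0. assert (H := Cmod_ge_0 (a n)). lra.
    - intros n. apply filterlim_locally. intros e.
      assert (Hd := Cder_scal (a n) _ _ _ (Cder_mode n _ _ _ Hz)).
      destruct (Cder_continuous _ _ _ e Hd (cond_pos e)) as [d [Hd0 Hdd]].
      exists (mkposreal d Hd0). intros s Hs _.
      change (Rabs (s - 0) < d) in Hs. specialize (Hdd s Hs).
      change (Rabs (Cmod (Cmult (a n) (Cminus (mode n (zeta s)) (mode n (zeta 0)))) - 0) < e).
      rewrite Rminus_0_r, Rabs_pos_eq by apply Cmod_ge_0.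
      replace (Cmult (a n) (Cminus (mode n (zeta s)) (mode n (zeta 0)))) with
        (Cminus (Cmult (a n) (mode n (zeta s))) (Cmult (a n) (mode n (zeta 0)))) by ring.
      exact Hdd. }
  rewrite Series_zero in L by reflexivity.
  rewrite filterlim_locally in L. destruct (L (mkposreal eps He)) as [d Hd].
  exists d. split; [apply cond_pos|]. intros s Hs.
  assert (Hb : ball 0 d s).
  { change (Rabs (s - 0) < d). rewrite Rminus_0_r, Rabs_pos_eq; lra. }
  specialize (Hd s Hb (proj1 Hs)).
  change (Rabs (Series (fun n => Cmod (Cmult (a n) (Cminus (mode n (zeta s)) (mode n (zeta
    0))))) - 0) < eps)
    in Hd.
  rewrite Rminus_0_r in Hd. eapply Rle_lt_trans; [|eapply Rle_lt_trans; [apply Rle_abs|exact Hd]].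
  assert (Hz0 := Hpos 0 (Rle_refl 0)). assert (Hzs := Hpos s (proj1 Hs)).
  unfold mode_sum. rewrite <- Csum_minus by auto using summable_mul_mode.
  assert (Hsum := summable_plus _ _ (summable_mul_mode _ _ Ha Hzs)
                    (summable_scal (-1) _ (summable_mul_mode _ _ Ha Hz0))).
  apply Cmod_Csum_le.
  - apply ex_series_ext with (2 := Hsum). intros n. f_equal. ring.
  - intros n. right. f_equal. ring.
Qed.

Lemma Cder_square_modulus (w : R -> C) (x : R) (l : C) : Cder w x l ->
  is_derive (fun s => Cmod (w s) ^ 2) x (2 * Re (Cmult (Cconj (w x)) l)).
Proof.
  intros [H1 H2].
  apply (is_derive_ext (fun s => Re (w s) * Re (w s) + Im (w s) * Im (w s))).
  - intros s. rewrite Cmod_sqr. simpl. ring.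
  - apply (is_derive_eq _ _ _ _ (is_derive_Rplus _ _ _ _ _
      (is_derive_Rmult _ _ _ _ _ H1 H1) (is_derive_Rmult _ _ _ _ _ H2 H2))).
    unfold Re, Im; simpl. ring.
Qed.

(** Gronwall's argument: |w|^2 exp(- M s) does not increase, and it tends to 0
    at time 0. *)
Lemma Gronwall_zero (w k : R -> C) (M t1 : R) :
  (forall s, 0 < s < t1 -> Cder w s (Cmult (k s) (w s))) ->
  (forall s, 0 < s < t1 -> 2 * Cmod (k s) <= M) ->
  (forall eps, 0 < eps -> exists d, 0 < d /\ forall s, 0 < s < d -> Cmod (w s) < eps) ->
  forall t, 0 < t < t1 -> w t = 0.
Proof.
  intros Hw Hk H0 t Ht.
  set (q := fun s => Cmod (w s) ^ 2 * exp (- (M * s))).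
  assert (Hdq : forall s, 0 < s < t1 ->
    is_derive q s ((2 * Re (k s) - M) * q s)).
  { intros s Hs. unfold q.
    assert (He : is_derive (fun s => exp (- (M * s))) s (- M * exp (- (M * s))))
      by (auto_derive; [exact I|ring]).
    apply (is_derive_eq _ _ _ _ (is_derive_Rmult _ _ _ _ _
             (Cder_square_modulus _ _ _ (Hw s Hs)) He)).
    rewrite Cmod_sqr. unfold Re, Im; simpl. ring. }
  assert (Hmono : forall s, 0 < s < t -> q t <= q s).
  { intros s Hs.
    destruct (MVT_gen q s t (fun r => (2 * Re (k r) - M) * q r)) as [c [Hc Heq]].
    - intros r Hr. rewrite Rmin_left, Rmax_right in Hr by lra. apply Hdq; lra.
    - intros r Hr. rewrite Rmin_left, Rmax_right in Hr by lra.
      apply continuity_pt_filterlim.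
      apply (ex_derive_continuous q). eexists; apply Hdq; lra.
    - rewrite Rmin_left, Rmax_right in Hc by lra.
      assert (Hq : 0 <= q c) by (apply Rmult_le_pos; [apply pow2_ge_0|left; apply exp_pos]).
      assert (B1 := Rabs_Re_le (k c)). assert (B2 := Rle_abs (Re (k c))).
      assert (B3 : 2 * Cmod (k c) <= M) by (apply Hk; lra).
      assert ((2 * Re (k c) - M) * q c <= 0) by nra.
      nra. }
  assert (HM : 0 <= M).
  { assert (B3 := Hk t Ht). assert (B := Cmod_ge_0 (k t)). lra. }
  destruct (Req_dec (Cmod (w t)) 0) as [Hz|Hz]; [apply Cmod_eq_0; exact Hz|exfalso].
  assert (Hqt : 0 < q t).
  { apply Rmult_lt_0_compat; [|apply exp_pos].
    apply pow_lt. assert (B := Cmod_ge_0 (w t)). lra. }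
  assert (Hsq : 0 < sqrt (q t)) by (apply sqrt_lt_R0; auto).
  destruct (H0 _ Hsq) as [d [Hd Hwd]].
  set (s := Rmin (d / 2) (t / 2)).
  assert (Hs1 : 0 < s) by (apply Rmin_pos; lra).
  assert (Hs2 : s <= d / 2) by apply Rmin_l.
  assert (Hs3 : s <= t / 2) by apply Rmin_r.
  assert (Hm := Hmono s ltac:(lra)).
  assert (Hws := Hwd s ltac:(lra)).
  assert (Hq2 : q s <= Cmod (w s) ^ 2).
  { unfold q. rewrite <- (Rmult_1_r (Cmod (w s) ^ 2)) at 2.
    apply Rmult_le_compat_l; [apply pow2_ge_0|].
    rewrite <- exp_0. destruct (Req_dec (M * s) 0) as [e|e].
    - rewrite e, Ropp_0; lra.
    - left. apply exp_increasing. assert (0 <= M * s) by nra. lra. }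
  assert (Hq3 : sqrt (q t) * sqrt (q t) = q t) by (apply sqrt_sqrt; lra).
  assert (B := Cmod_ge_0 (w s)).
  assert (Hlt := Rmult_le_0_lt_compat _ _ _ _ B B Hws Hws).
  rewrite Hq3 in Hlt. simpl in Hq2. lra.
Qed.

(** A positive real part of the initial value f0 sends the characteristic into
    the open half plane at once. There the chain rule applies although only the
    coefficients are known to be differentiable in time, and the difference
    between the solution and f0 satisfies a linear equation. *)
Lemma characteristic (a : R -> nat -> C) (T t1 M x : R) :
  coef_flow a T -> t1 <= T -> 0 <= M ->
  (forall t, 0 <= t < t1 -> wnorm (a t) <= M) ->
  0 < Re (mode_sum (a 0) (RtoC x)) ->
  forall t, 0 < t < t1 ->
    mode_sum (a t) (Cplus (RtoC x) (Cmult (Cmult Ci (RtoC (t / 2))) (mode_sum (a 0) (RtoC x))))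
      = mode_sum (a 0) (RtoC x).
Proof.
  intros [Hs [Hc Ho]] HtT HM Hb Hpos.
  set (f0 := mode_sum (a 0) (RtoC x)) in *.
  set (zeta := fun s => Cplus (RtoC x) (Cmult (Cmult Ci (RtoC (s / 2))) f0)).
  assert (HIm : forall s, Im (zeta s) = s / 2 * Re f0).
  { intros s. unfold zeta, Re, Im; simpl. ring. }
  assert (Hz : forall s, Cder zeta s (Cmult (Cmult Ci (RtoC (1 / 2))) f0)).
  { intros s. apply (Cder_eq _ _ (Cplus 0 (Cplus (Cmult (Cmult Ci (RtoC (1 / 2))) f0)
                               (Cmult (Cmult Ci (RtoC (s / 2))) 0)))); [|ring].
    apply Cder_plus; [apply Cder_const|].
    apply (Cder_mult (fun s => Cmult Ci (RtoC (s / 2))) (fun _ => f0)); [|apply Cder_const].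
    apply (Cder_scal Ci (fun s => RtoC (s / 2))), Cder_real. auto_derive; [exact I|field]. }
  intros t Ht.
  assert (Ha0 : wsummable (a 0)) by (apply Hs; lra).
  assert (G : forall s, 0 < s < t1 -> Cminus (mode_sum (a s) (zeta s)) f0 = 0).
  { apply Gronwall_zero with (k := fun s => Cmult (RtoC (1 / 2)) (mode_sum (dcoef (a s)) (zeta
    s)))
                             (M := M).
    - intros s Hs1.
      assert (Hws : wsummable (a s)) by (apply Hs; lra).
      assert (Hzs : 0 <= Im (zeta s)) by (rewrite HIm; nra).
      assert (Hdd : 0 < Rmin (s / 2) (t1 - s)) by (apply Rmin_pos; lra).
      assert (Hr : forall r, Rabs (r - s) < Rmin (s / 2) (t1 - s) -> s / 2 < r < t1).
      { intros r Hr. assert (B1 := Rmin_l (s / 2) (t1 - s)).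
        assert (B2 := Rmin_r (s / 2) (t1 - s)). apply Rabs_def2 in Hr. lra. }
      assert (Hy : 0 < s / 4 * Re f0) by nra.
      assert (HF : Cder (fun r => mode_sum (a r) (zeta r)) s
        (Cplus (mode_sum (fun n => Cmult (RtoC (1 / 2)) (conv (a s) (dcoef (a s)) n)) (zeta s))
           (Cmult (Cmult Ci (Cmult (Cmult Ci (RtoC (1 / 2))) f0)) (mode_sum (dcoef (a s)) (zeta
             s))))).
      { apply (Cder_mode_sum_curve a (fun r n => Cmult (RtoC (1 / 2)) (conv (a r) (dcoef (a r))
        n))
          zeta (fun _ => Cmult (Cmult Ci (RtoC (1 / 2))) f0)
          (fun _ => M + M * M) (s / 4 * Re f0) (Cmod (Cmult (Cmult Ci (RtoC (1 / 2))) f0))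
          s (Rmin (s / 2) (t1 - s))); auto.
        - apply Cmod_ge_0.
        - apply ex_series_ext with (fun n =>
            (M + M * M) * (INR n ^ 0 * exp (- (INR n * (s / 4 * Re f0)))) +
            (M + M * M) * (INR n ^ 1 * exp (- (INR n * (s / 4 * Re f0))))).
          + intros n. simpl. ring.
          + apply (ex_series_plus
              (fun n => (M + M * M) * (INR n ^ 0 * exp (- (INR n * (s / 4 * Re f0)))))
              (fun n => (M + M * M) * (INR n ^ 1 * exp (- (INR n * (s / 4 * Re f0))))));
              apply ex_series_Rscal, ex_series_pow_exp; auto.
        - intros; lra.
        - intros r Hrr. apply Hr in Hrr. rewrite HIm. nra.
        - intros n r Hrr. apply Hr in Hrr. apply Ho. lra.
        - intros n r Hrr. apply Hr in Hrr.
          assert (Hwr : wsummable (a r)) by (apply Hs; lra).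
          assert (B := Hb r ltac:(lra)).
          assert (B1 := term_le_Series _ n Hwr (weighted_nonneg (a r))).
          assert (B2 := Cmod_le_weighted (a r) n). unfold wnorm in B. nra.
        - intros n r Hrr. apply Hr in Hrr.
          assert (Hwr : wsummable (a r)) by (apply Hs; lra).
          assert (B := Hb r ltac:(lra)).
          rewrite Cmod_mult, Cmod_R, Rabs_pos_eq by lra.
          assert (B1 := Cmod_conv_le (a r) (dcoef (a r)) n (wsummable_summable _ Hwr)
                          (wsummable_dcoef _ Hwr)).
          assert (B2 := Series_Cmod_le_wnorm _ Hwr).
          assert (B3 := Series_Cmod_dcoef_le_wnorm _ Hwr).
          assert (P1 : 0 <= Series (fun n => Cmod (a r n))).
          { apply Series_nonneg; [apply wsummable_summable; auto|intros; apply Cmod_ge_0]. }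
          assert (P2 : 0 <= Series (fun n => Cmod (dcoef (a r) n))).
          { apply Series_nonneg; [apply wsummable_dcoef; auto|intros; apply Cmod_ge_0]. }
          assert (B4 := Rmult_le_compat _ M _ M P1 P2 ltac:(lra) ltac:(lra)).
          assert (B5 := Cmod_ge_0 (conv (a r) (dcoef (a r)) n)). nra. }
      assert (HW := Cder_plus _ _ _ _ _ HF (Cder_const (Copp f0) s)).
      apply (Cder_eq _ _ _ _ HW).
      rewrite mode_sum_scal, mode_sum_conv;
        auto using summable_conv, wsummable_summable, wsummable_dcoef.
      replace (Cmult Ci (Cmult (Cmult Ci (RtoC (1 / 2))) f0))
        with (Copp (Cmult (RtoC (1 / 2)) f0)) by (apply C_ext; unfold Re, Im; simpl; ring).
      ring.
    - intros s Hs1.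
      rewrite Cmod_mult, Cmod_R, Rabs_pos_eq by lra.
      assert (B := Hb s ltac:(lra)).
      assert (B1 : Cmod (mode_sum (dcoef (a s)) (zeta s)) <= wnorm (a s)).
      { apply Cmod_mode_sum_deriv_le_wnorm; [apply Hs; lra|rewrite HIm; nra]. }
      lra.
    - intros eps He.
      assert (He2 : 0 < eps / 2) by lra.
      destruct (Hc 0 ltac:(lra) _ He2) as [d1 [Hd1 Hw1]].
      assert (Hposz : forall s, 0 <= s -> 0 <= Im (zeta s)) by (intros s Hs0; rewrite HIm; nra).
      destruct (mode_sum_continuous_curve (a 0) zeta _ (eps / 2) (wsummable_summable _ Ha0)
                  (Hz 0) Hposz He2) as [d2 [Hd2 Hw2]].
      exists (Rmin (Rmin d1 d2) t1). split; [repeat apply Rmin_pos; lra|].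
      intros s Hs1.
      assert (Q1 := Rmin_l (Rmin d1 d2) t1). assert (Q2 := Rmin_r (Rmin d1 d2) t1).
      assert (Q3 := Rmin_l d1 d2). assert (Q4 := Rmin_r d1 d2).
      assert (Hws : wsummable (a s)) by (apply Hs; lra).
      replace (zeta 0) with (RtoC x) in Hw2
        by (unfold zeta; apply C_ext; unfold Re, Im; simpl; field).
      fold f0 in Hw2.
      replace (Cminus (mode_sum (a s) (zeta s)) f0) with
        (Cplus (Cminus (mode_sum (a s) (zeta s)) (mode_sum (a 0) (zeta s)))
               (Cminus (mode_sum (a 0) (zeta s)) f0)) by ring.
      eapply Rle_lt_trans; [apply Cmod_triangle|].
      assert (W2 := Hw2 s ltac:(lra)).
      assert (W1 : wnorm (fun n => Cminus (a s n) (a 0 n)) < eps / 2).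
      { apply Hw1; [lra|]. rewrite Rminus_0_r, Rabs_pos_eq; lra. }
      rewrite <- mode_sum_minus; auto using wsummable_summable; [|apply Hposz; lra].
      assert (W3 := Cmod_mode_sum_le_wnorm (fun n => Cminus (a s n) (a 0 n)) (zeta s)
                      (wsummable_minus _ _ Hws Ha0) (Hposz s ltac:(lra))).
      lra. }
  assert (Gt := G t Ht). unfold zeta in Gt.
  replace (mode_sum (a t) (Cplus (RtoC x) (Cmult (Cmult Ci (RtoC (t / 2))) f0)))
    with (Cplus (Cminus (mode_sum (a t) (Cplus (RtoC x) (Cmult (Cmult Ci (RtoC (t / 2))) f0)))
      f0) f0)
    by ring.
  rewrite Gt. ring.
Qed.

(** * Smoothness of the initial value where its real part is positive *)

(** The functions met when the sum of the series is differentiated repeatedly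
    along a curve [zeta] with derivative [K]. *)
Inductive curve_algebra (c : nat -> C) (zeta K : R -> C) : (R -> C) -> Prop :=
| alg_const : forall k, curve_algebra c zeta K (fun _ => k)
| alg_deriv : forall k, curve_algebra c zeta K (fun x => mode_sum (dcoef_iter k c) (zeta x))
| alg_speed : curve_algebra c zeta K K
| alg_plus : forall f g, curve_algebra c zeta K f -> curve_algebra c zeta K g ->
    curve_algebra c zeta K (fun x => Cplus (f x) (g x))
| alg_mult : forall f g, curve_algebra c zeta K f -> curve_algebra c zeta K g ->
    curve_algebra c zeta K (fun x => Cmult (f x) (g x)).

(** The relation between the speed and the first derivative, which comes from an
    implicit equation for the curve, makes the speed a rational function of that
    derivative; this closes the algebra under differentiation. *)
Lemma curve_algebra_closed (c : nat -> C) (zeta K : R -> C) (U : R -> Prop) (k : C) (M L : R) :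
  open U -> 0 <= L ->
  (forall n, Cmod (c n) <= M) ->
  (forall x, U x -> 0 < Im (zeta x)) ->
  (forall x, U x -> Cder zeta x (K x)) ->
  (forall x, U x -> Cmod (K x) <= L) ->
  (forall x, U x -> Cmult (K x) (Cplus 1 (Cmult k (mode_sum (dcoef_iter 1 c) (zeta x)))) = 1) ->
  forall phi, curve_algebra c zeta K phi ->
    exists psi, curve_algebra c zeta K psi /\ forall x, U x -> Cder phi x (psi x).
Proof.
  intros HU HL HM Hy Hz HzL HK.
  assert (HD : forall j x, U x -> Cder (fun s => mode_sum (dcoef_iter j c) (zeta s)) x
             (Cmult (Cmult Ci (K x)) (mode_sum (dcoef_iter (S j) c) (zeta x)))).
  { intros j x Hx. destruct (HU x Hx) as [d Hd].
    apply (Cder_mode_sum_dcoef_iter c M j zeta K L x d (cond_pos d)); auto. }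
  intros phi Hphi. induction Hphi as [w|j| |f g Hf [f' [Hf' IHf]] Hg [g' [Hg' IHg]]
                                     |f g Hf [f' [Hf' IHf]] Hg [g' [Hg' IHg]]].
  - exists (fun _ => RtoC 0). split; [apply alg_const|]. intros; apply Cder_const.
  - exists (fun x => Cmult (Cmult Ci (K x)) (mode_sum (dcoef_iter (S j) c) (zeta x))). split;
    auto.
    apply (alg_mult _ _ _ (fun x => Cmult Ci (K x)) (fun x => mode_sum (dcoef_iter (S j) c)
      (zeta x)));
      [|apply alg_deriv].
    apply (alg_mult _ _ _ (fun _ => Ci) K); [apply alg_const|apply alg_speed].
  - (* K is the inverse of q = 1 + k (- i F') on [U], so K' = - k K^2 (- i F')',
       where (- i F')' is the derivative along the curve *)
    exists (fun x => Cmult (Cmult (Copp k) (Cmult (K x) (K x)))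
                       (Cmult (Cmult Ci (K x)) (mode_sum (dcoef_iter 2 c) (zeta x)))).
    split.
    + apply (alg_mult _ _ _ (fun x => Cmult (Copp k) (Cmult (K x) (K x)))
               (fun x => Cmult (Cmult Ci (K x)) (mode_sum (dcoef_iter 2 c) (zeta x)))).
      * apply (alg_mult _ _ _ (fun _ => Copp k) (fun x => Cmult (K x) (K x)));
          [apply alg_const|]. apply alg_mult; apply alg_speed.
      * apply (alg_mult _ _ _ (fun x => Cmult Ci (K x)) (fun x => mode_sum (dcoef_iter 2 c)
        (zeta x)));
          [|apply alg_deriv].
        apply (alg_mult _ _ _ (fun _ => Ci) K); [apply alg_const|apply alg_speed].
    + intros x Hx.
      set (q := fun s => Cplus 1 (Cmult k (mode_sum (dcoef_iter 1 c) (zeta s)))).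
      assert (Hq0 : forall s, U s -> q s <> 0).
      { intros s Hs Hq. assert (He := HK s Hs). fold (q s) in He.
        rewrite Hq, Cmult_0_r in He. injection He; intros; lra. }
      assert (HqK : forall s, U s -> Cinv (q s) = K s).
      { intros s Hs. assert (He := HK s Hs). fold (q s) in He.
        rewrite <- (Cmult_1_l (Cinv (q s))), <- He.
        rewrite <- Cmult_assoc, Cinv_r by auto. ring. }
      apply (Cder_ext_loc (fun s => Cinv (q s))).
      { apply (filter_imp U); auto. }
      assert (Hq' : Cder q x (Cplus 0 (Cmult k (Cmult (Cmult Ci (K x)) (mode_sum (dcoef_iter 2
        c) (zeta x)))))).
      { apply Cder_plus; [apply Cder_const|]. apply Cder_scal, HD, Hx. }
      apply (Cder_eq _ _ _ _ (Cder_inv _ _ _ Hq' (Hq0 x Hx))).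
      rewrite HqK by auto. ring.
  - exists (fun x => Cplus (f' x) (g' x)). split; [apply alg_plus; auto|].
    intros x Hx. apply Cder_plus; auto.
  - exists (fun x => Cplus (Cmult (f' x) (g x)) (Cmult (f x) (g' x))). split.
    + apply (alg_plus _ _ _ (fun x => Cmult (f' x) (g x)) (fun x => Cmult (f x) (g' x)));
        apply alg_mult; auto.
    + intros x Hx. apply Cder_mult; auto.
Qed.

Lemma open_Re_pos (f : R -> C) : (forall x, exists l, Cder f x l) -> open (fun x => 0 < Re (f x)).
Proof.
  intros Hf x Hx. destruct (Hf x) as [l Hl].
  destruct (Cder_continuous _ _ _ _ Hl Hx) as [d [Hd Hc]].
  exists (mkposreal d Hd). intros s Hs. specialize (Hc s Hs).
  assert (B := Rabs_Re_le (Cminus (f s) (f x))).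
  change (Re (Cminus (f s) (f x))) with (Re (f s) - Re (f x)) in B.
  apply Rabs_le_between in B. lra.
Qed.

(** At a fixed positive time the constancy along characteristics is an implicit
    equation f0 x = F (zeta x) with zeta x = x + (i t / 2) f0 x and F analytic
    near zeta x. Differentiated once, it expresses zeta' through F' (zeta x),
    and from there smoothness bootstraps. *)
Lemma coef_flow_initial_smooth (a : R -> nat -> C) (T x0 : R) :
  0 < T -> coef_flow a T -> 0 < Re (mode_sum (a 0) (RtoC x0)) ->
  smooth_at (fun x => Re (mode_sum (a 0) (RtoC x))) x0.
Proof.
  intros HT Hflow Hx0.
  destruct (coef_flow_bounded a T HT Hflow) as [t1 [M [Ht1 [HM Hb]]]].
  assert (Hs := proj1 Hflow).
  assert (Ha0 : wsummable (a 0)) by (apply Hs; lra).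
  set (t := t1 / 2).
  assert (Ht : 0 < t) by (unfold t; lra).
  assert (Htt1 : t < t1) by (unfold t; lra).
  assert (Hat : wsummable (a t)) by (apply Hs; lra).
  assert (HMt : wnorm (a t) <= M) by (apply Hb; lra).
  set (f0 := fun x => mode_sum (a 0) (RtoC x)).
  set (U := fun x => 0 < Re (f0 x)).
  assert (Hf0 : forall x, Cder f0 x (Cmult Ci (mode_sum (dcoef (a 0)) (RtoC x))))
    by (intros x; exact (Cder_mode_sum_real (a 0) x Ha0)).
  assert (HU : open U) by (apply open_Re_pos; intros x; eexists; apply Hf0).
  set (zeta := fun x => Cplus (RtoC x) (Cmult (Cmult Ci (RtoC (t / 2))) (f0 x))).
  set (K := fun x => Cplus 1 (Cmult (Cmult Ci (RtoC (t / 2))) (Cmult Ci (mode_sum (dcoef (a 0))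
    (RtoC x))))).
  assert (Hz : forall x, Cder zeta x (K x)).
  { intros x. apply Cder_plus; [|apply Cder_scal, Hf0].
    apply Cder_real. apply (is_derive_id (K := R_AbsRing)). }
  assert (Him : forall x, U x -> 0 < Im (zeta x)).
  { intros x Hx. unfold U in Hx. replace (Im (zeta x)) with (t / 2 * Re (f0 x)).
    - apply Rmult_lt_0_compat; lra.
    - unfold zeta, Re, Im; simpl. ring. }
  assert (Hcf : forall x, U x -> mode_sum (dcoef_iter 0 (a t)) (zeta x) = f0 x).
  { intros x Hx. rewrite (mode_sum_ext _ (a t)).
    - apply (characteristic a T t1 M); auto; lra.
    - intros n. unfold dcoef_iter. simpl pow. ring. }
  assert (Hcb : forall n, Cmod (a t n) <= M).
  { intros n. eapply Rle_trans; [apply Cmod_le_weighted|].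
    eapply Rle_trans; [|exact HMt]. apply term_le_Series; auto using weighted_nonneg. }
  set (L := 1 + t / 2 * M).
  assert (HL : 0 <= L) by (unfold L; nra).
  assert (HKL : forall x, Cmod (K x) <= L).
  { intros x. eapply Rle_trans; [apply Cmod_triangle|]. unfold L.
    rewrite Cmod_1. apply Rplus_le_compat_l.
    replace (Cmult (Cmult Ci (RtoC (t / 2))) (Cmult Ci (mode_sum (dcoef (a 0)) (RtoC x))))
      with (Cmult (RtoC (- (t / 2))) (mode_sum (dcoef (a 0)) (RtoC x)))
      by (apply C_ext; unfold Re, Im; simpl; ring).
    rewrite Cmod_mult, Cmod_R, Rabs_Ropp, Rabs_pos_eq by lra.
    apply Rmult_le_compat_l; [lra|].
    eapply Rle_trans; [apply Cmod_mode_sum_deriv_le_wnorm; auto; simpl; lra|apply Hb; lra]. }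
  (* the derivative of the implicit equation; it also shows that the second
     factor does not vanish *)
  assert (HKeq : forall x, U x ->
    Cmult (K x) (Cplus 1 (Cmult (RtoC (t / 2)) (mode_sum (dcoef_iter 1 (a t)) (zeta x)))) = 1).
  { intros x Hx.
    assert (Hd0 : Cder f0 x (Cmult (Cmult Ci (K x)) (mode_sum (dcoef_iter 1 (a t)) (zeta x)))).
    { apply (Cder_ext_loc (fun s => mode_sum (dcoef_iter 0 (a t)) (zeta s))).
      - apply (filter_imp U); auto.
      - apply (Cder_mode_sum_dcoef_iter (a t) M 0 zeta K L x 1); auto; lra. }
    assert (Heq := Cder_unique _ _ _ _ (Hf0 x) Hd0).
    assert (HKd : K x = Cplus 1 (Cmult (Cmult Ci (RtoC (t / 2)))
                          (Cmult (Cmult Ci (K x)) (mode_sum (dcoef_iter 1 (a t)) (zeta x))))).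
    { unfold K at 1. rewrite Heq. reflexivity. }
    replace (Cmult (Cmult Ci (RtoC (t / 2))) (Cmult (Cmult Ci (K x)) (mode_sum (dcoef_iter 1 (a
      t)) (zeta x))))
      with (Copp (Cmult (K x) (Cmult (RtoC (t / 2)) (mode_sum (dcoef_iter 1 (a t)) (zeta x)))))
        in HKd
      by (apply C_ext; unfold Re, Im; simpl; ring).
    rewrite Cmult_plus_distr_l. rewrite HKd at 1. ring. }
  assert (Hclosed := curve_algebra_closed (a t) zeta K U (RtoC (t / 2)) M L HU HL Hcb Him
                       (fun x _ => Hz x) (fun x _ => HKL x) HKeq).
  unfold smooth_at. apply (filter_imp U); [|apply HU; exact Hx0].
  intros x Hx n.
  apply (ex_derive_n_ext_loc (fun s => Re (mode_sum (dcoef_iter 0 (a t)) (zeta s)))).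
  - apply (filter_imp U); [|apply HU; exact Hx].
    intros s Hs0. rewrite Hcf by auto. reflexivity.
  - apply (smooth_of_closed_class U _ HU Hclosed
             (fun s => mode_sum (dcoef_iter 0 (a t)) (zeta s))); auto. apply alg_deriv.
Qed.

(** * Fourier coefficients and Fourier series *)

Lemma continuous_Series (f : nat -> R -> R) (B : nat -> R) (x : R) :
  ex_series B -> (forall n, continuous (f n) x) -> (forall n y, Rabs (f n y) <= B n) ->
  continuous (fun y => Series (fun n => f n y)) x.
Proof.
  intros HB Hc Hb. unfold continuous.
  apply (Series_dominated_convergence (locally x) (fun y n => f n y) (fun n => f n x) B); auto.
  apply filter_forall. auto.
Qed.

Lemma RInt_antiderivative (f G : R -> R) (a b : R) :
  (forall x, is_derive G x (f x)) -> (forall x, continuous f x) ->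
  RInt f a b = G b - G a.
Proof.
  intros HG Hf. apply is_RInt_unique.
  apply (is_RInt_derive (V := R_CompleteNormedModule)); auto.
Qed.

Lemma continuous_Rmult (f g : R -> R) (x : R) :
  continuous f x -> continuous g x -> continuous (fun y => f y * g y) x.
Proof. exact (continuous_mult (K := R_AbsRing) f g x). Qed.

Lemma continuous_Rplus (f g : R -> R) (x : R) :
  continuous f x -> continuous g x -> continuous (fun y => f y + g y) x.
Proof. exact (continuous_plus (V := R_NormedModule) f g x). Qed.

Lemma continuous_Rminus (f g : R -> R) (x : R) :
  continuous f x -> continuous g x -> continuous (fun y => f y - g y) x.
Proof. exact (continuous_minus (V := R_NormedModule) f g x). Qed.

Lemma continuous_of_derive (f : R -> R) (x l : R) : is_derive f x l -> continuous f x.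
Proof. intros H. apply (ex_derive_continuous f). eexists; exact H. Qed.

Lemma continuous_cos_lin (m p x : R) : continuous (fun y => cos (m * y + p)) x.
Proof. eapply continuous_of_derive. auto_derive; [exact I|reflexivity]. Qed.

Lemma sin_IZR_PI (m : Z) : sin (IZR m * PI) = 0.
Proof. apply sin_eq_0_1. exists m; reflexivity. Qed.

Lemma RInt_cos_phase (m : Z) (p : R) :
  RInt (fun x => cos (IZR m * x + p)) (- PI) PI = if Z.eq_dec m 0 then 2 * PI * cos p else 0.
Proof. eq_R.
  destruct (Z.eq_dec m 0) as [->|Hm].
  - rewrite (RInt_Rext _ (fun _ => cos p)).
    + rewrite RInt_Rconst. ring.
    + intros x _. f_equal. ring.
  - assert (Hm0 : IZR m <> 0) by (apply not_0_IZR; auto).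
    rewrite (RInt_antiderivative _ (fun x => sin (IZR m * x + p) / IZR m)).
    + replace (IZR m * - PI) with (- (IZR m * PI)) by ring.
      rewrite !sin_plus, sin_neg, cos_neg, sin_IZR_PI. field; auto.
    + intros x. auto_derive; [auto|field; auto].
    + intros x. apply continuous_cos_lin.
Qed.

Lemma RInt_cos_cos_phase (m k : Z) (p q : R) :
  RInt (fun x => cos (IZR m * x + p) * cos (IZR k * x + q)) (- PI) PI =
  ((if Z.eq_dec (m - k) 0 then 2 * PI * cos (p - q) else 0) +
   (if Z.eq_dec (m + k) 0 then 2 * PI * cos (p + q) else 0)) / 2.
Proof. eq_R.
  rewrite <- !RInt_cos_phase.
  rewrite <- RInt_Rplus by (apply ex_RInt_cont; intros; apply continuous_cos_lin).
  rewrite (RInt_Rext _ (fun x => / 2 *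
    (cos (IZR (m - k) * x + (p - q)) + cos (IZR (m + k) * x + (p + q))))).
  - rewrite RInt_Rscal; [unfold Rdiv; ring|].
    apply ex_RInt_cont. intros. apply continuous_Rplus; apply continuous_cos_lin.
  - intros x _. rewrite minus_IZR, plus_IZR.
    replace ((IZR m - IZR k) * x + (p - q)) with ((IZR m * x + p) - (IZR k * x + q)) by ring.
    replace ((IZR m + IZR k) * x + (p + q)) with ((IZR m * x + p) + (IZR k * x + q)) by ring.
    set (A := IZR m * x + p). set (B := IZR k * x + q).
    rewrite cos_minus, cos_plus. field.
Qed.

(** The factor 2 folds the coefficient at [- n] of a real function into the one
    at [n]. *)
Definition multiplicity (n : nat) : R := match n with O => 1 | S _ => 2 end.

(** The Taylor coefficients of the analytic function on the disc whose real
    part has boundary values [u]. *)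
Definition analytic_coef (u : R -> R) (n : nat) : C :=
  Cmult (RtoC (multiplicity n)) (fourier u (Z.of_nat n)).

Lemma analytic_coef_Re (u : R -> R) (n : nat) :
  Re (analytic_coef u n) =
  multiplicity n / (2 * PI) * RInt (fun x => u x * cos (INR n * x + 0)) (- PI) PI.
Proof.
  unfold analytic_coef, fourier. rewrite <- INR_IZR_INZ. unfold Re; simpl.
  rewrite (RInt_Rext (fun x => u x * cos (INR n * x + 0)) (fun x => u x * cos (INR n * x))).
  - unfold Rdiv. ring.
  - intros x _. rewrite Rplus_0_r. reflexivity.
Qed.

Lemma analytic_coef_Im (u : R -> R) (n : nat) : (forall x, continuous u x) ->
  Im (analytic_coef u n) =
  multiplicity n / (2 * PI) * RInt (fun x => u x * cos (INR n * x + PI / 2)) (- PI) PI.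
Proof.
  intros Hu. unfold analytic_coef, fourier. rewrite <- INR_IZR_INZ. unfold Im; simpl.
  rewrite (RInt_Rext (fun x => u x * cos (INR n * x + PI / 2))
             (fun x => (-1) * (u x * sin (INR n * x)))).
  - rewrite RInt_Rscal; [unfold Rdiv; ring|].
    apply ex_RInt_cont. intros x. apply continuous_Rmult; auto.
    eapply continuous_of_derive. auto_derive; [exact I|reflexivity].
  - intros x _. rewrite cos_plus, cos_PI2, sin_PI2. ring.
Qed.

Lemma analytic_coef_0_Im (u : R -> R) : Im (analytic_coef u 0) = 0.
Proof.
  unfold analytic_coef, fourier, Im; simpl.
  rewrite (RInt_Rext _ (fun _ => 0)).
  - rewrite RInt_Rconst. ring.
  - intros x _. rewrite Rmult_0_l, sin_0. ring.
Qed.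

Lemma fourier_minus (u v : R -> R) (n : Z) :
  (forall x, continuous u x) -> (forall x, continuous v x) ->
  fourier (fun x => u x - v x) n = Cminus (fourier u n) (fourier v n).
Proof.
  intros Hu Hv.
  assert (Hc : forall x, continuous (fun x => cos (IZR n * x)) x)
    by (intros; eapply continuous_of_derive; auto_derive; [exact I|reflexivity]).
  assert (Hs : forall x, continuous (fun x => sin (IZR n * x)) x)
    by (intros; eapply continuous_of_derive; auto_derive; [exact I|reflexivity]).
  assert (H : forall phi, (forall x, continuous phi x) ->
     RInt (fun x => (u x - v x) * phi x) (- PI) PI =
     RInt (fun x => u x * phi x) (- PI) PI - RInt (fun x => v x * phi x) (- PI) PI).
  { intros phi Hphi. rewrite <- RInt_Rminus;
      try (apply ex_RInt_cont; intros; apply continuous_Rmult; auto).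
    apply RInt_Rext. intros; ring. }
  unfold fourier. rewrite !H by auto. apply C_ext; unfold Re, Im; simpl; eq_R; ring.
Qed.

Lemma analytic_coef_minus (u v : R -> R) (n : nat) :
  (forall x, continuous u x) -> (forall x, continuous v x) ->
  analytic_coef (fun x => u x - v x) n = Cminus (analytic_coef u n) (analytic_coef v n).
Proof. intros Hu Hv. unfold analytic_coef. rewrite fourier_minus by auto. ring. Qed.

Lemma Series_single (c : nat -> R) (k : nat) : (forall n, n <> k -> c n = 0) -> Series c = c k.
Proof.
  intros H. apply is_series_unique.
  assert (Hs : forall N, sum_f_R0 c N = if Compare_dec.le_dec k N then c k else 0).
  { induction N as [|N IH]; simpl.
    - destruct (Compare_dec.le_dec k 0) as [Hk|Hk]; [f_equal; lia|apply H; lia].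
    - rewrite IH. destruct (Compare_dec.le_dec k N), (Compare_dec.le_dec k (S N)); try lia.
      + rewrite (H (S N)) by lia. ring.
      + replace (S N) with k by lia. ring.
      + rewrite (H (S N)) by lia. ring. }
  apply (is_lim_seq_ext_loc (fun _ => c k) _ (c k)); [|apply is_lim_seq_const].
  exists k. intros N HN. rewrite sum_n_Reals, Hs. destruct (Compare_dec.le_dec k N); [auto|lia].
Qed.

Lemma multiplicity_pos (n : nat) : 0 < multiplicity n.
Proof. destruct n; simpl; lra. Qed.

Lemma Re_mul_mode (c : C) (n : nat) (x : R) :
  Re (Cmult c (mode n (RtoC x))) =
  Re c * cos (INR n * x + 0) + Im c * cos (INR n * x + PI / 2).
Proof.
  unfold mode, Re, Im; simpl. rewrite Rmult_0_r, Ropp_0, exp_0, Rplus_0_r, cos_plus, cos_PI2,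
    sin_PI2.
  ring.
Qed.

Lemma Im_mul_mode (c : C) (n : nat) (x : R) :
  Im (Cmult c (mode n (RtoC x))) = Re c * sin (INR n * x) + Im c * cos (INR n * x).
Proof. unfold mode, Re, Im; simpl. rewrite Rmult_0_r, Ropp_0, exp_0. ring. Qed.

Lemma continuous_Re_mul_mode (c : C) (n : nat) (x : R) :
  continuous (fun y => Re (Cmult c (mode n (RtoC y)))) x.
Proof.
  apply (continuous_ext (fun y => Re c * cos (INR n * y + 0) + Im c * cos (INR n * y + PI / 2))).
  - intros y. symmetry; apply Re_mul_mode.
  - apply continuous_Rplus; apply continuous_Rmult; try apply continuous_const;
      apply continuous_cos_lin.
Qed.

Lemma continuous_Re_mode_sum (c : nat -> C) (x : R) : summable c ->
  continuous (fun y => Re (mode_sum c (RtoC y))) x.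
Proof.
  intros Hc.
  apply (continuous_Series (fun n y => Re (Cmult (c n) (mode n (RtoC y)))) (fun n => Cmod (c n)));
    auto using continuous_Re_mul_mode.
  intros n y. eapply Rle_trans; [apply Rabs_Re_le|apply Cmod_mul_mode_le]. simpl; lra.
Qed.

Lemma mode_sum_periodic (c : nat -> C) (x : R) : mode_sum c (RtoC (x + 2 * PI)) = mode_sum c
  (RtoC x).
Proof.
  apply Csum_ext. intros n. f_equal. unfold mode, Re, Im; simpl.
  replace (INR n * (x + 2 * PI)) with (INR n * x + 2 * INR n * PI) by ring.
  rewrite cos_period, sin_period. reflexivity.
Qed.

Lemma RInt_mul_mode_cos (c : C) (n k : nat) (p : R) :
  RInt (fun x => Re (Cmult c (mode n (RtoC x))) * cos (INR k * x + p)) (- PI) PI =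
  if Nat.eq_dec n k then
    match k with O => 2 * PI * (Re c * cos p) | S _ => PI * (Re c * cos p + Im c * sin p) end
  else 0.
Proof. eq_R.
  rewrite (RInt_Rext _ (fun x =>
    Re c * (cos (IZR (Z.of_nat n) * x + 0) * cos (IZR (Z.of_nat k) * x + p)) +
    Im c * (cos (IZR (Z.of_nat n) * x + PI / 2) * cos (IZR (Z.of_nat k) * x + p)))).
  2: { intros x _. rewrite Re_mul_mode, <- !INR_IZR_INZ. ring. }
  assert (Hex : forall q, ex_RInt (fun x =>
    cos (IZR (Z.of_nat n) * x + q) * cos (IZR (Z.of_nat k) * x + p)) (- PI) PI).
  { intros q. apply ex_RInt_cont. intros x.
    apply continuous_Rmult; apply continuous_cos_lin. }
  rewrite RInt_Rplus; [|apply ex_RInt_Rscal, Hex|apply ex_RInt_Rscal, Hex].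
  rewrite (RInt_Rscal _ _ _ _ (Hex 0)), (RInt_Rscal _ _ _ _ (Hex (PI / 2))), !RInt_cos_cos_phase.
  replace (0 - p) with (- p) by ring. rewrite Rplus_0_l, cos_neg.
  rewrite cos_minus, cos_plus, cos_PI2, sin_PI2.
  destruct (Nat.eq_dec n k) as [->|Hnk].
  - rewrite Z.sub_diag. destruct (Z.eq_dec 0 0) as [_|]; [|lia].
    destruct k as [|k].
    + simpl Z.add. destruct (Z.eq_dec 0 0) as [_|]; [|lia]. field.
    + destruct (Z.eq_dec (Z.of_nat (S k) + Z.of_nat (S k)) 0); [lia|]. field.
  - destruct (Z.eq_dec (Z.of_nat n - Z.of_nat k) 0); [lia|].
    destruct (Z.eq_dec (Z.of_nat n + Z.of_nat k) 0); [lia|]. field.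
Qed.

Lemma RInt_Re_mode_sum_cos (c : nat -> C) (k : nat) (p : R) : summable c ->
  RInt (fun x => Re (mode_sum c (RtoC x)) * cos (INR k * x + p)) (- PI) PI =
  match k with O => 2 * PI * (Re (c k) * cos p)
             | S _ => PI * (Re (c k) * cos p + Im (c k) * sin p) end.
Proof.
  intros Hc. eq_R.
  assert (HPI := PI_RGT_0).
  rewrite (RInt_Rext _ (fun x => Series (fun n =>
     Re (Cmult (c n) (mode n (RtoC x))) * cos (INR k * x + p)))).
  2: { intros x _. rewrite Series_scal_r. reflexivity. }
  assert (Hb : forall n x, Rabs (Re (Cmult (c n) (mode n (RtoC x))) * cos (INR k * x + p))
                           <= Cmod (c n)).
  { intros n x. rewrite Rabs_mult.
    assert (H1 : Rabs (Re (Cmult (c n) (mode n (RtoC x)))) <= Cmod (c n)).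
    { eapply Rle_trans; [apply Rabs_Re_le|apply Cmod_mul_mode_le]. simpl; lra. }
    assert (H2 : Rabs (cos (INR k * x + p)) <= 1) by (apply Rabs_le, COS_bound).
    assert (H3 := Rabs_pos (Re (Cmult (c n) (mode n (RtoC x))))).
    assert (H4 := Rabs_pos (cos (INR k * x + p))). nra. }
  assert (Hcont : forall n x,
     continuous (fun x => Re (Cmult (c n) (mode n (RtoC x))) * cos (INR k * x + p)) x).
  { intros. apply continuous_Rmult; [apply continuous_Re_mul_mode|apply continuous_cos_lin]. }
  rewrite (RInt_Series (fun n x => Re (Cmult (c n) (mode n (RtoC x))) * cos (INR k * x + p))
             (fun n => Cmod (c n))); auto; try lra.
  - rewrite (Series_single _ k).
    + rewrite RInt_mul_mode_cos. destruct (Nat.eq_dec k k); [reflexivity|lia].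
    + intros n Hn. rewrite RInt_mul_mode_cos. destruct (Nat.eq_dec n k); [lia|reflexivity].
  - apply ex_RInt_cont. intros x.
    apply (continuous_Series (fun n x => Re (Cmult (c n) (mode n (RtoC x))) * cos (INR k * x + p))
             (fun n => Cmod (c n))); auto.
Qed.

Lemma analytic_coef_Re_mode_sum (c : nat -> C) (k : nat) : summable c -> Im (c 0%nat) = 0 ->
  analytic_coef (fun x => Re (mode_sum c (RtoC x))) k = c k.
Proof.
  intros Hc H0. assert (HPI := PI_RGT_0). apply C_ext.
  - rewrite analytic_coef_Re, RInt_Re_mode_sum_cos by auto.
    rewrite cos_0, sin_0. destruct k; simpl; field; lra.
  - rewrite analytic_coef_Im, RInt_Re_mode_sum_cos by auto using continuous_Re_mode_sum.
    rewrite cos_PI2, sin_PI2. destruct k; simpl multiplicity.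
    + rewrite H0. field; lra.
    + field; lra.
Qed.

Lemma RInt_RChasles (f : R -> R) (a b c : R) : (forall x, continuous f x) ->
  RInt f a c = RInt f a b + RInt f b c.
Proof.
  intros Hf. symmetry.
  apply (RInt_Chasles (V := R_CompleteNormedModule)); apply ex_RInt_cont; auto.
Qed.

Lemma RInt_period (f : R -> R) (x : R) : (forall y, continuous f y) -> periodic f ->
  RInt f (x - PI) (x + PI) = RInt f (- PI) PI.
Proof.
  intros Hf Hp. eq_R.
  rewrite (RInt_RChasles f (x - PI) (- PI) (x + PI)), (RInt_RChasles f (- PI) PI (x + PI)) by
    auto.
  assert (Hs : RInt f PI (x + PI) = - RInt f (x - PI) (- PI)).
  { rewrite <- (opp_RInt_swap f (- PI) (x - PI)).
    2: { apply ex_RInt_cont; auto. }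
    change (RInt f PI (x + PI) = - - RInt f (- PI) (x - PI)). eq_R. rewrite Ropp_involutive.
    assert (Hl := RInt_comp_lin (V := R_CompleteNormedModule) f 1 (2 * PI) (- PI) (x - PI)).
    replace (1 * - PI + 2 * PI) with PI in Hl by ring.
    replace (1 * (x - PI) + 2 * PI) with (x + PI) in Hl by ring.
    rewrite <- Hl by (apply ex_RInt_cont; auto).
    apply RInt_Rext. intros y _.
    change (1 * f (1 * y + 2 * PI) = f y). rewrite !Rmult_1_l. apply Hp. }
  eq_R. rewrite Hs. ring.
Qed.

(** * Uniqueness of Fourier coefficients *)

(** Multiplication by cos (y - x0) moves the frequency by one and the phase by
    [x0] in opposite directions; an arbitrary phase makes the induction close. *)
Lemma RInt_kernel_power_zero (g : R -> R) (x0 A : R) :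
  (forall y, continuous g y) ->
  (forall (m : Z) p, RInt (fun y => g y * cos (IZR m * y + p)) (x0 - PI) (x0 + PI) = 0) ->
  forall (N : nat) (m : Z) p,
    RInt (fun y => g y * (A + cos (y - x0)) ^ N * cos (IZR m * y + p)) (x0 - PI) (x0 + PI) = 0.
Proof.
  intros Hg H0 N.
  assert (HT : forall N y, continuous (fun y => (A + cos (y - x0)) ^ N) y).
  { intros N' y. eapply continuous_of_derive. auto_derive; [exact I|reflexivity]. }
  assert (Hc : forall N m p y,
    continuous (fun y => g y * (A + cos (y - x0)) ^ N * cos (IZR m * y + p)) y).
  { intros. apply continuous_Rmult; [apply continuous_Rmult; auto|apply continuous_cos_lin]. }
  induction N as [|N IH]; intros m p.
  - rewrite <- (H0 m p). apply RInt_Rext. intros y _. simpl. ring.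
  - rewrite (RInt_Rext _ (fun y =>
      A * (g y * (A + cos (y - x0)) ^ N * cos (IZR m * y + p)) +
      (/ 2 * (g y * (A + cos (y - x0)) ^ N * cos (IZR (m + 1) * y + (p - x0))) +
       / 2 * (g y * (A + cos (y - x0)) ^ N * cos (IZR (m - 1) * y + (p + x0)))))).
    + assert (Hk : forall k m p y,
        continuous (fun y => k * (g y * (A + cos (y - x0)) ^ N * cos (IZR m * y + p))) y).
      { intros. apply continuous_Rmult; [apply continuous_const|apply Hc]. }
      rewrite RInt_Rplus, RInt_Rplus, !RInt_Rscal, !IH;
        try (apply ex_RInt_cont; intros; auto using continuous_Rplus).
      eq_R. ring.
    + intros y _. rewrite plus_IZR, minus_IZR.
      replace ((IZR m + 1) * y + (p - x0)) with ((IZR m * y + p) + (y - x0)) by ring.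
      replace ((IZR m - 1) * y + (p + x0)) with ((IZR m * y + p) - (y - x0)) by ring.
      set (a := IZR m * y + p). set (b := y - x0). rewrite cos_plus, cos_minus.
      simpl. field.
Qed.

Lemma cos_le_Rabs (w v : R) : Rabs w <= v -> v <= PI -> cos v <= cos w.
Proof.
  intros H1 H2. assert (H0 := Rabs_pos w).
  replace (cos w) with (cos (Rabs w)).
  - apply cos_decr_1; lra.
  - unfold Rabs. destruct (Rcase_abs w); [apply cos_neg|reflexivity].
Qed.

Lemma cos_ge_Rabs (w v : R) : 0 <= v <= Rabs w -> Rabs w <= PI -> cos w <= cos v.
Proof.
  intros H1 H2.
  replace (cos w) with (cos (Rabs w)).
  - apply cos_decr_1; lra.
  - unfold Rabs. destruct (Rcase_abs w); [apply cos_neg|reflexivity].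
Qed.

(** If [g x0 > 0], the powers of the trigonometric polynomial
    1 + cos (y - x0) - cos d, which exceeds 1 only within distance [d] of [x0],
    concentrate at [x0] and cannot all be orthogonal to [g]. *)
Lemma Fourier_orthogonal_nonpos (g : R -> R) (x0 : R) :
  (forall y, continuous g y) ->
  (forall (m : Z) p, RInt (fun y => g y * cos (IZR m * y + p)) (x0 - PI) (x0 + PI) = 0) ->
  g x0 <= 0.
Proof.
  intros Hg H0. apply Rnot_lt_le. intros Hpos.
  assert (HPI := PI_RGT_0).
  assert (He : 0 < g x0 / 2) by lra.
  destruct (proj1 (filterlim_locally _ _) (Hg x0) (mkposreal _ He)) as [d0 Hd0].
  set (d := Rmin (d0 / 2) (PI / 2)).
  assert (Hd : 0 < d) by (apply Rmin_pos; [apply Rdiv_lt_0_compat; [apply cond_pos|lra]|lra]).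
  assert (Hdd0 : d <= d0 / 2) by apply Rmin_l.
  assert (HdPI : d <= PI / 2) by apply Rmin_r.
  assert (Hnear : forall y, Rabs (y - x0) <= d -> g x0 / 2 <= g y).
  { intros y Hy. assert (Hp := cond_pos d0).
    assert (Hb : Rabs (g y - g x0) < g x0 / 2).
    { apply (Hd0 y). change (Rabs (y - x0) < d0). lra. }
    apply Rabs_def2 in Hb. lra. }
  assert (Hcomp : exists B, 0 <= B /\ forall y, x0 - PI <= y <= x0 + PI -> Rabs (g y) <= B).
  { destruct (continuity_ab_maj (fun y => Rabs (g y)) (x0 - PI) (x0 + PI)) as [z [Hz _]].
    - lra.
    - intros c _. apply continuity_pt_filterlim.
      apply (continuous_comp g Rabs); [apply Hg|apply continuous_Rabs].
    - exists (Rabs (g z)). split; [apply Rabs_pos|exact Hz]. }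
  destruct Hcomp as [B [HB0 HB]].
  set (T := fun y => (1 - cos d) + cos (y - x0)).
  set (eta := cos (d / 2) - cos d).
  assert (Heta : 0 < eta).
  { assert (cos d < cos (d / 2)) by (apply cos_decreasing_1; lra). unfold eta; lra. }
  assert (Hcd : 0 <= cos d) by (apply cos_ge_0; lra).
  (* the mass near x0 grows like (1 + eta)^N, the rest stays bounded *)
  assert (Hkey : forall N, d * (g x0 / 2 * (1 + eta) ^ N) <= 2 * PI * B).
  { intros N.
    assert (HTc : forall y, continuous (fun y => g y * T y ^ N) y).
    { intros y. apply continuous_Rmult; auto.
      eapply continuous_of_derive. unfold T. auto_derive; [exact I|reflexivity]. }
    assert (Hz : RInt (fun y => g y * T y ^ N) (x0 - PI) (x0 + PI) = 0).
    { rewrite <- (RInt_kernel_power_zero g x0 (1 - cos d) Hg H0 N 0 0).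
      apply RInt_Rext. intros y _. rewrite Rmult_0_l, Rplus_0_l, cos_0. unfold T. ring. }
    assert (Hlow : forall y, Rabs (y - x0) <= PI -> - B <= g y * T y ^ N).
    { intros y Hy.
      assert (HBy : Rabs (g y) <= B) by (apply HB; apply Rabs_le_between in Hy; lra).
      destruct (Rle_lt_dec (Rabs (y - x0)) d) as [Hin|Hout].
      - assert (HT1 : 1 <= T y) by (assert (Q := cos_le_Rabs _ _ Hin ltac:(lra)); unfold T; lra).
        assert (HTN : 0 <= T y ^ N) by (apply pow_le; lra).
        assert (Hgy := Hnear y Hin). assert (0 <= g y * T y ^ N) by (apply Rmult_le_pos; lra).
        lra.
      - assert (HT1 : Rabs (T y) <= 1).
        { assert (Q := cos_ge_Rabs (y - x0) d ltac:(lra) Hy).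
          assert (Q2 := COS_bound (y - x0)). assert (Q3 := COS_bound d).
          unfold T. apply Rabs_le. lra. }
        assert (HTN : Rabs (T y ^ N) <= 1).
        { rewrite <- RPow_abs. rewrite <- (pow1 N). apply pow_incr.
          split; [apply Rabs_pos|exact HT1]. }
        assert (Hm : Rabs (g y * T y ^ N) <= B).
        { rewrite Rabs_mult. assert (P1 := Rabs_pos (g y)). assert (P2 := Rabs_pos (T y ^ N)).
          nra. }
        apply Rabs_le_between in Hm. lra. }
    assert (Hmid : forall y, Rabs (y - x0) <= d / 2 ->
              g x0 / 2 * (1 + eta) ^ N <= g y * T y ^ N).
    { intros y Hy. apply Rmult_le_compat.
      - lra.
      - apply pow_le; lra.
      - apply Hnear; lra.
      - apply pow_incr. split; [lra|].
        assert (Q := cos_le_Rabs _ _ Hy ltac:(lra)). unfold T, eta. lra. }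
    rewrite (RInt_RChasles _ _ (x0 - d / 2) _ HTc) in Hz.
    rewrite (RInt_RChasles _ (x0 - d / 2) (x0 + d / 2) _ HTc) in Hz.
    assert (Hconst : forall a b k, a <= b -> (forall y, a <= y <= b -> k <= g y * T y ^ N) ->
      (b - a) * k <= RInt (fun y => g y * T y ^ N) a b).
    { intros a b k Hab Hk. rewrite <- RInt_Rconst. apply RInt_le; auto.
      - apply ex_RInt_cont. intros; apply continuous_const.
      - apply ex_RInt_cont; auto.
      - intros y Hy. apply Hk; lra. }
    assert (I1 := Hconst (x0 - PI) (x0 - d / 2) (- B) ltac:(lra)
      ltac:(intros; apply Hlow; apply Rabs_le; lra)).
    assert (I2 := Hconst (x0 - d / 2) (x0 + d / 2) _ ltac:(lra)
      ltac:(intros; apply Hmid; apply Rabs_le; lra)).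
    assert (I3 := Hconst (x0 + d / 2) (x0 + PI) (- B) ltac:(lra)
      ltac:(intros; apply Hlow; apply Rabs_le; lra)).
    assert (HdB : 0 <= d * B) by (apply Rmult_le_pos; lra).
    set (i1 := RInt _ _ (x0 - d / 2)) in *. set (i2 := RInt _ _ (x0 + d / 2)) in *.
    set (i3 := RInt _ _ (x0 + PI)) in *. set (P := g x0 / 2 * (1 + eta) ^ N) in *.
    clearbody i1 i2 i3 P. change R in (type of i1). nra. }
  destruct (INR_unbounded (2 * PI * B / (d * (g x0 / 2) * eta))) as [N HN].
  assert (Hp : 0 < d * (g x0 / 2)) by (apply Rmult_lt_0_compat; lra).
  assert (HNk := Hkey N).
  assert (Hpoly := poly N eta Heta).
  assert (Hq : 0 < d * (g x0 / 2) * eta) by (apply Rmult_lt_0_compat; lra).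
  apply (Rmult_lt_compat_r _ _ _ Hq) in HN.
  unfold Rdiv in HN at 1. rewrite Rmult_assoc, Rinv_l, Rmult_1_r in HN by lra.
  assert (Hm := Rmult_le_compat_l _ _ _ (Rlt_le _ _ Hp) Hpoly). lra.
Qed.

Lemma Fourier_uniqueness (g : R -> R) (x0 : R) :
  periodic g -> (forall y, continuous g y) -> (forall n, analytic_coef g n = 0) -> g x0 = 0.
Proof.
  intros Hp Hg H0. assert (HPI := PI_RGT_0).
  assert (Hnat : forall n p, RInt (fun y => g y * cos (INR n * y + p)) (- PI) PI = 0).
  { intros n p.
    assert (Hm := multiplicity_pos n).
    assert (Hk : multiplicity n / (2 * PI) <> 0).
    { apply Rgt_not_eq, Rdiv_lt_0_compat; lra. }
    assert (H1 : RInt (fun x => g x * cos (INR n * x + 0)) (- PI) PI = 0).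
    { assert (Hr := analytic_coef_Re g n). rewrite H0 in Hr. symmetry in Hr.
      apply Rmult_integral in Hr. destruct Hr; [contradiction|auto]. }
    assert (H2 : RInt (fun x => g x * cos (INR n * x + PI / 2)) (- PI) PI = 0).
    { assert (Hr := analytic_coef_Im g n Hg). rewrite H0 in Hr. symmetry in Hr.
      apply Rmult_integral in Hr. destruct Hr; [contradiction|auto]. }
    rewrite (RInt_Rext _ (fun y => cos p * (g y * cos (INR n * y + 0)) +
                            sin p * (g y * cos (INR n * y + PI / 2)))).
    - assert (Hc : forall q, ex_RInt (fun y => g y * cos (INR n * y + q)) (- PI) PI).
      { intros q. apply ex_RInt_cont. intros y.
        apply continuous_Rmult; [apply Hg|apply continuous_cos_lin]. }
      rewrite RInt_Rplus; [|apply ex_RInt_Rscal, Hc|apply ex_RInt_Rscal, Hc].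
      rewrite (RInt_Rscal _ _ _ _ (Hc 0)), (RInt_Rscal _ _ _ _ (Hc (PI / 2))), H1, H2.
      eq_R; ring.
    - intros y _. rewrite Rplus_0_r, !cos_plus, cos_PI2, sin_PI2. ring. }
  assert (Hint : forall (m : Z) p,
            RInt (fun y => g y * cos (IZR m * y + p)) (x0 - PI) (x0 + PI) = 0).
  { intros m p.
    rewrite (RInt_period (fun y => g y * cos (IZR m * y + p))).
    - destruct (Z_le_gt_dec 0 m) as [Hm|Hm].
      + rewrite <- (Hnat (Z.to_nat m) p). apply RInt_Rext. intros y _.
        rewrite INR_IZR_INZ, Z2Nat.id by auto. reflexivity.
      + rewrite <- (Hnat (Z.to_nat (- m)) (- p)). apply RInt_Rext. intros y _.
        rewrite INR_IZR_INZ, Z2Nat.id, opp_IZR by lia.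
        rewrite <- (cos_neg (IZR m * y + p)). f_equal. f_equal. ring.
    - intros y. apply continuous_Rmult; auto using continuous_cos_lin.
    - intros y. cbv beta. rewrite (Hp y). f_equal.
      replace (IZR m * (y + 2 * PI) + p) with (IZR m * y + p + 2 * (IZR m * PI)) by ring.
      rewrite (cos_plus _ (2 * (IZR m * PI))), cos_2a_sin, sin_2a, sin_IZR_PI. ring. }
  apply Rle_antisym.
  - apply Fourier_orthogonal_nonpos; auto.
  - assert (Hn : - g x0 <= 0); [|lra].
    apply (Fourier_orthogonal_nonpos (fun y => - g y)).
    + intros y. apply (continuous_opp (V := R_NormedModule) g); auto.
    + intros m p. rewrite (RInt_Rext _ (fun y => (-1) * (g y * cos (IZR m * y + p)))).
      * rewrite RInt_Rscal, Hint; [eq_R; ring|].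
        apply ex_RInt_cont. intros; apply continuous_Rmult; auto using continuous_cos_lin.
      * intros y _. ring.
Qed.

(** The sum of the series has the same coefficients as [u], and it is continuous
    and periodic. *)
Lemma Fourier_series (u : R -> R) (x : R) :
  periodic u -> (forall y, continuous u y) -> summable (analytic_coef u) ->
  u x = Re (mode_sum (analytic_coef u) (RtoC x)).
Proof.
  intros Hp Hu Hs.
  set (v := fun y => Re (mode_sum (analytic_coef u) (RtoC y))).
  assert (Hv : forall y, continuous v y) by (intros; apply continuous_Re_mode_sum; auto).
  assert (H : u x - v x = 0).
  { apply (Fourier_uniqueness (fun y => u y - v y)).
    - intros y. unfold v. rewrite Hp, mode_sum_periodic. reflexivity.
    - intros; apply continuous_Rminus; auto.
    - intros n. rewrite analytic_coef_minus by auto.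
      unfold v. rewrite analytic_coef_Re_mode_sum; auto using analytic_coef_0_Im. ring. }
  fold (v x). lra.
Qed.

(** * The periodic Hilbert transform of a Fourier series *)

(** [conj_kernel n w] extends sin (n w) cot (w / 2) continuously to w = 0. *)
Fixpoint conj_kernel (n : nat) (w : R) : R :=
  match n with
  | O => 0
  | S m => conj_kernel m w + (cos (INR (S m) * w) + cos (INR m * w))
  end.

Lemma conj_kernel_S (n : nat) (w : R) :
  conj_kernel (S n) w = conj_kernel n w + (cos ((INR n + 1) * w) + cos (INR n * w)).
Proof. rewrite <- S_INR. reflexivity. Qed.

Lemma conj_kernel_spec (n : nat) (w : R) :
  conj_kernel n w * sin (w / 2) = sin (INR n * w) * cos (w / 2).
Proof.
  induction n as [|n IH].
  - simpl. rewrite !Rmult_0_l, sin_0. ring.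
  - rewrite conj_kernel_S, Rmult_plus_distr_r, IH, S_INR.
    replace ((INR n + 1) * w) with (INR n * w + 2 * (w / 2)) by field.
    set (a := INR n * w). set (b := w / 2).
    rewrite cos_plus, sin_plus, sin_2a.
    assert (H1 : cos (2 * b) = 2 * cos b * cos b - 1) by (rewrite cos_2a_cos; ring).
    rewrite H1. assert (H := sin2_cos2 b). unfold Rsqr in H.
    apply Rminus_diag_uniq.
    transitivity (2 * sin a * cos b * (1 - (sin b * sin b + cos b * cos b)));
      [ring|rewrite H; ring].
Qed.

Lemma continuous_conj_kernel (n : nat) (w : R) : continuous (conj_kernel n) w.
Proof.
  induction n as [|n IH].
  - apply continuous_const.
  - apply (continuous_Rplus (conj_kernel n)
             (fun w => cos (INR (S n) * w) + cos (INR n * w))); auto.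
    eapply continuous_of_derive. auto_derive; [exact I|reflexivity].
Qed.

Lemma conj_kernel_bound (n : nat) (w : R) : Rabs (conj_kernel n w) <= 2 * INR n.
Proof.
  induction n as [|n IH].
  - simpl. rewrite Rabs_R0; lra.
  - rewrite S_INR, conj_kernel_S.
    assert (H1 := COS_bound ((INR n + 1) * w)). assert (H2 := COS_bound (INR n * w)).
    apply Rabs_le_between in IH. apply Rabs_le. lra.
Qed.

Lemma RInt_cos_half (k : nat) :
  RInt (fun w => cos (INR k * w)) 0 PI = match k with O => PI | S _ => 0 end.
Proof.
  eq_R. destruct k as [|k].
  - rewrite (RInt_Rext _ (fun _ => 1)).
    + rewrite RInt_Rconst. eq_R. ring.
    + intros x _. simpl. rewrite Rmult_0_l. apply cos_0.
  - assert (Hk : INR (S k) <> 0) by (apply not_0_INR; lia).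
    set (m := INR (S k)) in *.
    rewrite (RInt_antiderivative _ (fun w => sin (m * w) / m)).
    + unfold m at 1. rewrite INR_IZR_INZ, sin_IZR_PI, Rmult_0_r, sin_0. eq_R. field; auto.
    + intros w. auto_derive; [auto|field; auto].
    + intros w. eapply continuous_of_derive. auto_derive; [exact I|reflexivity].
Qed.

Lemma RInt_conj_kernel (n : nat) :
  RInt (conj_kernel n) 0 PI = match n with O => 0 | S _ => PI end.
Proof.
  eq_R. induction n as [|n IH].
  - rewrite (RInt_Rext _ (fun _ => 0)) by reflexivity. rewrite RInt_Rconst. eq_R. ring.
  - assert (Hc : forall k x, continuous (fun w => cos (INR k * w)) x).
    { intros. eapply continuous_of_derive. auto_derive; [exact I|reflexivity]. }
    rewrite (RInt_Rext _ (fun w => conj_kernel n w + (cos (INR (S n) * w) + cos (INR n * w))))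
      by reflexivity.
    rewrite RInt_Rplus, RInt_Rplus, IH, !RInt_cos_half;
      try (apply ex_RInt_cont; intros; auto using continuous_conj_kernel, continuous_Rplus).
    eq_R. destruct n; ring.
Qed.

(** The oddness of the kernel turns the truncated integral into an integral of
    the difference of the values at [x - w] and [x + w], which cancels the
    singularity. *)
Lemma hilbert_trunc_Re_mode_sum (c : nat -> C) (x e : R) : wsummable c -> 0 < e < PI ->
  hilbert_trunc (fun y => Re (mode_sum c (RtoC y))) x e =
  RInt (fun w => Series (fun n => Im (Cmult (c n) (mode n (RtoC x))) * conj_kernel n w)) e PI.
Proof.
  intros Hc He. assert (HPI := PI_RGT_0).
  set (v := fun y => Re (mode_sum c (RtoC y))).
  assert (Hs := wsummable_summable c Hc).
  assert (Hv : forall y, continuous v y) by (intros; apply continuous_Re_mode_sum; auto).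
  assert (Hsin : forall w, e <= w <= PI -> 0 < sin (w / 2)).
  { intros w Hw. apply sin_gt_0; lra. }
  set (kap := fun w => cos (w / 2) / (2 * sin (w / 2))).
  assert (Hkap : forall w, e < w < PI -> / (2 * tan (w / 2)) = kap w).
  { intros w Hw. assert (S0 := Hsin w ltac:(lra)).
    assert (C0 : 0 < cos (w / 2)) by (apply cos_gt_0; lra).
    unfold kap, tan. field. lra. }
  assert (Hck : forall w, e <= w <= PI -> continuous kap w).
  { intros w Hw. assert (S0 := Hsin w Hw). eapply continuous_of_derive.
    unfold kap. auto_derive; [lra|reflexivity]. }
  assert (Hex : forall s, ex_RInt (fun w => v (x + s * w) * kap w) e PI).
  { intros s. apply (ex_RInt_continuous (V := R_CompleteNormedModule)).
    intros w Hw. rewrite Rmin_left, Rmax_right in Hw by lra.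
    apply continuous_Rmult; auto.
    apply (continuous_comp (fun w => x + s * w) v); auto.
    eapply continuous_of_derive. auto_derive; [exact I|reflexivity]. }
  assert (I1 : RInt (fun y => v y / (2 * tan ((x - y) / 2))) (x - PI) (x - e)
               = RInt (fun w => v (x + -1 * w) * kap w) e PI).
  { assert (Hi := ex_RInt_swap _ _ _ (Hex (-1))).
    replace e with (-1 * (x - e) + x) in Hi by ring.
    replace PI with (-1 * (x - PI) + x) in Hi by ring.
    assert (Hl := RInt_comp_lin (V := R_CompleteNormedModule) _ _ _ _ _ Hi).
    replace (-1 * (x - e) + x) with e in Hl by ring.
    replace (-1 * (x - PI) + x) with PI in Hl by ring.
    rewrite <- (opp_RInt_swap _ _ _ (ex_RInt_swap _ _ _ (Hex (-1)))), <- Hl.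
    transitivity (RInt (fun y => - (-1 * (v (x + -1 * (-1 * y + x)) * kap (-1 * y + x))))
                    (x - PI) (x - e)).
    2: { apply (RInt_opp (V := R_CompleteNormedModule)).
         apply (ex_RInt_comp_lin (V := R_NormedModule) (fun w => v (x + -1 * w) * kap w)).
         exact Hi. }
    apply RInt_Rext. intros y Hy. rewrite Rmin_left, Rmax_right in Hy by lra.
    rewrite <- Hkap by lra.
    replace (x + -1 * (-1 * y + x)) with y by ring.
    replace (-1 * y + x) with (x - y) by ring.
    unfold Rdiv. ring. }
  assert (I2 : RInt (fun y => v y / (2 * tan ((x - y) / 2))) (x + e) (x + PI)
               = - RInt (fun w => v (x + 1 * w) * kap w) e PI).
  { assert (Hi := Hex 1).
    replace e with (1 * (x + e) + - x) in Hi by ring.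
    replace PI with (1 * (x + PI) + - x) in Hi by ring.
    assert (Hl := RInt_comp_lin (V := R_CompleteNormedModule) _ _ _ _ _ Hi).
    replace (1 * (x + e) + - x) with e in Hl by ring.
    replace (1 * (x + PI) + - x) with PI in Hl by ring.
    rewrite <- Hl.
    transitivity (RInt (fun y => - (1 * (v (x + 1 * (1 * y + - x)) * kap (1 * y + - x))))
                    (x + e) (x + PI)).
    2: { apply (RInt_opp (V := R_CompleteNormedModule)).
         apply (ex_RInt_comp_lin (V := R_NormedModule) (fun w => v (x + 1 * w) * kap w)).
         exact Hi. }
    apply RInt_Rext. intros y Hy. rewrite Rmin_left, Rmax_right in Hy by lra.
    rewrite <- Hkap by lra.
    replace (x + 1 * (1 * y + - x)) with y by ring.
    replace ((x - y) / 2) with (- ((1 * y + - x) / 2)) by field.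
    rewrite tan_neg, Ropp_mult_distr_r_reverse.
    unfold Rdiv. rewrite Rinv_opp. ring. }
  unfold hilbert_trunc. fold (v). rewrite I1, I2.
  change (RInt (fun w => v (x + -1 * w) * kap w) e PI -
          RInt (fun w => v (x + 1 * w) * kap w) e PI =
    RInt (fun w => Series (fun n => Im (Cmult (c n) (mode n (RtoC x))) * conj_kernel n w)) e PI).
  rewrite <- RInt_Rminus by apply Hex.
  apply RInt_Rext. intros w Hw. rewrite Rmin_left, Rmax_right in Hw by lra.
  assert (HvS : forall y, v y = Series (fun n => Re (Cmult (c n) (mode n (RtoC y)))))
    by reflexivity.
  rewrite !HvS.
  assert (Hsum : forall y, ex_series (fun n => Re (Cmult (c n) (mode n (RtoC y))))).
  { intros y. apply summable_Re, summable_mul_mode; auto. simpl; lra. }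
  rewrite <- Rmult_minus_distr_r, <- Series_minus by apply Hsum.
  rewrite <- Series_scal_r. apply Series_ext. intros n.
  assert (S0 := Hsin w ltac:(lra)).
  assert (Hk : conj_kernel n w = sin (INR n * w) * cos (w / 2) / sin (w / 2)).
  { rewrite <- conj_kernel_spec. field. lra. }
  rewrite Hk, !Re_mul_mode, Im_mul_mode. unfold kap.
  replace (INR n * (x + -1 * w)) with (INR n * x - INR n * w) by ring.
  replace (INR n * (x + 1 * w)) with (INR n * x + INR n * w) by ring.
  rewrite !Rplus_0_r, !(cos_plus _ (PI / 2)), cos_PI2, sin_PI2.
  rewrite cos_plus, cos_minus, sin_plus, sin_minus. field. lra.
Qed.

(** All conjugate kernels of order n >= 1 have the same integral PI over
    (0, PI), so the transform multiplies every mode of positive order by - i. *)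
Lemma Hilbert_Re_mode_sum (c : nat -> C) (x : R) : wsummable c -> Im (c 0%nat) = 0 ->
  Hilbert (fun y => Re (mode_sum c (RtoC y))) x = Im (mode_sum c (RtoC x)).
Proof.
  intros Hc H0. assert (HPI := PI_RGT_0).
  set (phi := fun n w => Im (Cmult (c n) (mode n (RtoC x))) * conj_kernel n w).
  assert (Hphib : forall n w, Rabs (phi n w) <= 2 * weighted c n).
  { intros n w. unfold phi. rewrite Rabs_mult.
    assert (H1 : Rabs (Im (Cmult (c n) (mode n (RtoC x)))) <= Cmod (c n)).
    { eapply Rle_trans; [apply Rabs_Im_le|apply Cmod_mul_mode_le]. simpl; lra. }
    assert (H2 := conj_kernel_bound n w). unfold weighted.
    assert (P1 := Rabs_pos (Im (Cmult (c n) (mode n (RtoC x))))).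
    assert (P2 := Rabs_pos (conj_kernel n w)). assert (P3 := Cmod_ge_0 (c n)).
    assert (P4 := Rmult_le_compat _ _ _ _ P1 P2 H1 H2). nra. }
  assert (HB : ex_series (fun n => 2 * weighted c n)) by (apply ex_series_Rscal; exact Hc).
  assert (Hphic : forall n w, continuous (phi n) w).
  { intros n w. apply (continuous_Rmult (fun _ => Im (Cmult (c n) (mode n (RtoC x))))).
    - apply continuous_const.
    - apply continuous_conj_kernel. }
  set (Phi := fun w => Series (fun n => phi n w)).
  assert (HPhi : forall w, continuous Phi w).
  { intros w. apply (continuous_Series phi (fun n => 2 * weighted c n)); auto. }
  assert (Hval : RInt Phi 0 PI = PI * Im (mode_sum c (RtoC x))).
  { unfold Phi. rewrite (RInt_Series phi (fun n => 2 * weighted c n)); auto; try lra.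
    2: { apply ex_RInt_cont; exact HPhi. }
    change (Im (mode_sum c (RtoC x))) with (Series (fun n => Im (Cmult (c n) (mode n (RtoC x))))).
    rewrite <- Series_scal_l. apply Series_ext. intros n.
    unfold phi. rewrite RInt_Rscal by (apply ex_RInt_cont, continuous_conj_kernel).
    rewrite RInt_conj_kernel. destruct n as [|n]; [|apply Rmult_comm].
    rewrite Im_mul_mode, H0. simpl INR. rewrite Rmult_0_l, sin_0. eq_R. ring. }
  unfold Hilbert.
  rewrite (iota_filterlim_locally (V := R_CompleteNormedModule) (F := at_right 0) _
             (RInt Phi 0 PI)).
  - rewrite Hval. eq_R. field. lra.
  - assert (Hcont : continuous (fun e => RInt Phi e PI) 0).
    { apply (ex_derive_continuous (fun e => RInt Phi e PI)).
      exists (opp (Phi 0)). apply (is_derive_RInt' Phi _ 0 PI).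
      - apply filter_forall. intros e. apply (RInt_correct (V := R_CompleteNormedModule)),
        ex_RInt_cont; auto.
      - apply HPhi. }
    apply filterlim_ext_loc with (fun e => RInt Phi e PI).
    + exists (mkposreal PI HPI). intros e He Hepos.
      change (Rabs (e - 0) < PI) in He. rewrite Rminus_0_r in He. apply Rabs_def2 in He.
      symmetry. apply hilbert_trunc_Re_mode_sum; [auto|lra].
    + eapply filterlim_filter_le_1; [|exact Hcont].
      apply filter_le_within.
Qed.

(** * Sobolev control of the coefficients *)

Lemma Rpower_le_neg (a x y : R) : 0 < x <= y -> a <= 0 -> Rpower y a <= Rpower x a.
Proof.
  intros Hxy Ha. replace a with (- - a) by ring. rewrite !(Rpower_Ropp _ (- a)).
  apply Rinv_le_contravar; [apply exp_pos|].
  apply Rle_Rpower_l; lra.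
Qed.

(** The integral test, by telescoping: (n+2)^-p is at most a constant times
    (n+1)^(1-p) - (n+2)^(1-p). *)
Lemma ex_series_Rpower (p : R) : 1 < p -> ex_series (fun n => Rpower (INR n + 1) (- p)).
Proof.
  intros Hp. apply ex_series_incr_1.
  set (T := fun n : nat => Rpower (INR n + 1) (1 - p) / (p - 1)).
  assert (Hstep : forall n, Rpower (INR (S n) + 1) (- p) <= T n - T (S n)).
  { intros n. rewrite S_INR. set (x := INR n + 1).
    assert (Hx : 1 <= x) by (assert (H := pos_INR n); unfold x; lra).
    assert (Hder : forall y, 0 < y ->
      is_derive (fun y => Rpower y (1 - p)) y ((1 - p) * Rpower y (1 - p - 1))).
    { intros y Hy. apply is_derive_Reals, derivable_pt_lim_power, Hy. }
    destruct (MVT_gen (fun y => Rpower y (1 - p)) x (x + 1)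
                (fun y => (1 - p) * Rpower y (1 - p - 1))) as [c [Hc Heq]].
    - intros y Hy. rewrite Rmin_left in Hy by lra. apply Hder; lra.
    - intros y Hy. rewrite Rmin_left in Hy by lra. apply continuity_pt_filterlim.
      exact (continuous_of_derive _ y _ (Hder y ltac:(lra))).
    - rewrite Rmin_left, Rmax_right in Hc by lra.
      replace (x + 1 - x) with 1 in Heq by ring. rewrite Rmult_1_r in Heq.
      replace (1 - p - 1) with (- p) in Heq by ring.
      assert (Hle : Rpower (x + 1) (- p) <= Rpower c (- p)) by (apply Rpower_le_neg; lra).
      unfold T. rewrite S_INR. fold x.
      replace (Rpower x (1 - p) / (p - 1) - Rpower (x + 1) (1 - p) / (p - 1))
        with (- (Rpower (x + 1) (1 - p) - Rpower x (1 - p)) / (p - 1)) by (field; lra).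
      rewrite Heq. replace (- ((1 - p) * Rpower c (- p)) / (p - 1)) with (Rpower c (- p))
        by (field; lra).
      exact Hle. }
  assert (HT : forall n, 0 <= T n).
  { intros n. apply Rlt_le, Rdiv_lt_0_compat; [apply exp_pos|lra]. }
  assert (Hsum : forall N, sum_f_R0 (fun n => Rpower (INR (S n) + 1) (- p)) N <= T 0%nat - T (S
    N)).
  { induction N as [|N IH]; [apply Hstep|]. rewrite tech5.
    assert (H := Hstep (S N)). lra. }
  apply ex_finite_lim_seq_incr with (M := T 0%nat).
  - intros n. rewrite !sum_n_Reals, tech5. assert (H := exp_pos (- p * ln (INR (S (S n)) + 1))).
    unfold Rpower at 3. lra.
  - intros n. rewrite sum_n_Reals. assert (H1 := Hsum n). assert (H2 := HT (S n)). lra.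
Qed.

Lemma sobolev_weight_nonneg (s : R) (f : R -> R) (n : Z) : 0 <= sobolev_weight s f n.
Proof.
  unfold sobolev_weight. apply Rmult_le_pos; [left; apply exp_pos|apply pow2_ge_0].
Qed.

Lemma sobolev_pair_nonneg (s : R) (f : R -> R) (k : nat) : 0 <= sobolev_pair s f k.
Proof.
  unfold sobolev_pair.
  assert (H1 := sobolev_weight_nonneg s f (Z.of_nat k)).
  assert (H2 := sobolev_weight_nonneg s f (- Z.of_nat (S k))). lra.
Qed.

(** The weights (1 + n)^2 / (1 + n^2)^s are summable for s > 3/2, and the
    Cauchy-Schwarz inequality is used in the form 2 x y <= e x^2 + y^2 / e. *)
Lemma sobolev_controls_wnorm (s : R) : 3 / 2 < s ->
  exists K, 0 <= K /\ forall f, ex_series (sobolev_pair s f) ->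
    wsummable (analytic_coef f) /\
    forall e, 0 < e -> Hs_norm s f <= e -> wnorm (analytic_coef f) <= e * K.
Proof.
  intros Hs.
  set (q := fun n : nat => (1 + INR n) ^ 2 / Rpower (1 + INR n ^ 2) s).
  assert (Hq : ex_series q).
  { apply ex_series_dominated with
      (fun n => 2 * Rpower (/ 2) (1 - s) * Rpower (INR n + 1) (- (2 * s - 2))).
    - apply ex_series_Rscal, ex_series_Rpower. lra.
    - intros n. assert (Hn := pos_INR n).
      assert (Hb : 0 < 1 + INR n ^ 2) by nra.
      unfold q. rewrite Rabs_pos_eq.
      2: { apply Rdiv_le_0_compat; [apply pow2_ge_0|apply exp_pos]. }
      apply Rle_trans with (2 * Rpower (1 + INR n ^ 2) (1 - s)).
      + unfold Rminus. rewrite Rpower_plus, Rpower_1, Rpower_Ropp by lra.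
        unfold Rdiv. rewrite <- Rmult_assoc. apply Rmult_le_compat_r.
        * left. apply Rinv_0_lt_compat, exp_pos.
        * assert (H := pow2_ge_0 (1 - INR n)). nra.
      + rewrite Rmult_assoc. apply Rmult_le_compat_l; [lra|].
        apply Rle_trans with (Rpower (/ 2 * (INR n + 1) ^ 2) (1 - s)).
        * apply Rpower_le_neg; [|lra].
          assert (H := pow2_ge_0 (1 - INR n)). nra.
        * rewrite <- Rpower_mult_distr by nra. apply Rmult_le_compat_l; [left; apply exp_pos|].
          right. rewrite <- (Rpower_pow 2) by lra. rewrite Rpower_mult.
          f_equal. simpl. ring. }
  assert (Pq : forall n, 0 <= q n).
  { intros n. apply Rdiv_le_0_compat; [apply pow2_ge_0|apply exp_pos]. }
  exists (Series q + 1). split; [assert (H := Series_nonneg q Hq Pq); lra|].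
  intros f Hf.
  assert (Hterm : forall e n, 0 < e ->
            weighted (analytic_coef f) n <= e * q n + / e * sobolev_pair s f n).
  { intros e n He.
    assert (H1 : sobolev_weight s f (Z.of_nat n) <= sobolev_pair s f n).
    { assert (H2 := sobolev_weight_nonneg s f (- Z.of_nat (S n))). unfold sobolev_pair; lra. }
    apply Rle_trans with (e * q n + / e * sobolev_weight s f (Z.of_nat n)).
    2: { assert (Hi := Rinv_0_lt_compat e He).
         assert (H3 := Rmult_le_compat_l _ _ _ (Rlt_le _ _ Hi) H1). lra. }
    unfold weighted, analytic_coef, q, sobolev_weight.
    rewrite Cmod_mult, Cmod_R, <- INR_IZR_INZ.
    assert (Hm : Rabs (multiplicity n) <= 2).
    { destruct n; simpl; rewrite Rabs_pos_eq; lra. }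
    set (W := Rpower (1 + INR n ^ 2) s). assert (HW : 0 < W) by apply exp_pos.
    set (z := Cmod (fourier f (Z.of_nat n))). assert (Hz : 0 <= z) by apply Cmod_ge_0.
    assert (Hn := pos_INR n). set (m := 1 + INR n) in *. assert (Hm0 : 0 <= m) by (unfold m; lra).
    apply Rle_trans with (2 * m * z).
    { assert (Hmz : 0 <= m * z) by (apply Rmult_le_pos; auto). nra. }
    assert (Hsq : 0 <= (e * m - W * z) ^ 2 / (e * W)).
    { apply Rdiv_le_0_compat; [apply pow2_ge_0|apply Rmult_lt_0_compat; auto]. }
    replace ((e * m - W * z) ^ 2 / (e * W))
      with (e * (m ^ 2 / W) + / e * (W * z ^ 2) - 2 * m * z) in Hsq by (field; lra).
    lra. }
  assert (Hex : forall e, ex_series (fun n => e * q n + / e * sobolev_pair s f n)).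
  { intros e. apply (ex_series_plus (fun n => e * q n) (fun n => / e * sobolev_pair s f n));
      apply ex_series_Rscal; auto. }
  split.
  - apply ex_series_dominated with (1 := Hex 1). intros n.
    rewrite Rabs_pos_eq by apply weighted_nonneg. apply Hterm; lra.
  - intros e He Hn.
    apply Rle_trans with (Series (fun n => e * q n + / e * sobolev_pair s f n)).
    + apply Series_le; auto. intros n; split; [apply weighted_nonneg|apply Hterm; auto].
    + rewrite Series_plus, !Series_scal_l by (apply ex_series_Rscal; auto).
      rewrite Rmult_plus_distr_l, Rmult_1_r. apply Rplus_le_compat_l.
      assert (HS : 0 <= Series (sobolev_pair s f))
        by (apply Series_nonneg; auto using sobolev_pair_nonneg).
      unfold Hs_norm in Hn.
      assert (Hsq : Series (sobolev_pair s f) <= e * e).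
      { rewrite <- (sqrt_sqrt _ HS).
        assert (H0 := sqrt_pos (Series (sobolev_pair s f))). nra. }
      apply Rmult_le_reg_l with e; auto.
      rewrite <- Rmult_assoc, Rinv_r, Rmult_1_l by lra. exact Hsq.
Qed.

Lemma ex_series_sobolev_minus (s : R) (f g : R -> R) :
  in_Hs s f -> in_Hs s g -> ex_series (sobolev_pair s (fun x => f x - g x)).
Proof.
  intros [_ [Hfc Hf]] [_ [Hgc Hg]].
  assert (Hw : forall n, sobolev_weight s (fun x => f x - g x) n
                         <= 2 * sobolev_weight s f n + 2 * sobolev_weight s g n).
  { intros n. unfold sobolev_weight. rewrite fourier_minus by auto.
    set (a := fourier f n). set (b := fourier g n).
    assert (Ht := Cmod_triangle a (Copp b)). rewrite Cmod_opp in Ht.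
    change (Cplus a (Copp b)) with (Cminus a b) in Ht.
    assert (H0 := Cmod_ge_0 (Cminus a b)). assert (H1 := Cmod_ge_0 a). assert (H2 := Cmod_ge_0 b).
    assert (HW : 0 < Rpower (1 + IZR n ^ 2) s) by apply exp_pos.
    assert (Hsq : Cmod (Cminus a b) ^ 2 <= 2 * Cmod a ^ 2 + 2 * Cmod b ^ 2).
    { assert (H3 := pow2_ge_0 (Cmod a - Cmod b)). nra. }
    nra. }
  apply ex_series_dominated with (fun n => 2 * sobolev_pair s f n + 2 * sobolev_pair s g n).
  - apply (ex_series_plus (fun n => 2 * sobolev_pair s f n) (fun n => 2 * sobolev_pair s g n));
      apply ex_series_Rscal; auto.
  - intros n. rewrite Rabs_pos_eq by apply sobolev_pair_nonneg.
    assert (H1 := Hw (Z.of_nat n)). assert (H2 := Hw (- Z.of_nat (S n))%Z).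
    unfold sobolev_pair. lra.
Qed.

(** * From solutions to coefficient flows *)

Lemma in_Hs_wsummable (s : R) (f : R -> R) : 3 / 2 < s -> in_Hs s f ->
  wsummable (analytic_coef f).
Proof.
  intros Hs [_ [_ Hf]]. destruct (sobolev_controls_wnorm s Hs) as [K [_ HK]].
  apply HK, Hf.
Qed.

Lemma in_Hs_Fourier_series (s : R) (f : R -> R) : 3 / 2 < s -> in_Hs s f ->
  f = fun x => Re (mode_sum (analytic_coef f) (RtoC x)).
Proof.
  intros Hs Hf. assert (Hw := in_Hs_wsummable s f Hs Hf).
  destruct Hf as [Hp [Hc _]].
  apply functional_extensionality. intros x.
  apply Fourier_series; auto using wsummable_summable.
Qed.

(** The right-hand side of the equation: with f = u + i H u one has
    (u H u)_x / 2 = Im (f f_x) / 2, and f_x is i times the second factor. *)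
Definition velocity (a : nat -> C) (x : R) : R :=
  / 2 * Re (Cmult (mode_sum a (RtoC x)) (mode_sum (dcoef a) (RtoC x))).

Lemma is_derive_flux (a : nat -> C) (x : R) : wsummable a -> Im (a 0%nat) = 0 ->
  is_derive (fun y => Re (mode_sum a (RtoC y)) * Hilbert (fun z => Re (mode_sum a (RtoC z))) y) x
    (2 * velocity a x).
Proof.
  intros Ha H0.
  apply (is_derive_ext (fun y => Re (mode_sum a (RtoC y)) * Im (mode_sum a (RtoC y)))).
  - intros y. rewrite Hilbert_Re_mode_sum; auto.
  - destruct (Cder_mode_sum_real a x Ha) as [H1 H2].
    apply (is_derive_eq _ _ _ _ (is_derive_Rmult _ _ _ _ _ H1 H2)).
    unfold velocity, Re, Im; simpl. field.
Qed.

Lemma velocity_as_series (a : nat -> C) (x : R) : wsummable a ->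
  velocity a x = Re (mode_sum (fun n => Cmult (RtoC (1 / 2)) (conv a (dcoef a) n)) (RtoC x)).
Proof.
  intros Ha. assert (Hx : 0 <= Im (RtoC x)) by (simpl; lra).
  rewrite mode_sum_scal, mode_sum_conv; auto using summable_conv, wsummable_summable,
    wsummable_dcoef.
  unfold velocity, Re, Im; simpl. field.
Qed.

Lemma velocity_continuous_dependence (a b : nat -> C) (x : R) :
  wsummable a -> wsummable b -> wnorm (fun n => Cminus (a n) (b n)) <= 1 ->
  Rabs (velocity a x - velocity b x)
    <= (wnorm b + 1) * wnorm (fun n => Cminus (a n) (b n)).
Proof.
  intros Ha Hb H1. assert (Hx : 0 <= Im (RtoC x)) by (simpl; lra).
  set (c := fun n => Cminus (a n) (b n)) in *.
  assert (Hc : wsummable c) by (apply wsummable_minus; auto).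
  assert (HF : mode_sum a (RtoC x) = Cplus (mode_sum b (RtoC x)) (mode_sum c (RtoC x))).
  { unfold c. rewrite mode_sum_minus by auto using wsummable_summable. ring. }
  assert (HD : mode_sum (dcoef a) (RtoC x) = Cplus (mode_sum (dcoef b) (RtoC x)) (mode_sum
    (dcoef c) (RtoC x))).
  { rewrite (mode_sum_ext (dcoef c) (fun n => Cminus (dcoef a n) (dcoef b n))).
    - rewrite mode_sum_minus by auto using wsummable_dcoef. ring.
    - intros n. unfold dcoef, c. ring. }
  assert (B1 := Cmod_mode_sum_le_wnorm b (RtoC x) Hb Hx).
  assert (B2 := Cmod_mode_sum_deriv_le_wnorm b (RtoC x) Hb Hx).
  assert (B3 := Cmod_mode_sum_le_wnorm c (RtoC x) Hc Hx).
  assert (B4 := Cmod_mode_sum_deriv_le_wnorm c (RtoC x) Hc Hx).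
  unfold velocity. rewrite HF, HD.
  set (f := mode_sum b (RtoC x)) in *. set (g := mode_sum (dcoef b) (RtoC x)) in *.
  set (p := mode_sum c (RtoC x)) in *. set (q := mode_sum (dcoef c) (RtoC x)) in *.
  replace (/ 2 * Re (Cmult (Cplus f p) (Cplus g q)) - / 2 * Re (Cmult f g))
    with (/ 2 * Re (Cplus (Cmult p g) (Cmult (Cplus f p) q)))
    by (unfold Re; simpl; ring).
  rewrite Rabs_mult, (Rabs_pos_eq (/ 2)) by lra.
  assert (Hm : Rabs (Re (Cplus (Cmult p g) (Cmult (Cplus f p) q)))
               <= Cmod p * Cmod g + (Cmod f + Cmod p) * Cmod q).
  { eapply Rle_trans; [apply Rabs_Re_le|]. eapply Rle_trans; [apply Cmod_triangle|].
    rewrite !Cmod_mult. apply Rplus_le_compat_l, Rmult_le_compat_r; [apply Cmod_ge_0|].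
    apply Cmod_triangle. }
  set (N := wnorm b) in *. set (e := wnorm c) in *.
  assert (P1 := Cmod_ge_0 p). assert (P2 := Cmod_ge_0 g).
  assert (P3 := Cmod_ge_0 f). assert (P4 := Cmod_ge_0 q).
  assert (M1 : Cmod p * Cmod g <= e * N) by (apply Rmult_le_compat; auto).
  assert (M2 : (Cmod f + Cmod p) * Cmod q <= (N + e) * e)
    by (apply Rmult_le_compat; auto; lra).
  nra.
Qed.

(** The mean value inequality for r |-> u r x - r v t x bounds the error of the
    difference quotient uniformly in x. *)
Lemma is_derive_RInt_uniform (u v : R -> R -> R) (phi : R -> R) (t d0 a b : R) :
  0 < d0 -> a <= b ->
  (forall x, continuous phi x) -> (forall x, Rabs (phi x) <= 1) ->
  (forall r, Rabs (r - t) < d0 -> forall x, continuous (u r) x) ->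
  (forall x, continuous (v t) x) ->
  (forall r x, Rabs (r - t) < d0 -> is_derive (fun r => u r x) r (v r x)) ->
  (forall eps, 0 < eps -> exists d, 0 < d /\ forall r x, Rabs (r - t) < d ->
     Rabs (r - t) < d0 -> Rabs (v r x - v t x) <= eps) ->
  is_derive (fun r => RInt (fun x => u r x * phi x) a b) t
    (RInt (fun x => v t x * phi x) a b).
Proof.
  intros Hd0 Hab Hphi Hphi1 Hu Hv Hder Hunif.
  apply is_derive_Reals. intros eps Heps.
  assert (He : 0 < eps / (b - a + 1)) by (apply Rdiv_lt_0_compat; lra).
  destruct (Hunif _ He) as [d [Hd Hvd]].
  assert (Hm : 0 < Rmin d d0) by (apply Rmin_pos; auto).
  exists (mkposreal _ Hm). intros h Hh0 Hh. simpl in Hh.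
  assert (Hh1 := Rlt_le_trans _ _ _ Hh (Rmin_l _ _)).
  assert (Hh2 := Rlt_le_trans _ _ _ Hh (Rmin_r _ _)).
  assert (Hth : t + h - t = h) by ring.
  assert (Htt : Rabs (t - t) < d0).
  { replace (t - t) with 0 by ring. rewrite Rabs_R0; auto. }
  assert (C1 : forall x, continuous (fun x => u (t + h) x * phi x) x).
  { intros x. apply continuous_Rmult; auto. apply Hu. rewrite Hth; auto. }
  assert (C2 : forall x, continuous (fun x => u t x * phi x) x)
    by (intros; apply continuous_Rmult; auto).
  assert (C3 : forall x, continuous (fun x => v t x * phi x) x)
    by (intros; apply continuous_Rmult; auto).
  assert (C4 : forall x, continuous (fun x => / h * (u (t + h) x * phi x - u t x * phi x)) x).
  { intros. apply continuous_Rmult; [apply continuous_const|apply continuous_Rminus; auto]. }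
  replace ((RInt (fun x => u (t + h) x * phi x) a b - RInt (fun x => u t x * phi x) a b) / h)
    with (/ h * (RInt (fun x => u (t + h) x * phi x) a b - RInt (fun x => u t x * phi x) a b))
    by (unfold Rdiv; ring).
  rewrite <- RInt_Rminus, <- RInt_Rscal, <- RInt_Rminus;
    try (apply ex_RInt_cont; intros; auto using continuous_Rminus).
  apply Rle_lt_trans with ((b - a) * (eps / (b - a + 1))).
  - apply abs_RInt_le_const; auto.
    + apply ex_RInt_cont. intros; apply continuous_Rminus; auto.
    + intros x _.
      assert (Hbv := bounded_variation (fun r => u r x - r * v t x) (fun r => v r x - v t x)
                       (eps / (b - a + 1)) t (t + h)).
      cbv beta in Hbv. rewrite Hth in Hbv.
      assert (Hq : Rabs (u (t + h) x - (t + h) * v t x - (u t x - t * v t x))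
                   <= eps / (b - a + 1) * Rabs h).
      { apply Hbv. intros r Hr. split.
        - apply is_derive_Rminus; [apply Hder; lra|]. auto_derive; [exact I|ring].
        - apply Hvd; lra. }
      replace (/ h * (u (t + h) x * phi x - u t x * phi x) - v t x * phi x)
        with (/ h * (u (t + h) x - (t + h) * v t x - (u t x - t * v t x)) * phi x)
        by (field; auto).
      rewrite !Rabs_mult, Rabs_inv.
      assert (Hah : 0 < Rabs h) by (apply Rabs_pos_lt; auto).
      apply Rle_trans with (eps / (b - a + 1) * 1); [|lra].
      apply Rmult_le_compat; auto using Rabs_pos.
      * apply Rmult_le_pos; [left; apply Rinv_0_lt_compat; auto|apply Rabs_pos].
      * apply Rmult_le_reg_l with (Rabs h); auto.
        rewrite <- Rmult_assoc, Rinv_r, Rmult_1_l by lra. lra.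
  - apply Rmult_lt_reg_r with (b - a + 1); [lra|].
    replace ((b - a) * (eps / (b - a + 1)) * (b - a + 1)) with ((b - a) * eps) by (field; lra).
    nra.
Qed.

(** For s > 3/2 the right-hand side of the equation is continuous in time,
    uniformly in space, so the equation may be integrated against each mode; as
    the real part of a product of two series it has coefficients given by a
    Cauchy product. *)
Lemma solution_coef_flow (s T : R) (w0 : R -> R) (u : R -> R -> R) :
  3 / 2 < s -> is_solution s T w0 u -> coef_flow (fun t => analytic_coef (u t)) T.
Proof.
  intros Hs [[HHs Hcont] [_ Hpde]].
  destruct (sobolev_controls_wnorm s Hs) as [K [HK0 HK]].
  assert (Hw : forall t, 0 <= t < T -> wsummable (analytic_coef (u t))).
  { intros t Ht. apply (in_Hs_wsummable s); auto. }
  assert (Huc : forall t, 0 <= t < T -> forall x, continuous (u t) x)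
    by (intros t Ht; apply (HHs t Ht)).
  assert (Hc : forall t, 0 <= t < T -> forall eps, 0 < eps ->
     exists d, 0 < d /\ forall r, 0 <= r < T -> Rabs (r - t) < d ->
       wnorm (fun n => Cminus (analytic_coef (u r) n) (analytic_coef (u t) n)) < eps).
  { intros t Ht eps Heps.
    assert (He : 0 < eps / (K + 1)) by (apply Rdiv_lt_0_compat; lra).
    assert (HL := Hcont t Ht). rewrite filterlim_locally in HL.
    destruct (HL (mkposreal _ He)) as [d Hd].
    exists d. split; [apply cond_pos|]. intros r Hr Hrt.
    assert (Hb := Hd r Hrt Hr).
    change (Rabs (Hs_norm s (fun x => u r x - u t x) - 0) < eps / (K + 1)) in Hb.
    rewrite Rminus_0_r in Hb.
    destruct (HK (fun x => u r x - u t x)) as [_ Hn].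
    { apply ex_series_sobolev_minus; auto. }
    assert (Hle : Hs_norm s (fun x => u r x - u t x) <= eps / (K + 1)).
    { eapply Rle_trans; [apply Rle_abs|lra]. }
    specialize (Hn _ He Hle).
    replace (fun n => Cminus (analytic_coef (u r) n) (analytic_coef (u t) n))
      with (analytic_coef (fun x => u r x - u t x)).
    2: { apply functional_extensionality. intros n. apply analytic_coef_minus; auto. }
    eapply Rle_lt_trans; [exact Hn|].
    apply Rmult_lt_reg_r with (K + 1); [lra|].
    replace (eps / (K + 1) * K * (K + 1)) with (eps * K) by (field; lra). lra. }
  split; [exact Hw|split; [exact Hc|]].
  assert (Hut : forall t x, 0 < t < T ->
    is_derive (fun r => u r x) t (velocity (analytic_coef (u t)) x)).
  { intros t x Ht. destruct (Hpde t x Ht) as [Hex [_ Heq]].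
    apply Derive_correct in Hex. apply (is_derive_eq _ _ _ _ Hex).
    assert (Hflux := is_derive_flux (analytic_coef (u t)) x (Hw t ltac:(lra))
                       (analytic_coef_0_Im (u t))).
    assert (HFS := in_Hs_Fourier_series s (u t) Hs (HHs t ltac:(lra))).
    assert (Hflux' : is_derive (fun y => u t y * Hilbert (u t) y) x
                       (2 * velocity (analytic_coef (u t)) x)).
    { apply (is_derive_ext (fun y => Re (mode_sum (analytic_coef (u t)) (RtoC y))
               * Hilbert (fun z => Re (mode_sum (analytic_coef (u t)) (RtoC z))) y)); auto.
      intros y. rewrite <- HFS. f_equal.
      symmetry. exact (f_equal (fun f => f y) HFS). }
    assert (HD : Derive (fun y : R => u t y * Hilbert (u t) y) x
                 = 2 * velocity (analytic_coef (u t)) x)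
      by exact (is_derive_unique _ _ _ Hflux').
    change (Derive (fun r : R => u r x) t = velocity (analytic_coef (u t)) x). lra. }
  intros t n Ht.
  set (a := analytic_coef (u t)).
  assert (Ha : wsummable a) by (apply Hw; lra).
  set (b := fun n => Cmult (RtoC (1 / 2)) (conv a (dcoef a) n)).
  assert (Hb : summable b)
    by (apply summable_scal, summable_conv; auto using wsummable_summable, wsummable_dcoef).
  assert (Hb0 : Im (b 0%nat) = 0).
  { unfold b, conv, Csum_upto, dcoef, Re, Im; simpl. ring. }
  set (v := fun r x => velocity (analytic_coef (u r)) x).
  assert (Hvt : v t = fun x => Re (mode_sum b (RtoC x))).
  { apply functional_extensionality. intros x. unfold v, b. apply velocity_as_series; auto. }
  assert (Hvb : forall k, analytic_coef (v t) k = b k).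
  { intros k. rewrite Hvt. apply analytic_coef_Re_mode_sum; auto. }
  assert (Hvc : forall x, continuous (v t) x).
  { intros x. rewrite Hvt. apply continuous_Re_mode_sum; auto. }
  set (d0 := Rmin t (T - t)).
  assert (Hd0 : 0 < d0) by (apply Rmin_pos; lra).
  assert (Hr : forall r, Rabs (r - t) < d0 -> 0 < r < T).
  { intros r Hr. assert (Q1 := Rmin_l t (T - t)). assert (Q2 := Rmin_r t (T - t)).
    apply Rabs_def2 in Hr. unfold d0 in Hr. lra. }
  assert (HPI := PI_RGT_0).
  assert (HI : forall p, is_derive (fun r => RInt (fun x => u r x * cos (INR n * x + p)) (- PI)
    PI) t
                (RInt (fun x => v t x * cos (INR n * x + p)) (- PI) PI)).
  { intros p. apply (is_derive_RInt_uniform u v (fun x => cos (INR n * x + p)) t d0); auto; try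
    lra.
    - intros x. apply continuous_cos_lin.
    - intros x. apply Rabs_le, COS_bound.
    - intros r Hrd. apply Huc. assert (Q := Hr r Hrd). lra.
    - intros eps Heps.
      assert (HN : 0 < wnorm a + 1) by (assert (Q := wnorm_nonneg a Ha); lra).
      assert (He2 : 0 < Rmin 1 (eps / (wnorm a + 1)))
        by (apply Rmin_pos; [lra|apply Rdiv_lt_0_compat; lra]).
      destruct (Hc t ltac:(lra) _ He2) as [d [Hd Hdd]].
      exists d. split; auto. intros r x Hrd Hrd0.
      assert (Hrr := Hr r Hrd0). assert (Hlt := Hdd r ltac:(lra) Hrd).
      assert (Q1 := Rmin_l 1 (eps / (wnorm a + 1))).
      assert (Q2 := Rmin_r 1 (eps / (wnorm a + 1))).
      eapply Rle_trans;
        [apply (velocity_continuous_dependence (analytic_coef (u r)) a x); auto|].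
      + apply Hw; lra.
      + unfold a. lra.
      + apply Rle_trans with ((wnorm a + 1) * (eps / (wnorm a + 1))).
        * apply Rmult_le_compat_l; [lra|]. unfold a in *. lra.
        * right. field. lra. }
  change (Cder (fun r => analytic_coef (u r) n) t (b n)). rewrite <- Hvb.
  split.
  - apply (is_derive_ext (fun r => multiplicity n / (2 * PI) *
      RInt (fun x => u r x * cos (INR n * x + 0)) (- PI) PI)).
    + intros r. symmetry. apply analytic_coef_Re.
    + rewrite analytic_coef_Re. apply is_derive_scal, HI.
  - apply (is_derive_ext_loc (fun r => multiplicity n / (2 * PI) *
      RInt (fun x => u r x * cos (INR n * x + PI / 2)) (- PI) PI)).
    + exists (mkposreal _ Hd0). intros r Hrd. symmetry. apply analytic_coef_Im.
      apply Huc. assert (Q := Hr r Hrd). lra.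
    + rewrite analytic_coef_Im by auto. apply is_derive_scal, HI.
Qed.

(** * Flows with nonnegative initial coefficients *)

Lemma nondecreasing_from_start (f df : R -> R) (T : R) :
  (forall s, 0 < s < T -> is_derive f s (df s)) ->
  (forall s, 0 < s < T -> 0 <= df s) ->
  (forall eps, 0 < eps -> exists d, 0 < d /\ forall s, 0 < s < d -> Rabs (f s - f 0) < eps) ->
  forall t, 0 <= t < T -> f 0 <= f t.
Proof.
  intros Hd Hp Hc t Ht.
  destruct (Req_dec t 0) as [->|Ht0]; [lra|].
  apply Rnot_lt_le. intros Hlt.
  destruct (Hc (f 0 - f t)) as [d [Hd0 Hdd]]; [lra|].
  set (s := Rmin (d / 2) (t / 2)).
  assert (Hs1 : 0 < s) by (apply Rmin_pos; lra).
  assert (Hs2 : s <= d / 2) by apply Rmin_l.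
  assert (Hs3 : s <= t / 2) by apply Rmin_r.
  assert (Hfs := Hdd s ltac:(lra)). apply Rabs_def2 in Hfs.
  destruct (MVT_gen f s t df) as [c [Hcc Heq]].
  - intros r Hr. rewrite Rmin_left, Rmax_right in Hr by lra. apply Hd; lra.
  - intros r Hr. rewrite Rmin_left, Rmax_right in Hr by lra.
    apply continuity_pt_filterlim.
    exact (continuous_of_derive _ r _ (Hd r ltac:(lra))).
  - rewrite Rmin_left, Rmax_right in Hcc by lra.
    assert (Hq := Hp c ltac:(lra)). nra.
Qed.

Lemma coef_flow_continuous_at_0 (a : R -> nat -> C) (T : R) (n : nat) (eps : R) :
  0 < T -> coef_flow a T -> 0 < eps ->
  exists d, 0 < d /\ forall s, 0 < s < d -> Cmod (Cminus (a s n) (a 0 n)) < eps.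
Proof.
  intros HT [Hs [Hc _]] He.
  destruct (Hc 0 ltac:(lra) eps He) as [d [Hd Hdd]].
  exists (Rmin d T). split; [apply Rmin_pos; auto|]. intros s Hsd.
  assert (Q1 := Rmin_l d T). assert (Q2 := Rmin_r d T).
  eapply Rle_lt_trans; [|apply (Hdd s); [lra|rewrite Rminus_0_r, Rabs_pos_eq; lra]].
  set (b := fun n => Cminus (a s n) (a 0 n)).
  change (Cmod (b n) <= wnorm b).
  eapply Rle_trans; [apply Cmod_le_weighted|].
  apply term_le_Series; [|apply weighted_nonneg].
  apply wsummable_minus; apply Hs; lra.
Qed.

(** The multiplier [k] gives access to the real part (for 1) and to the
    imaginary part (for Ci and its opposite) in one statement. *)
Lemma coef_flow_lower_bound (a : R -> nat -> C) (T : R) (n : nat) (k : C) (g dg : R -> R) :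
  0 < T -> coef_flow a T ->
  (forall s, is_derive g s (dg s)) ->
  (forall s, 0 < s < T ->
     dg s <= Re (Cmult k (Cmult (RtoC (1 / 2)) (conv (a s) (dcoef (a s)) n)))) ->
  forall t, 0 <= t < T -> Re (Cmult k (a 0 n)) - g 0 <= Re (Cmult k (a t n)) - g t.
Proof.
  intros HT Hflow Hg Hle.
  apply (nondecreasing_from_start (fun t => Re (Cmult k (a t n)) - g t)
    (fun s => Re (Cmult k (Cmult (RtoC (1 / 2)) (conv (a s) (dcoef (a s)) n))) - dg s)).
  - intros s Hs. apply is_derive_Rminus; [|apply Hg].
    apply (Cder_scal k (fun s => a s n)). apply Hflow; auto.
  - intros s Hs. assert (H := Hle s Hs). lra.
  - intros eps He.
    assert (He2 : 0 < eps / 2 / (Cmod k + 1)).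
    { assert (H := Cmod_ge_0 k). apply Rdiv_lt_0_compat; lra. }
    destruct (coef_flow_continuous_at_0 a T n _ HT Hflow He2) as [d1 [Hd1 Hc1]].
    assert (Hgc := continuous_of_derive _ _ _ (Hg 0)).
    assert (He3 : 0 < eps / 2) by lra.
    destruct (proj1 (filterlim_locally _ _) Hgc (mkposreal _ He3)) as [d2 Hc2].
    exists (Rmin d1 d2). split; [apply Rmin_pos; [auto|apply cond_pos]|].
    intros s Hs. assert (Q1 := Rmin_l d1 d2). assert (Q2 := Rmin_r d1 d2).
    assert (B1 := Hc1 s ltac:(lra)).
    assert (B2 : Rabs (g s - g 0) < eps / 2).
    { apply (Hc2 s). change (Rabs (s - 0) < d2). rewrite Rminus_0_r, Rabs_pos_eq; lra. }
    assert (B3 : Rabs (Re (Cmult k (Cminus (a s n) (a 0 n)))) < eps / 2).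
    { eapply Rle_lt_trans; [apply Rabs_Re_le|]. rewrite Cmod_mult.
      assert (Hk := Cmod_ge_0 k).
      apply Rmult_lt_compat_r with (r := Cmod k + 1) in B1; [|lra].
      replace (eps / 2 / (Cmod k + 1) * (Cmod k + 1)) with (eps / 2) in B1 by (field; lra).
      assert (H0 := Cmod_ge_0 (Cminus (a s n) (a 0 n))). nra. }
    replace (Re (Cmult k (a s n)) - g s - (Re (Cmult k (a 0 n)) - g 0))
      with (Re (Cmult k (Cminus (a s n) (a 0 n))) - (g s - g 0))
      by (unfold Re; simpl; ring).
    eapply Rle_lt_trans; [apply Rabs_triang|]. rewrite Rabs_Ropp. lra.
Qed.

Definition nonneg_flow (a : R -> nat -> C) (T : R) (b : nat -> R) : Prop :=
  0 < T /\ coef_flow a T /\ (forall n, a 0 n = RtoC (b n)) /\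
  (forall n, 0 <= b n) /\ b 0%nat = 0.

Lemma flow_coef_0 (a : R -> nat -> C) (T : R) (b : nat -> R) (t : R) :
  nonneg_flow a T b -> 0 <= t < T -> a t 0%nat = 0.
Proof.
  intros [HT [Hflow [Hinit [Hb Hb0]]]] Ht.
  assert (Hzero : forall k : C, 0 <= Re (Cmult k (a t 0%nat))).
  { intros k.
    assert (H := coef_flow_lower_bound a T 0 k (fun _ => 0) (fun _ => 0) HT Hflow).
    rewrite Hinit, Hb0 in H.
    assert (H1 := H ltac:(intros; apply (is_derive_const (V := R_NormedModule)))
      ltac:(intros; unfold conv, Csum_upto, dcoef, Re, Im; simpl; lra) t Ht).
    revert H1. unfold Re; simpl. lra. }
  apply C_ext.
  - assert (H1 := Hzero 1). assert (H2 := Hzero (-1)).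
    revert H1 H2. unfold Re; simpl. lra.
  - assert (H1 := Hzero Ci). assert (H2 := Hzero (Copp Ci)).
    revert H1 H2. unfold Re, Im; simpl. lra.
Qed.

Definition nonneg_real_above (a : R -> nat -> C) (T : R) (b : nat -> R) (n : nat) : Prop :=
  forall t, 0 <= t < T -> Im (a t n) = 0 /\ b n <= Re (a t n).

(** The system is triangular, since a_0 = 0 and the factor [INR 0] kills the
    other occurrence of a_n. *)
Lemma conv_terms_nonneg (a : R -> nat -> C) (T : R) (b : nat -> R) (n : nat) :
  nonneg_flow a T b -> (forall m, (m < n)%nat -> nonneg_real_above a T b m) ->
  forall t, 0 <= t < T -> forall k,
    Im (Cmult (a t k) (dcoef (a t) (n - k)%nat)) = 0 /\
    0 <= Re (Cmult (a t k) (dcoef (a t) (n - k)%nat)).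
Proof.
  intros Hnf IH t Ht k. assert (Hb := proj1 (proj2 (proj2 (proj2 Hnf)))).
  destruct (Nat.eq_dec k 0) as [->|Hk].
  { rewrite (flow_coef_0 a T b) by auto. unfold Re, Im; simpl. lra. }
  destruct (le_lt_dec n k) as [Hnk|Hnk].
  { replace (n - k)%nat with 0%nat by lia. unfold dcoef, Re, Im; simpl. lra. }
  destruct (IH k ltac:(lia) t Ht) as [I1 R1].
  destruct (IH (n - k)%nat ltac:(lia) t Ht) as [I2 R2].
  assert (B1 := Hb k). assert (B2 := Hb (n - k)%nat). assert (Hp := pos_INR (n - k)).
  unfold dcoef. unfold Re, Im in *; simpl. rewrite I1, I2. split; [ring|].
  assert (0 <= fst (a t k) * (INR (n - k) * fst (a t (n - k)%nat))).
  { apply Rmult_le_pos; [lra|]. apply Rmult_le_pos; lra. }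
  lra.
Qed.

(** Strong induction along the triangular system: the derivative of a_n is a
    nonnegative combination of products of earlier coefficients. *)
Lemma flow_nonneg (a : R -> nat -> C) (T : R) (b : nat -> R) (n : nat) :
  nonneg_flow a T b -> nonneg_real_above a T b n.
Proof.
  intros Hnf. assert (Hnf' := Hnf). destruct Hnf' as [HT [Hflow [Hinit [Hb Hb0]]]].
  induction n as [n IH] using (well_founded_induction lt_wf).
  intros t Ht.
  assert (Hterms := conv_terms_nonneg a T b n Hnf IH).
  assert (Him : forall k : C, Re k = 0 -> 0 <= Re (Cmult k (a t n))).
  { intros k Hk.
    assert (H := coef_flow_lower_bound a T n k (fun _ => 0) (fun _ => 0) HT Hflow).
    rewrite Hinit in H.
    assert (H1 := H ltac:(intros; apply (is_derive_const (V := R_NormedModule)))).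
    specialize (H1 ltac:(intros s Hs;
      assert (Hz : Im (conv (a s) (dcoef (a s)) n) = 0)
        by (apply sum_eq_R0; intros j _; apply Hterms; lra);
      revert Hz Hk; unfold Re, Im; simpl; intros Hz Hk; rewrite Hz, Hk; lra) t Ht).
    revert H1 Hk. unfold Re; simpl. intros H1 Hk. rewrite Hk in *. lra. }
  split.
  - assert (H1 := Him Ci eq_refl). assert (H2 := Him (Copp Ci)).
    revert H1 H2. unfold Re, Im; simpl. intros H1 H2. specialize (H2 ltac:(lra)). lra.
  - assert (H := coef_flow_lower_bound a T n 1 (fun _ => 0) (fun _ => 0) HT Hflow).
    rewrite Hinit in H.
    assert (H1 := H ltac:(intros; apply (is_derive_const (V := R_NormedModule)))).
    specialize (H1 ltac:(intros s Hs;
      assert (Hz : 0 <= Re (conv (a s) (dcoef (a s)) n))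
        by (apply cond_pos_sum; intros j; apply Hterms; lra);
      revert Hz; unfold Re; simpl; intros Hz; lra) t Ht).
    revert H1. unfold Re; simpl. lra.
Qed.

(** The binomial coefficient C(n + k - 1, k). *)
Fixpoint growth (n k : nat) : R :=
  match k with
  | O => 1
  | S j => growth n j * ((INR n + INR j) / (INR j + 1))
  end.

(** Only the term a_1 a_(n+k) of the system is kept at each step; it transports
    the initial coefficient [b n] to higher and higher frequencies. *)
Lemma flow_cascade (a : R -> nat -> C) (T : R) (b : nat -> R) (n k : nat) (t : R) :
  nonneg_flow a T b -> (1 <= n)%nat -> 0 <= t < T ->
  b n * growth n k * (b 1%nat / 2) ^ k * t ^ k <= Re (a t (n + k)%nat).
Proof.
  intros Hnf Hn. assert (Hnf' := Hnf). destruct Hnf' as [HT [Hflow [Hinit [Hb Hb0]]]].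
  revert t. induction k as [|k IH]; intros t Ht.
  - rewrite Nat.add_0_r. simpl. destruct (flow_nonneg a T b n Hnf t Ht) as [_ H]. lra.
  - set (K := b n * growth n (S k) * (b 1%nat / 2) ^ S k).
    assert (H := coef_flow_lower_bound a T (n + S k) 1 (fun s => K * s ^ S k)
                   (fun s => K * (INR (S k) * s ^ k)) HT Hflow).
    assert (Hd : forall s, is_derive (fun s => K * s ^ S k) s (K * (INR (S k) * s ^ k))).
    { intros s.
      exact (is_derive_scal _ _ K _ (proj2 (is_derive_Reals _ _ _) (derivable_pt_lim_pow s (S
        k)))). }
    specialize (H Hd).
    assert (Hle : forall s, 0 < s < T -> K * (INR (S k) * s ^ k) <=
      Re (Cmult 1 (Cmult (RtoC (1 / 2)) (conv (a s) (dcoef (a s)) (n + S k))))).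
    { intros s Hs.
      assert (Hterms := conv_terms_nonneg a T b (n + S k) Hnf (fun m _ => flow_nonneg a T b m
        Hnf) s ltac:(lra)).
      assert (Hone : Re (Cmult (a s 1%nat) (dcoef (a s) (n + S k - 1)%nat))
                     <= Re (conv (a s) (dcoef (a s)) (n + S k))).
      { apply (term_le_sum (fun j => Re (Cmult (a s j) (dcoef (a s) (n + S k - j)%nat))));
          [lia|intros j; apply Hterms]. }
      replace (n + S k - 1)%nat with (n + k)%nat in Hone by lia.
      destruct (flow_nonneg a T b 1 Hnf s ltac:(lra)) as [I1 R1].
      destruct (flow_nonneg a T b (n + k) Hnf s ltac:(lra)) as [I2 _].
      assert (R2 := IH s ltac:(lra)).
      set (L := b n * growth n k * (b 1%nat / 2) ^ k * s ^ k) in *.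
      assert (HL : K * (INR (S k) * s ^ k) = / 2 * (b 1%nat * (INR (n + k) * L))).
      { unfold K, L. simpl growth. rewrite S_INR, plus_INR. simpl pow.
        assert (Hk := pos_INR k). field. lra. }
      assert (HL0 : 0 <= L).
      { unfold L. assert (Hg : forall j, 0 <= growth n j).
        { induction j; simpl; [lra|]. assert (Hj := pos_INR j). assert (Hn0 := pos_INR n).
          apply Rmult_le_pos; auto. apply Rdiv_le_0_compat; lra. }
        assert (B0 := Hb n). assert (B1 := Hb 1%nat).
        repeat apply Rmult_le_pos; auto; apply pow_le; lra. }
      assert (Hp := pos_INR (n + k)). assert (B1 := Hb 1%nat).
      assert (Hprod : b 1%nat * (INR (n + k) * L) <= Re (a s 1%nat) * (INR (n + k) * Re (a s (n
        + k)%nat))).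
      { apply Rmult_le_compat; auto.
        - apply Rmult_le_pos; auto.
        - apply Rmult_le_compat_l; auto. }
      rewrite HL.
      replace (Re (Cmult (a s 1%nat) (dcoef (a s) (n + k)%nat)))
        with (Re (a s 1%nat) * (INR (n + k) * Re (a s (n + k)%nat))) in Hone.
      2: { unfold dcoef. unfold Re, Im in *; simpl. rewrite I1, I2. ring. }
      replace (Re (Cmult 1 (Cmult (RtoC (1 / 2)) (conv (a s) (dcoef (a s)) (n + S k)))))
        with (/ 2 * Re (conv (a s) (dcoef (a s)) (n + S k)))
        by (unfold Re; simpl; field).
      lra. }
    specialize (H Hle t Ht). rewrite Hinit in H.
    assert (B0 := Hb (n + S k)%nat).
    rewrite pow_ne_zero in H by lia. revert H. unfold Re; simpl fst. intros H.
    replace (1 * t ^ S k) with (t ^ S k) in H by ring. simpl in *. lra.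
Qed.

(** * Smooth initial data without solution *)

(** Each of the [k] factors (M k + j) / (j + 1) with j < k is at least M. *)
Lemma growth_lower_bound (M k : nat) : (1 <= M)%nat -> INR M ^ k <= growth (M * k) k.
Proof.
  intros HM.
  assert (H : forall j, (j <= k)%nat -> INR M ^ j <= growth (M * k) j).
  { induction j as [|j IH]; intros Hj; simpl; [lra|].
    rewrite Rmult_comm. assert (HMp := pos_INR M). assert (Hjp := pos_INR j).
    apply Rmult_le_compat; auto using pow_le.
    - apply IH; lia.
    - apply Rmult_le_reg_r with (INR j + 1); [lra|].
      unfold Rdiv. rewrite Rmult_assoc, Rinv_l, Rmult_1_r by lra.
      rewrite mult_INR.
      assert (Hjk : INR j + 1 <= INR k) by (rewrite <- S_INR; apply le_INR; lia).
      assert (Hmk : INR M * (INR j + 1) <= INR M * INR k) by (apply Rmult_le_compat_l; auto).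
      lra. }
  apply H; lia.
Qed.

Lemma exp_INR (n : nat) : exp (INR n) = exp 1 ^ n.
Proof.
  induction n as [|n IH]; [apply exp_0|]. rewrite S_INR, exp_plus, IH. simpl. ring.
Qed.

(** Decay faster than any power but slower than any exponential. *)
Definition bad_coef (n : nat) : R := match n with O => 0 | S _ => exp (- sqrt (INR n)) end.

Lemma bad_coef_nonneg (n : nat) : 0 <= bad_coef n.
Proof. destruct n; [simpl; lra|left; apply exp_pos]. Qed.

Lemma bad_coef_rapid_decay (k : nat) : summable (dcoef_iter k (fun n => RtoC (bad_coef n))).
Proof.
  set (A := INR (Factorial.fact (2 * (k + 2)))).
  apply summable_dominated with (fun n => 4 * A * Rpower (INR n + 1) (Ropp 2)).
  { apply ex_series_Rscal, ex_series_Rpower. lra. }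
  intros n. rewrite Cmod_dcoef_iter, Cmod_R, Rabs_pos_eq by apply bad_coef_nonneg.
  assert (HA : 0 < A) by apply INR_fact_lt_0.
  destruct n as [|n].
  { simpl bad_coef. rewrite Rmult_0_r. apply Rmult_le_pos; [lra|left; apply exp_pos]. }
  unfold bad_coef. set (x := INR (S n)).
  assert (Hx : 1 <= x) by (unfold x; rewrite S_INR; assert (H := pos_INR n); lra).
  assert (Hs : 0 < sqrt x) by (apply sqrt_lt_R0; lra).
  assert (Hfac := exp_pow_le (2 * (k + 2)) (sqrt x) Hs). fold A in Hfac.
  rewrite pow_mult, pow2_sqrt in Hfac by lra.
  assert (Hp2 : Rpower (x + 1) 2 = (x + 1) ^ 2).
  { rewrite <- (Rpower_pow 2) by lra. f_equal. }
  rewrite Rpower_Ropp, Hp2.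
  rewrite pow_add in Hfac.
  apply Rmult_le_reg_r with (x ^ 2); [nra|].
  apply Rle_trans with A; [lra|].
  assert (Hq : (x + 1) ^ 2 <= 4 * x ^ 2) by nra.
  apply Rmult_le_reg_r with ((x + 1) ^ 2); [nra|].
  replace (4 * A * / (x + 1) ^ 2 * x ^ 2 * (x + 1) ^ 2) with (A * (4 * x ^ 2)) by (field; nra).
  apply Rmult_le_compat_l; lra.
Qed.

Lemma summable_dcoef_iter_wsummable (c : nat -> C) :
  (forall k, summable (dcoef_iter k c)) -> wsummable c.
Proof.
  intros H.
  apply ex_series_ext with (fun n => Cmod (dcoef_iter 0 c n) + Cmod (dcoef_iter 1 c n)).
  - intros n. rewrite !Cmod_dcoef_iter. unfold weighted. eq_R. simpl. ring.
  - apply (ex_series_plus (fun n => Cmod (dcoef_iter 0 c n)) (fun n => Cmod (dcoef_iter 1 c n)));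
      apply H.
Qed.

Lemma smooth_periodic_mode_sum (c : nat -> C) : (forall k, summable (dcoef_iter k c)) ->
  smooth_periodic (fun x => Re (mode_sum c (RtoC x))).
Proof.
  intros Hc. split.
  - intros x. rewrite mode_sum_periodic. reflexivity.
  - intros n x.
    apply (smooth_of_closed_class (fun _ => True)
      (fun phi => exists k c, (forall j, summable (dcoef_iter j c)) /\
                  forall x, phi x = Cmult k (mode_sum c (RtoC x)))) with (phi := fun x =>
                    mode_sum c (RtoC x));
      auto.
    + intros y _. apply filter_forall. auto.
    + intros phi [k [d [Hd Hphi]]].
      exists (fun x => Cmult (Cmult k Ci) (mode_sum (dcoef d) (RtoC x))). split.
      * exists (Cmult k Ci), (dcoef d). split; auto. intros j.
        apply summable_dominated with (1 := Hd (S j)). intros m. right.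
        rewrite !Cmod_dcoef_iter. unfold dcoef. rewrite Cmod_mult, Cmod_R, Rabs_pos_eq by apply
          pos_INR.
        simpl. ring.
      * intros y _. apply (Cder_ext_loc (fun s => Cmult k (mode_sum d (RtoC s)))).
        { apply filter_forall. auto. }
        apply (Cder_eq _ _ _ _ (Cder_scal k _ _ _
                 (Cder_mode_sum_real d y (summable_dcoef_iter_wsummable d Hd)))).
        ring.
    + exists (RtoC 1), c. split; auto. intros y. ring.
Qed.

(** At any positive time the cascade makes coefficients of arbitrarily high order
    at least 1. *)
Lemma bad_coef_no_flow (a : R -> nat -> C) (T : R) : 0 < T -> coef_flow a T ->
  (forall n, a 0 n = RtoC (bad_coef n)) -> False.
Proof.
  intros HT Hflow Hinit.
  assert (Hnf : nonneg_flow a T bad_coef).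
  { split; [exact HT|split; [exact Hflow|split; [exact Hinit|split]]].
    - apply bad_coef_nonneg.
    - reflexivity. }
  set (t := T / 2). assert (Ht : 0 <= t < T) by (unfold t; lra).
  set (theta := bad_coef 1 / 2 * t).
  assert (Hth : 0 < theta).
  { unfold theta, t. apply Rmult_lt_0_compat; [|lra].
    assert (H := exp_pos (- sqrt (INR 1))). unfold bad_coef. lra. }
  destruct (INR_unbounded (2 / theta + 1)) as [M HM].
  assert (HM2 : 2 <= INR M * theta).
  { assert (Hlt : 2 / theta < INR M) by lra.
    apply (Rmult_lt_compat_r theta) in Hlt; auto.
    unfold Rdiv in Hlt. rewrite Rmult_assoc, Rinv_l, Rmult_1_r in Hlt by lra. lra. }
  assert (HM1 : (1 <= M)%nat).
  { destruct M; [simpl in HM2; lra|lia]. }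
  assert (Hwt : wsummable (a t)) by (apply Hflow; auto).
  destruct (INR_unbounded (wnorm (a t) + 2)) as [q Hq].
  assert (Hw0 := wnorm_nonneg _ Hwt).
  assert (Hq2 : (2 <= q)%nat) by (apply INR_le; simpl; lra).
  (* M theta >= 2 beats the decay exp(- sqrt n) for n = M k; k = M q^2 makes
     n a perfect square *)
  set (k := (M * q * q)%nat). set (n := (M * k)%nat).
  assert (Hn1 : (1 <= n)%nat) by (unfold n, k; nia).
  assert (Hcas := flow_cascade a T bad_coef n k t Hnf Hn1 Ht).
  assert (Hgr := growth_lower_bound M k HM1). fold n in Hgr.
  assert (Hbn : bad_coef n = / exp (INR (M * q))).
  { assert (Hexp : forall m, (1 <= m)%nat -> bad_coef m = exp (- sqrt (INR m)))
      by (intros [|m] Hm; [lia|reflexivity]).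
    rewrite <- exp_Ropp, Hexp by exact Hn1. f_equal. f_equal.
    apply sqrt_lem_1; try apply pos_INR.
    rewrite <- mult_INR. f_equal. unfold n, k. lia. }
  assert (Hone : 1 <= bad_coef n * growth n k * (bad_coef 1 / 2) ^ k * t ^ k).
  { replace (bad_coef n * growth n k * (bad_coef 1 / 2) ^ k * t ^ k)
      with (bad_coef n * (growth n k * theta ^ k))
      by (unfold theta; rewrite Rpow_mult_distr; ring).
    assert (H2k : 2 ^ k <= growth n k * theta ^ k).
    { apply Rle_trans with ((INR M * theta) ^ k); [apply pow_incr; lra|].
      rewrite Rpow_mult_distr. apply Rmult_le_compat_r; auto. apply pow_le; lra. }
    assert (He : exp (INR (M * q)) <= 2 ^ k).
    { unfold k. replace (M * q * q)%nat with (q * (M * q))%nat by lia.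
      rewrite pow_mult, exp_INR. apply pow_incr. split; [left; apply exp_pos|].
      apply Rle_trans with 3; [apply exp_le_3|].
      apply Rle_trans with (2 ^ 2); [lra|]. apply Rle_pow; [lra|auto]. }
    rewrite Hbn. assert (Hpos := exp_pos (INR (M * q))).
    apply Rmult_le_reg_l with (exp (INR (M * q))); auto.
    rewrite <- Rmult_assoc, Rinv_r, Rmult_1_l, Rmult_1_r by lra. lra. }
  assert (Hsmall := term_le_Series _ (n + k)%nat Hwt (weighted_nonneg (a t))).
  fold (wnorm (a t)) in Hsmall. unfold weighted in Hsmall.
  assert (Hre := Rabs_Re_le (a t (n + k)%nat)). assert (Habs := Rle_abs (Re (a t (n + k)%nat))).
  assert (Hqn : INR q <= INR (n + k)) by (apply le_INR; unfold n, k; nia).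
  assert (Hmod : 1 <= Cmod (a t (n + k)%nat)) by lra.
  assert (Hnk := pos_INR (n + k)). nra.
Qed.

Theorem theorem4p1 :
  (forall (s : R) (w0 : R -> R),
     3 / 2 < s ->
     in_Hs s w0 ->
     RInt w0 (- PI) PI = 0 ->
     (exists x0 : R, 0 < w0 x0 /\ ~ smooth_at w0 x0) ->
     forall T : R, 0 < T ->
       ~ exists u : R -> R -> R, is_solution s T w0 u)
  /\
  (exists w0 : R -> R,
     smooth_periodic w0 /\
     RInt w0 (- PI) PI = 0 /\
     forall s T : R, 3 / 2 < s -> 0 < T ->
       ~ exists u : R -> R -> R, is_solution s T w0 u).
Proof.
  split.
  - intros s w0 Hs Hw0 _ [x0 [Hpos Hns]] T HT [u Hu].
    apply Hns.
    assert (Hflow := solution_coef_flow s T w0 u Hs Hu).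
    assert (Hu0 : u 0 = w0) by (apply functional_extensionality; apply Hu).
    assert (HFS := in_Hs_Fourier_series s w0 Hs Hw0).
    rewrite HFS in Hpos |- *. rewrite <- Hu0 in Hpos |- *.
    exact (coef_flow_initial_smooth _ T x0 HT Hflow Hpos).
  - set (c := fun n => RtoC (bad_coef n)).
    assert (Hc : forall k, summable (dcoef_iter k c)) by apply bad_coef_rapid_decay.
    assert (Hsum := wsummable_summable _ (summable_dcoef_iter_wsummable c Hc)).
    exists (fun x => Re (mode_sum c (RtoC x))). split; [|split].
    + apply smooth_periodic_mode_sum, Hc.
    + assert (H := RInt_Re_mode_sum_cos c 0 0 Hsum). simpl in H.
      rewrite !Rmult_0_l, !Rmult_0_r in H. rewrite <- H.
      apply RInt_Rext. intros x _. simpl. rewrite Rmult_0_l, Rplus_0_r, cos_0. ring.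
    + intros s T Hs HT [u Hu].
      assert (Hflow := solution_coef_flow s T _ u Hs Hu).
      apply (bad_coef_no_flow _ T HT Hflow). intros n.
      assert (Hu0 : u 0 = fun x => Re (mode_sum c (RtoC x)))
        by (apply functional_extensionality; apply Hu).
      rewrite Hu0. apply analytic_coef_Re_mode_sum; auto.
Qed.
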